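(* Let $u$ be real with $-\infty<u<1$. Let $(x,y,z)$ be a point of the unit ball $x^2+y^2+z^2\le1$ and $r=\sqrt{x^2+y^2+z^2}$. As $n\to\infty$, the asymptotics of the relative entropy $S(\overset{n}{\otimes}\rho,\zeta_n(u))$ of $\overset{n}{\otimes}\rho$ with respect to $\zeta_n(u)$ for a fixed $r$ with $0\le r<1$ is given by $$\frac32\log n-\frac12-\frac32\log2-(1-u)\log(1-r^2)+\frac1{2r}\log\left(\frac{1-r}{1+r}\right)+\log\Gamma(1-u)-\log\Gamma(5/2-u)+O\left(\frac1n\right).\qquad( * )$$ In the case $r=0$, this means that the asymptotics is given by the expression $( * )$ in the limit $r\downarrow0$, i.e., by $$\frac32\log n-\frac32-\frac32\log2+\log\Gamma(1-u)-\log\Gamma(5/2-u)+O\left(\frac1n\right).$$ For any fixed $\varepsilon>0$, the $O(\cdot)$ term in $( * )$ is uniform in $u$ and $r$ as long as $0\le r\le1-\varepsilon$. For $r=1$ the asymptotics is given by $$(2-u)\log n+(2u-3)\log2+\frac12\log\pi-\log\Gamma(5/2-u)+O\left(\frac1n\right).$$ Also here, the $O(\cdot)$ term is uniform in $u$.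
   Context: For $(x,y,z)$ in the unit ball, $$\rho=\frac12\begin{pmatrix}1+z & x-iy \\ x+iy & 1-z\end{pmatrix},$$ and $\overset{n}{\otimes}\rho$ is its $n$-fold tensor power, a $2^n\times2^n$ density matrix. The matrix $\zeta_n(u)$ is the average $$\zeta_n(u)=\int_{x^2+y^2+z^2\le1}\Big(\overset{n}{\otimes}\rho\Big)\,q(u)\,dx\,dy\,dz,\qquad q(u)=\frac{\Gamma(5/2-u)}{\pi^{3/2}\,\Gamma(1-u)\,(1-x^2-y^2-z^2)^u},\quad -\infty<u<1.$$ The relative entropy of a density matrix $\rho_1$ with respect to a density matrix $\rho_2$ is $S(\rho_1,\rho_2)=\operatorname{Tr}\rho_1(\log\rho_1-\log\rho_2)$; $\log$ is the natural logarithm and $0\log0=0$. The relative entropy $S(\overset{n}{\otimes}\rho,\zeta_n(u))$ depends on $(x,y,z)$ only through $r$.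
   Formalization: Uniformity in u over all u<1 is false (for fixed n the error is unbounded as u→−∞, and for r<1 also as u→1), so the O(1/n) term is stated uniform for a≤u≤b<1 when 0≤r≤1−ε, and for a≤u<1 when r=1, with a, b arbitrary. *)

(* Defs.v *)
From mathcomp Require Import all_boot all_order all_algebra.
From mathcomp Require Import complex mxtens.
From mathcomp Require Import all_classical all_reals all_analysis.

Set Implicit Arguments.
Unset Strict Implicit.
Unset Printing Implicit Defensive.

Import Order.TTheory GRing.Theory Num.Theory.
Import numFieldNormedType.Exports.

Local Open Scope classical_set_scope.
Local Open Scope ring_scope.
Local Open Scope complex_scope.

Section Definitions.
Variable R : realType.

(* Euler's integral; meaningful for 0 < s only. *)
Definition Gamma (s : R) : R :=
  \int[lebesgue_measure]_(t in `]0, +oo[) (t `^ (s - 1) * expR (- t)).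

(* A point (x, y, z) of R^3 is encoded as the nested pair ((x, y), z). *)
Definition normsq3 (p : R * R * R) : R :=
  p.1.1 ^+ 2 + p.1.2 ^+ 2 + p.2 ^+ 2.

Definition norm3 (p : R * R * R) : R := Num.sqrt (normsq3 p).

Definition unit_ball3 : set (R * R * R) := [set p | normsq3 p <= 1].

Definition lebesgue_measure3 : set (R * R * R) -> \bar R :=
  ((lebesgue_measure \x lebesgue_measure) \x lebesgue_measure)%E.

Definition qubit (p : R * R * R) : 'M[R[i]]_2 :=
  let: (x, y, z) := p in
  (2^-1)%:C *: \matrix_(i < 2, j < 2)
    if i == 0 then (if j == 0 then (1 + z)%:C else x -i* y)
    else (if j == 0 then x +i* y else (1 - z)%:C).

Definition prior (u : R) (p : R * R * R) : R :=
  Gamma (5 / 2 - u) /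
  (pi `^ (3 / 2) * Gamma (1 - u) * (1 - normsq3 p) `^ u).

(* The matrix-valued integral is taken entrywise, real and imaginary parts
   separately. *)
Definition zeta (n : nat) (u : R) : 'M[R[i]]_(2 ^ n) :=
  \matrix_(i, j)
    ((\int[lebesgue_measure3]_(p in unit_ball3)
        (complex.Re ((qubit p ^t n) i j) * prior u p)) +i*
     (\int[lebesgue_measure3]_(p in unit_ball3)
        (complex.Im ((qubit p ^t n) i j) * prior u p))).

(* Logarithm of a positive semidefinite Hermitian matrix, by functional
   calculus: ln acts on the eigenvalues in an orthonormal eigenbasis.  Since
   ln 0 = 0, a zero eigenvalue is sent to 0; in particular A *m mxlog A obeys
   the convention 0 log 0 = 0. *)
Definition mxlog (m : nat) (A : 'M[R[i]]_m) : 'M[R[i]]_m :=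
  invmx (spectralmx A)
  *m diag_mx (map_mx (fun l : R[i] => (ln (complex.Re l))%:C) (spectral_diag A))
  *m spectralmx A.

(* The usual relative entropy when the support of A is contained in that of B
   (in particular when B is positive definite, as zeta n u is for u < 1); the trace is
   then real.  The value +oo of the other case is not represented. *)
Definition relative_entropy (m : nat) (A B : 'M[R[i]]_m) : R :=
  complex.Re (\tr (A *m (mxlog A - mxlog B))).

Definition redundancy (u : R) (p : R * R * R) (n : nat) : R :=
  relative_entropy (qubit p ^t n) (zeta n u).

(* At r = 0 the term log((1-r)/(1+r))/(2r) is given its limit as r -> 0+. *)
Definition mixed_asymp (u r : R) (n : nat) : R :=
  3 / 2 * ln n%:R - 1 / 2 - 3 / 2 * ln 2 - (1 - u) * ln (1 - r ^+ 2)
  + (if r == 0 then -1 else 1 / (2 * r) * ln ((1 - r) / (1 + r)))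
  + ln (Gamma (1 - u)) - ln (Gamma (5 / 2 - u)).

Definition center_asymp (u : R) (n : nat) : R :=
  3 / 2 * ln n%:R - 3 / 2 - 3 / 2 * ln 2
  + ln (Gamma (1 - u)) - ln (Gamma (5 / 2 - u)).

Definition pure_asymp (u : R) (n : nat) : R :=
  (2 - u) * ln n%:R + (2 * u - 3) * ln 2 + 1 / 2 * ln pi
  - ln (Gamma (5 / 2 - u)).

End Definitions.

(* Main.v *)
(* The average zeta_n(u) is invariant under rotations of the Bloch ball, hence commutes with the
   n-fold tensor power of every rotation and acts as a scalar on each isotypic component of the
   n-qubit space.  Evaluated on a highest weight vector with k ones, this scalar is the integral
   over the ball of ((1 + z) / 2)^(n - 2k) ((1 - r^2) / 4)^k against the prior, a quotient of Gamma
   functions.  So if P_k projects onto the basis vectors with k ones, Tr (log zeta_n(u) P_k) has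
   increments (C(n, k + 1) - C(n, k)) log lambda_(k + 1); after diagonalizing rho by a rotation,
   summation by parts turns r Tr (rho^n log zeta_n(u)) into a difference of Bernstein polynomials
   of log Gamma.

   The derivative of such a Bernstein polynomial is one of log, whose own derivative is explicit up
   to O(n^-2).  Integrating back twice from the endpoint 1, where Stirling's formula applies, gives
   the asymptotics uniformly for 0 < r <= 1 - eps.  The case r = 0 follows by letting r tend to 0,
   and at r = 1 only the top eigenvalue lambda_0 contributes. *)
Require Import Defs.
From HB Require Import structures.
From mathcomp Require Import all_boot all_order all_algebra.
From mathcomp Require Import complex mxtens.
From mathcomp Require Import all_classical all_reals all_analysis.
From mathcomp Require Import measurable_realfun gauss_integral zify ring lra.
Import Order.TTheory GRing.Theory Num.Theory.
Import numFieldNormedType.Exports.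
Local Open Scope classical_set_scope.
Local Open Scope ring_scope.

Set Implicit Arguments.
Unset Strict Implicit.
Unset Printing Implicit Defensive.

(** * Gamma, Beta and ball integrals *)

Section Affine.
Context {R : realType}.
Notation mu := (@lebesgue_measure R).

(** Rotations are parametrized by the tangent t of the half angle. A plane rotation is then a
    product of three shears, so its invariance comes from translation invariance and Tonelli; its
    lift to two by two matrices is 1 + t X up to a scalar, so tensor powers are polynomial in t and
    comparing coefficients of t replaces differentiation at the identity. Weight projections, ladder
    operators and traces stand in for a decomposition into irreducible components.

    Gamma identities are proved in the extended nonnegative reals, and finiteness and positivity are
    then deduced from them.

    The delicate point is uniformity as r tends to 0, because the Bernstein difference must be
    divided by r. The symmetry of the eigenvalues under k -> n + 1 - k makes the log Gamma part
    carry an explicit factor r. What remains is an increment between t and s of q times a binomial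
    mean of log; the mean value theorem bounds its error by O(r / n), which separate estimates at s
    and t would not give. The condition r <= 1 - eps keeps s and t away from 0, where the binomial
    means of log lose uniformity. *)

Lemma measurable_affine (a b : R) :
  @measurable_fun _ _ (measurableTypeR R) (measurableTypeR R) setT (fun x => a * x + b).
Proof. by apply: measurable_funD => //; exact: measurable_funM. Qed.

Lemma affine_preimage_itvoc (a b c d : R) : 0 < a ->
  (fun x => a * x + b) @^-1` `]c, d] = `](c - b) / a, (d - b) / a]%classic.
Proof.
move=> a0; apply/seteqP; split => x /=; rewrite !in_itv/= ltr_pdivrMr// ler_pdivlMr//;
  by rewrite ltrBlDr lerBrDr (mulrC x).
Qed.

(** The pushforward scaled by [a] is a measure with the Lebesgue value on half-open intervals, so
    uniqueness of Lebesgue measure applies. *)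
Lemma lebesgue_measure_affine (a b : R) (A : set (measurableTypeR R)) (a0 : 0 < a) : measurable A ->
  (a%:E * mu ((fun x => a * x + b)%R @^-1` A))%E = mu A.
Proof.
move=> mA.
suff : mscale (NngNum (ltW a0)) (pushforward mu (fun x : measurableTypeR R => (a * x + b : measurableTypeR R))) A = mu A.
  by move/(_ (measurable_affine a b)).
move=> maff; apply/esym/lebesgue_measure_unique => //=.
move=> _ [[c d] /= _ <-]; rewrite /mscale/= /pushforward/= affine_preimage_itvoc//.
rewrite !lebesgue_measure_itv/= !lte_fin.
rewrite ltr_pM2r ?invr_gt0// ltrD2r; case: ifPn => _; last by rewrite mule0.
by rewrite -!EFinD -EFinM; congr (_%:E); field; rewrite gt_eqF.
Qed.

Lemma ge0_integral_affine (a b : R) (f : R -> \bar R) : 0 < a ->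
  measurable_fun [set: R] f -> (forall x, 0 <= f x)%E ->
  (a%:E * \int[mu]_x f (a * x + b)%R = \int[mu]_x f x)%E.
Proof.
move=> a0 mf f0.
rewrite -(@ge0_integral_pushforward _ _ _ _ _ _ (measurable_affine a b) mu setT) //.
rewrite -(@ge0_integral_mscale _ _ _ _ setT _ (NngNum (ltW a0)))//; first exact: measurable_affine.
move=> maff; apply: eq_measure_integral => A mA _.
by rewrite -[RHS](lebesgue_measure_affine b a0)//.
Qed.

Lemma ge0_integral_translate (b : R) (f : R -> \bar R) :
  measurable_fun [set: R] f -> (forall x, 0 <= f x)%E ->
  (\int[mu]_x f (x + b)%R = \int[mu]_x f x)%E.
Proof.
move=> mf f0; rewrite -[RHS](@ge0_integral_affine 1 b)// mul1e.
by apply: eq_integral => x _; rewrite mul1r.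
Qed.
End Affine.

Lemma ge0_EFin_integralZl {R : realType} d (T : measurableType d) (m : {measure set T -> \bar R})
    (k : R) (f : T -> R) : 0 <= k -> measurable_fun setT f -> (forall x, 0 <= f x) ->
  (k%:E * \int[m]_x (f x)%:E = \int[m]_x (k * f x)%:E)%E.
Proof.
move=> k0 mf f0; rewrite -ge0_integralZl_EFin//; last exact/measurable_EFinP.
by move=> x _; rewrite lee_fin.
Qed.

(** * Convolution identities for Gamma and Beta in the extended reals *)

Section PositivePower.
Context {R : realType}.
Notation mu := (@lebesgue_measure R).

(** Extending powers by zero to nonpositive bases encodes the domain in the integrand: half-lines,
    intervals and balls all become integrals over the whole space, ready for substitution and
    Tonelli. *)
Definition ppow (w a : R) : R := if 0 < w then w `^ a else 0.

Lemma ppow_ge0 w a : 0 <= ppow w a.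
Proof. by rewrite /ppow; case: ifP => // _; rewrite powR_ge0. Qed.

Lemma ppow_gt0 w a : 0 < w -> ppow w a = w `^ a.
Proof. by rewrite /ppow => ->. Qed.

Lemma ppow_le0 w a : w <= 0 -> ppow w a = 0.
Proof. by rewrite /ppow leNgt => /negbTE ->. Qed.

Lemma ppowM k w a : 0 < k -> ppow (k * w) a = ppow k a * ppow w a.
Proof.
move=> k0; rewrite /ppow k0 pmulr_rgt0//; case: ifPn => w0; last by rewrite mulr0.
by rewrite powRM// ltW.
Qed.

Lemma ppowD w a b : ppow w (a + b) = ppow w a * ppow w b.
Proof.
rewrite /ppow; case: ifPn => w0; last by rewrite mulr0.
by rewrite powRD// (gt_eqF w0) implybT.
Qed.

Lemma measurable_ppow d (T : measurableType d) (f : T -> R) a :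
  measurable_fun setT f -> measurable_fun setT (fun x => ppow (f x) a).
Proof.
move=> mf; rewrite /ppow; apply: measurable_fun_ifT => //.
- exact: measurable_fun_ltr.
- by apply: (measurableT_comp (measurable_powR a) mf).
Qed.

(** Extended-real form of Euler's integral; [eGammaE] identifies it with [Gamma] once finiteness is
    known. *)
Definition eGamma (s : R) : \bar R := (\int[mu]_t (ppow t (s - 1) * expR (- t))%:E)%E.

Lemma GammaE s : Gamma s = fine (eGamma s).
Proof.
rewrite /Gamma /Rintegral integral_mkcond /eGamma; congr fine.
apply: eq_integral => t _; rewrite patchE /ppow.
have [t0|t0] := boolP (0 < t); first by rewrite mem_set//= in_itv/= t0.
by rewrite memNset/= ?mul0r// in_itv/= (negbTE t0).
Qed.

(* The inner integral is translated by h x, then the order of integration is exchanged. *)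
Lemma eGamma_convolution (phi h : R -> R) (c : R) :
  measurable_fun setT phi -> measurable_fun setT h -> (forall x, 0 <= phi x) ->
  ((\int[mu]_x (phi x * expR (- h x))%:E) * eGamma c =
   \int[mu]_w ((expR (- w))%:E * \int[mu]_x (phi x * ppow (w - h x) (c - 1))%:E))%E.
Proof.
move=> mphi mh phi0.
have mF : measurable_fun setT (fun p : R * R => phi p.1 * expR (- p.2) * ppow (p.2 - h p.1) (c - 1)).
  apply: measurable_funM; first apply: measurable_funM.
  - exact: measurableT_comp mphi measurable_fst.
  - by apply: measurableT_comp => //; apply: measurableT_comp.
  - apply: measurable_ppow; apply: measurable_funB => //.
    exact: measurableT_comp mh measurable_fst.
have F0 p : 0 <= phi p.1 * expR (- p.2) * ppow (p.2 - h p.1) (c - 1).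
  by rewrite !mulr_ge0 ?expR_ge0 ?ppow_ge0.
have mG : measurable_fun setT (fun t : R => (ppow t (c - 1) * expR (- t))%:E).
  apply/measurable_EFinP; apply: measurable_funM; first exact: measurable_ppow.
  by apply: measurableT_comp => //.
transitivity (\int[mu]_x \int[mu]_w (phi x * expR (- w) * ppow (w - h x) (c - 1))%:E)%E; last first.
  rewrite -(@fubini_tonelli1 _ _ _ _ _ mu mu (fun p => (phi p.1 * expR (- p.2) * ppow (p.2 - h p.1) (c - 1))%:E)); last 2 first.
    exact/measurable_EFinP.
    by move=> x; rewrite lee_fin.
  rewrite fubini_tonelli2; last 2 first.
    exact/measurable_EFinP.
    by move=> x; rewrite lee_fin.
  apply: eq_integral => w _ /=; rewrite /fubini_G.
  rewrite -ge0_integralZl//=.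
  - by apply: eq_integral => x _; rewrite -EFinM; congr (_%:E); ring.
  - apply/measurable_EFinP; apply: measurable_funM => //.
    by apply: measurable_ppow; apply: measurable_funB.
  - by move=> x _; rewrite lee_fin mulr_ge0 ?ppow_ge0.
rewrite muleC -ge0_integralZl//=; last 3 first.
- by apply/measurable_EFinP; apply: measurable_funM => //; apply: measurableT_comp => //; exact: measurableT_comp.
- by move=> x _; rewrite lee_fin mulr_ge0 ?expR_ge0.
- by apply: integral_ge0 => x _; rewrite lee_fin mulr_ge0 ?expR_ge0 ?ppow_ge0.
apply: eq_integral => x _.
rewrite muleC /eGamma -(@ge0_integral_translate _ (- h x))//; last first.
  by move=> t; rewrite lee_fin mulr_ge0 ?expR_ge0 ?ppow_ge0.
rewrite -ge0_integralZl//=.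
- apply: eq_integral => w _; rewrite -EFinM; congr (_%:E).
  by rewrite opprD opprK expRD; have := expRxMexpNx_1 (h x); set e := expR (- h x); set e' := expR (h x) => E; rewrite -[RHS]mulr1 -E; ring.
- apply: (measurableT_comp mG); exact: measurable_funD.
- by move=> t _; rewrite lee_fin mulr_ge0 ?expR_ge0 ?ppow_ge0.
- by rewrite lee_fin mulr_ge0 ?expR_ge0.
Qed.

Definition eBeta (x y : R) : \bar R := (\int[mu]_s (ppow s (x - 1) * ppow (1 - s) (y - 1))%:E)%E.
(** The integrand is supported in ]-1, 1[. This is the factor gained when one Cartesian coordinate
    of a ball is integrated out. *)
Definition eBall (c : R) : \bar R := (\int[mu]_s (ppow (1 - s ^+ 2) (c - 1))%:E)%E.

(** Substitute s = t s' for t > 0. Both sides vanish for t <= 0, so the identity holds at every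
    point of the outer integral of a convolution. *)
Lemma eBeta_scale (x y t : R) :
  (\int[mu]_s (ppow s (x - 1) * ppow (t - s) (y - 1))%:E = (ppow t (x + y - 1))%:E * eBeta x y)%E.
Proof.
have [t0|t0] := leP t 0.
  rewrite ppow_le0// mul0e integral0_eq// => s _.
  have [s0|s0] := leP s 0; first by rewrite (ppow_le0 _ s0) mul0r.
  by rewrite (ppow_le0 (w:=t - s)) ?mulr0// subr_le0 (le_trans t0)// ltW.
pose f s := ppow s (x - 1) * ppow (t - s) (y - 1).
have mf : measurable_fun setT f.
  by apply: measurable_funM; apply: measurable_ppow => //; exact: measurable_funB.
have f0 s : 0 <= f s by rewrite mulr_ge0 ?ppow_ge0.
rewrite -[LHS](@ge0_integral_affine R t 0 (EFin \o f) t0); last 2 first.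
- exact/measurable_EFinP.
- by move=> s; rewrite lee_fin.
rewrite [LHS](@ge0_EFin_integralZl _ _ _ mu t (fun s => f (t * s + 0)))//; first last.
- by apply: measurableT_comp => //; exact: measurable_affine.
- exact: ltW.
have mg : measurable_fun setT (fun s : R => ppow s (x - 1) * ppow (1 - s) (y - 1)).
  by apply: measurable_funM; apply: measurable_ppow => //; exact: measurable_funB.
have g0 (s : R) : 0 <= ppow s (x - 1) * ppow (1 - s) (y - 1) by rewrite mulr_ge0 ?ppow_ge0.
rewrite /eBeta (ge0_EFin_integralZl mu (ppow_ge0 t _) mg g0).
apply: eq_integral => s _; rewrite /f addr0 (_ : t - t * s = t * (1 - s)); last by ring.
rewrite !ppowM//.
rewrite (_ : x + y - 1 = (x - 1) + (y - 1) + 1); last by ring.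
by rewrite !ppowD (ppow_gt0 1 t0) powRr1 ?ltW//; congr (_%:E); ring.
Qed.

(** Substitute x = sqrt v s'; the Jacobian sqrt v moves the exponent from c - 1 to c - 1/2. *)
Lemma eBall_scale (c v : R) :
  (\int[mu]_x (ppow (v - x ^+ 2) (c - 1))%:E = (ppow v (c - 2^-1))%:E * eBall c)%E.
Proof.
have [v0|v0] := leP v 0.
  rewrite ppow_le0// mul0e integral0_eq// => s _.
  by rewrite ppow_le0// subr_le0 (le_trans v0)// sqr_ge0.
have sv0 : 0 < Num.sqrt v by rewrite sqrtr_gt0.
pose f s := ppow (v - s ^+ 2) (c - 1).
have mf w : measurable_fun setT (fun s : R => ppow (w - s ^+ 2) (c - 1)).
  by apply: measurable_ppow => //; apply: measurable_funB => //; exact: measurable_funX.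
rewrite -[LHS](@ge0_integral_affine R (Num.sqrt v) 0 (EFin \o f) sv0); last 2 first.
- apply/measurable_EFinP; exact: mf.
- by move=> s; rewrite lee_fin ppow_ge0.
rewrite [LHS](@ge0_EFin_integralZl _ _ _ mu (Num.sqrt v) (fun s => f (Num.sqrt v * s + 0))); first last.
- by move=> s; exact: ppow_ge0.
- by apply: (measurableT_comp (mf v)); exact: measurable_affine.
- exact: ltW.
rewrite /eBall (ge0_EFin_integralZl mu (ppow_ge0 v _) (mf 1) (fun s => ppow_ge0 _ _)).
apply: eq_integral => s _; rewrite /f addr0 exprMn sqr_sqrtr ?ltW// (_ : v - v * s ^+ 2 = v * (1 - s ^+ 2)); last by ring.
rewrite ppowM//.
rewrite (_ : c - 2^-1 = (c - 1) + 2^-1); last by field.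
by rewrite (ppowD v (c - 1)) (ppow_gt0 (2^-1) v0) powR12_sqrt ?ltW//; congr (_%:E); ring.
Qed.

(** When the inner integral of a convolution is a constant times a pure power of [w], the outer
    integral is Euler's again. *)
Lemma eGamma_scaled (K : \bar R) (s : R) (F : R -> \bar R) : (0 <= K)%E ->
  (forall w, F w = (ppow w (s - 1))%:E * K)%E ->
  (\int[mu]_w ((expR (- w))%:E * F w) = eGamma s * K)%E.
Proof.
move=> K0 FE; rewrite muleC /eGamma -ge0_integralZl//=.
- by apply: eq_integral => w _; rewrite FE (muleC _ K) muleCA -EFinM (mulrC (expR _)).
- apply/measurable_EFinP; apply: measurable_funM; first exact: measurable_ppow.
  by apply: measurableT_comp => //.
- by move=> t _; rewrite lee_fin mulr_ge0 ?expR_ge0 ?ppow_ge0.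
Qed.

Lemma eGammaM x y : (eGamma x * eGamma y = eGamma (x + y) * eBeta x y)%E.
Proof.
rewrite {1}/eGamma (@eGamma_convolution (fun t => ppow t (x - 1)) id)//; last 2 first.
- exact: measurable_ppow.
- by move=> s; exact: ppow_ge0.
apply: eGamma_scaled; last by move=> w; exact: eBeta_scale.
by apply: integral_ge0 => s _; rewrite lee_fin mulr_ge0 ?ppow_ge0.
Qed.

(** The convolution identity with phi = 1 and h x = x^2: the first factor is the Gaussian integral,
    which supplies sqrt pi. *)
Lemma eGamma_half_shift c : ((Num.sqrt pi)%:E * eGamma c = eGamma (c + 2^-1) * eBall c)%E.
Proof.
rewrite -integralT_gauss.
under eq_integral do rewrite /gauss_fun -[expR _]mul1r.
rewrite (@eGamma_convolution (fun=> 1) (fun x => x ^+ 2)); last 3 first.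
- exact: measurable_cst.
- exact: measurable_funX.
- by move=> x; exact: ler01.
apply: eGamma_scaled; first by apply: integral_ge0 => s _; rewrite lee_fin ppow_ge0.
move=> w; under eq_integral do rewrite mul1r.
by rewrite eBall_scale; congr ((ppow _ _)%:E * _)%E; field.
Qed.

End PositivePower.

(** * Recurrence, finiteness and positivity of Gamma *)

Section GammaFunction.
Context {R : realType}.
Notation mu := (@lebesgue_measure R).

Lemma eGamma_ge0 (s : R) : (0 <= eGamma s)%E.
Proof. by apply: integral_ge0 => t _; rewrite lee_fin mulr_ge0 ?ppow_ge0 ?expR_ge0. Qed.

Lemma measurable_Gamma_integrand (s : R) :
  measurable_fun setT (fun t : R => ppow t (s - 1) * expR (- t)).
Proof.
apply: measurable_funM; first exact: measurable_ppow.
by apply: measurableT_comp.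
Qed.

Lemma eGamma1 : eGamma (1 : R) = 1%E.
Proof.
have mexp : measurable_fun setT (fun x : R => (expR (- x))%:E).
  by apply/measurable_EFinP; exact: measurableT_comp.
transitivity (\int[mu]_(x in `[0%R, +oo[) (expR (- x))%:E)%E.
  rewrite -integral_itv_obnd_cbnd; last exact: measurable_funTS.
  rewrite integral_mkcond /eGamma; apply: eq_integral => t _; rewrite patchE /ppow subrr powRr0.
  have [t0|t0] := boolP (0 < t); first by rewrite mem_set ?mul1r//= in_itv/= t0.
  by rewrite memNset/= ?mul0r// in_itv/= (negbTE t0).
rewrite -(integral_exponential_pdf (@ltr01 R)) integral_mkcond.
apply: eq_integral => t _; rewrite /exponential_pdf/= !patchE.
by case: ifP => // _; rewrite /= mul1r mulN1r.
Qed.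

Lemma derivable_powR_primitive (s x : R) : 0 < s -> 0 < x ->
  is_derive x 1 (fun t => s^-1 * t `^ s) (x `^ (s - 1)).
Proof.
move=> s0 x0; have := is_derive1_powR s x0 => dx.
have := is_deriveZ (f := fun t => t `^ s) (s^-1) dx.
by rewrite /GRing.scale/= mulrA mulVf ?gt_eqF// mul1r.
Qed.

Lemma integral_powR (s a : R) : 0 < s -> 0 < a -> a < 1 ->
  (\int[mu]_(t in `[a, 1%R]) (t `^ (s - 1))%:E = (s^-1 * (1 - a `^ s))%:E)%E.
Proof.
move=> s0 a0 a1.
have cF (x : R) : 0 < x -> {for x, continuous (fun t => s^-1 * t `^ s)}.
  move=> x0; apply: differentiable_continuous; apply/derivable1_diffP.
  by have [] := derivable_powR_primitive s0 x0.
rewrite (@continuous_FTC2 _ _ (fun t => s^-1 * t `^ s))//.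
- by rewrite powR1 -EFinB mulrBr mulr1.
- apply: derivable_within_continuous => x; rewrite in_itv/= => /andP[ax _].
  have x0 : 0 < x by exact: lt_le_trans ax.
  by have [] := is_derive1_powR (s - 1) x0.
- split.
  + move=> x; rewrite in_itv/= => /andP[ax _].
    by have [] := derivable_powR_primitive s0 (lt_trans a0 ax).
  + apply: cvg_at_right_filter; exact: cF.
  + apply: cvg_at_left_filter; exact: cF.
- move=> x; rewrite in_itv/= => /andP[ax _].
  rewrite derive1E; have dF := derivable_powR_primitive s0 (lt_trans a0 ax).
  by rewrite derive_val.
Qed.

(** The integrand may be unbounded at 0, so the fundamental theorem of calculus is applied away from
    0 and monotone convergence finishes. *)
Lemma eBeta_x1 (s : R) : 0 < s -> (eBeta s 1 = (s^-1)%:E)%E.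
Proof.
move=> s0.
(* Starting at 1/2 rather than 1 keeps the left endpoint strictly below 1, as [integral_powR]
   demands. *)
pose F (i : nat) := `[(i.+2%:R^-1 : R), 1]%classic.
have ndF : {homo F : n m / (n <= m)%N >-> (n <= m)%O}.
  move=> n m nm; apply/subsetPset => x; rewrite /F/= !in_itv/= => /andP[nx ->].
  by rewrite andbT (le_trans _ nx)// lef_pV2 ?posrE// ler_nat.
have uF : \bigcup_i F i = `]0, 1]%classic.
  apply/seteqP; split => [x [i _]|x]; rewrite /F/= !in_itv/=.
    by move=> /andP[ix ->]; rewrite andbT (lt_le_trans _ ix).
  move=> /andP[x0 x1]; exists (Num.truncn x^-1) => //=; rewrite in_itv/= x1 andbT.
  rewrite -[leRHS]invrK lef_pV2 ?posrE ?invr_gt0//.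
  by rewrite ltW// (lt_le_trans (truncnS_gt _))// ler_nat.
have -> : eBeta s 1 = (\int[mu]_(t in `]0%R, 1%R]) (t `^ (s - 1))%:E)%E.
  rewrite -integral_itv_bndo_bndc; last first.
    by apply: measurable_funTS; apply/measurable_EFinP; exact: measurable_powR.
  rewrite integral_mkcond /eBeta; apply: eq_integral => t _; rewrite patchE subrr.
  have [t0|t0] := leP t 0.
    by rewrite (ppow_le0 _ t0) mul0r memNset//= in_itv/= ltNge t0.
  have [t1|t1] := leP 1 t.
    by rewrite (@ppow_le0 _ (1 - t)) ?subr_le0// mulr0 memNset//= in_itv/= t0/= ltNge t1.
  by rewrite !ppow_gt0 ?subr_gt0// powRr0 mulr1 mem_set//= in_itv/= t0 t1.
rewrite -uF.
have H1 : (\int[mu]_(t in F i) (t `^ (s - 1))%:E)%E @[i --> \oo] -->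
    (\int[mu]_(t in \bigcup_i F i) (t `^ (s - 1))%:E)%E.
  apply: ge0_nondecreasing_set_cvg_integral => //.
  - by move=> i; exact: measurable_itv.
  - by move=> i; apply: measurable_funTS; apply/measurable_EFinP; exact: measurable_powR.
  - by move=> i x _; rewrite lee_fin powR_ge0.
suff : (\int[mu]_(t in F i) (t `^ (s - 1))%:E)%E @[i --> \oo] --> (s^-1)%:E.
  exact: cvg_unique.
rewrite (_ : (fun i => _) = (fun i : nat => (s^-1 * (1 - i.+2%:R^-1 `^ s))%:E)); last first.
  by apply/funext => i; rewrite integral_powR// invf_lt1// ltr1n.
apply: cvg_EFin; first exact: nearW.
have inv0 : (i.+2%:R^-1 : R) @[i --> \oo] --> 0.
  by have := @cvg_harmonic R; rewrite -(cvg_shiftS (@harmonic R)).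
have pow0 : (i.+2%:R^-1 : R) `^ s @[i --> \oo] --> 0.
  have /cvg_at_rightP := powR_cvg0 s0; apply; split => // i.
rewrite [X in _ --> X](_ : _ = s^-1 * (1 - 0)); last by rewrite subr0 mulr1.
by apply: cvgM; [exact: cvg_cst|apply: cvgB => //; exact: cvg_cst].
Qed.

(** With y the right-hand side, add the bounds ln z <= z - 1 at z = x / y with weight c and at z = 1
    / y with weight 1 - c; the upper bounds sum to 0. *)
Lemma weighted_AMGM (x c : R) : 0 < x -> 0 <= c <= 1 -> x `^ c <= 1 - c + c * x.
Proof.
move=> x0 /andP[c0 c1].
have ln_le (z : R) : 0 < z -> ln z <= z - 1.
  by move=> z0; rewrite -{1}(subrK 1 z) addrC le_ln1Dx// ltrBrDr addNr.
set y := 1 - c + c * x.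
have y0 : 0 < y.
  rewrite /y; have [->|cn0] := eqVneq c 0; first by rewrite subr0 mul0r addr0.
  by rewrite ltr_wpDl ?subr_ge0// mulr_gt0// lt_neqAle eq_sym cn0.
have H1 := ln_le (x / y) (divr_gt0 x0 y0).
have H2 := ln_le y^-1 (etrans (invr_gt0 y) y0).
rewrite -ler_ln ?posrE ?powR_gt0// ln_powR.
have := lerD (ler_wpM2l c0 H1) (ler_wpM2l (etrans (subr_ge0 _ _) c1) H2).
rewrite lnM ?posrE ?invr_gt0// lnV ?posrE// -/y => H.
rewrite -subr_le0; apply: le_trans (le_trans H _).
  by lra.
have -> : c * (x / y - 1) + (1 - c) * (y^-1 - 1) = y / y - 1 by rewrite /y; ring.
by rewrite divff ?subrr// gt_eqF.
Qed.

(** Weighted AM-GM at t / x, integrated against the Gamma density. Once Gamma (x + 1) = x Gamma x is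
    available, the right side collapses to x^c Gamma x. *)
Lemma eGamma_le (x c : R) : 0 < x -> 0 <= c <= 1 ->
  (eGamma (x + c) <= (x `^ c * (1 - c))%:E * eGamma x + (x `^ c * c / x)%:E * eGamma (x + 1))%E.
Proof.
move=> x0 c01; have /andP[c0 c1] := c01; rewrite /eGamma.
have i0 (s t : R) : 0 <= ppow t (s - 1) * expR (- t) by rewrite mulr_ge0 ?ppow_ge0 ?expR_ge0.
rewrite (ge0_EFin_integralZl mu _ (measurable_Gamma_integrand x) (i0 x)); last first.
  by rewrite mulr_ge0 ?powR_ge0 ?subr_ge0.
rewrite (ge0_EFin_integralZl mu _ (measurable_Gamma_integrand (x + 1)) (i0 (x + 1))); last first.
  by rewrite mulr_ge0 ?mulr_ge0 ?powR_ge0 ?invr_ge0// ltW.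
have m1 : measurable_fun setT (fun t : R => ((x `^ c * (1 - c)) * (ppow t (x - 1) * expR (- t)))%:E).
  by apply/measurable_EFinP; apply: measurable_funM => //; exact: measurable_Gamma_integrand.
have m2 : measurable_fun setT (fun t : R => ((x `^ c * c / x) * (ppow t (x + 1 - 1) * expR (- t)))%:E).
  by apply/measurable_EFinP; apply: measurable_funM => //; exact: measurable_Gamma_integrand.
rewrite -ge0_integralD//; last 2 first.
- by move=> t _; rewrite lee_fin mulr_ge0// mulr_ge0 ?powR_ge0 ?subr_ge0.
- by move=> t _; rewrite lee_fin mulr_ge0// !mulr_ge0 ?powR_ge0 ?invr_ge0// ltW.
apply: ge0_le_integral => //.
- by move=> t _; rewrite lee_fin.
- by apply/measurable_EFinP; exact: measurable_Gamma_integrand.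
- exact: emeasurable_funD.
move=> t _; rewrite lee_fin.
have [t0|t0] := leP t 0; first by rewrite !(ppow_le0 _ t0) !(mul0r, mulr0, addr0).
rewrite !mulrA -mulrDl ler_wpM2r ?expR_ge0//.
rewrite (_ : x + c - 1 = (x - 1) + c); last by ring.
rewrite (_ : x + 1 - 1 = (x - 1) + 1); last by ring.
rewrite (ppowD t (x - 1) c) (ppowD t (x - 1) 1) !(ppow_gt0 _ t0) (powRr1 (ltW t0)).
have E : x `^ c * (t / x) `^ c = t `^ c.
  rewrite -powRM ?(ltW x0)//; last by apply: divr_ge0; apply: ltW.
  by rewrite mulrC divfK// gt_eqF.
have /(ler_wpM2l (powR_ge0 x c)) := weighted_AMGM (divr_gt0 t0 x0) c01.
rewrite E => /(ler_wpM2l (powR_ge0 t (x - 1))) H; apply: le_trans H _.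
by rewrite le_eqVlt; apply/orP; left; apply/eqP; ring.
Qed.

(** The product formula at y = 1 replaces integration by parts and is valid before finiteness is
    known. *)
Lemma eGammaS (s : R) : 0 < s -> (eGamma (s + 1) = s%:E * eGamma s)%E.
Proof.
move=> s0; have := eGammaM s 1; rewrite eGamma1 mule1 eBeta_x1// => ->.
by rewrite muleCA -EFinM divff ?mule1// gt_eqF.
Qed.

Lemma eGamma_nat (n : nat) : (eGamma (n.+1%:R : R) = (n`!%:R)%:E)%E.
Proof.
elim: n => [|n IHn]; first exact: eGamma1.
by rewrite -natr1 eGammaS ?ltr0n// IHn -EFinM factS natrM.
Qed.

(** Finiteness spreads from the factorials: [eGamma_le] bounds the value at s by those at the two
    neighbouring integers. *)
Lemma eGamma_lty_ge1 (s : R) : 1 <= s -> (eGamma s < +oo)%E.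
Proof.
move=> s1; have s0 : 0 <= s by exact: le_trans s1.
have [/andP[ns sn]] := truncn_itv s0.
move: (Num.truncn s) ns sn => n ns sn.
have n0 : (0 < n)%N by rewrite -ltnS -(ltr_nat R) (le_lt_trans s1).
have c01 : 0 <= s - n%:R <= 1 by rewrite subr_ge0 ns/= lerBlDl natr1 ltW.
have := @eGamma_le n%:R (s - n%:R) _ c01; rewrite ltr0n => /(_ n0).
rewrite addrC subrK => /le_lt_trans; apply.
rewrite -(prednK n0) natr1 !eGamma_nat -!EFinM -EFinD; exact: ltry.
Qed.

Lemma eGamma_lty (s : R) : 0 < s -> (eGamma s < +oo)%E.
Proof.
move=> s0; have [s1|s1] := leP 1 s; first exact: eGamma_lty_ge1.
have := eGammaM s 1; rewrite eGamma1 mule1 eBeta_x1// => ->.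
have := @eGamma_lty_ge1 (s + 1); rewrite lerDr ltW// => /(_ isT).
have := eGamma_ge0 (s + 1); case: (eGamma (s + 1)) => // r _ _.
by rewrite -EFinM ltry.
Qed.

Lemma eGammaE (s : R) : 0 < s -> eGamma s = (Gamma s)%:E.
Proof.
move=> s0; rewrite GammaE fineK// ge0_fin_numE ?eGamma_lty//; exact: eGamma_ge0.
Qed.

Lemma GammaS (s : R) : 0 < s -> Gamma (s + 1) = s * Gamma s.
Proof. by move=> s0; rewrite !GammaE eGammaS// eGammaE// -GammaE. Qed.

Lemma Gamma1 : Gamma (1 : R) = 1.
Proof. by rewrite GammaE eGamma1. Qed.

Lemma Gamma_nat (n : nat) : Gamma (n.+1%:R : R) = n`!%:R.
Proof. by rewrite GammaE eGamma_nat. Qed.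

(** Wendel's inequality. Together with the recurrence and the values at 1 and 1/2, it is all that
    Stirling's formula will use about Gamma. *)
Lemma Gamma_add_le (x c : R) : 0 < x -> 0 <= c <= 1 -> Gamma (x + c) <= x `^ c * Gamma x.
Proof.
move=> x0 c01; have /andP[c0 c1] := c01; have := eGamma_le x0 c01.
have xc0 : 0 < x + c by rewrite ltr_pwDl.
have x10 : 0 < x + 1 by rewrite addr_gt0.
rewrite !eGammaE//.
rewrite -!EFinM -EFinD lee_fin GammaS// => /le_trans; apply.
rewrite le_eqVlt; apply/orP; left; apply/eqP.
by field; rewrite gt_eqF.
Qed.

(** Wendel's inequality read backwards: a step from s up to the next integer bounds a factorial by a
    multiple of Gamma s. *)
Lemma Gamma_gt0 (s : R) : 0 < s -> 0 < Gamma s.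
Proof.
move=> s0; have [/andP[ns sn]] := truncn_itv (ltW s0).
move: (Num.truncn s) ns sn => n ns sn.
have c01 : 0 <= n.+1%:R - s <= 1.
  by rewrite subr_ge0 ltW//= lerBlDl -natr1 lerD2r.
have := Gamma_add_le s0 c01; rewrite addrC subrK Gamma_nat => H.
have : 0 < s `^ (n.+1%:R - s) * Gamma s by apply: lt_le_trans H; rewrite ltr0n fact_gt0.
by rewrite pmulr_rgt0// powR_gt0.
Qed.

Lemma eBetaE (x y : R) : 0 < x -> 0 < y ->
  eBeta x y = (Gamma x * Gamma y / Gamma (x + y))%:E.
Proof.
move=> x0 y0; have xy0 := addr_gt0 x0 y0.
have := eGammaM x y; rewrite !eGammaE//.
have : (0 <= eBeta x y)%E by apply: integral_ge0 => s _; rewrite lee_fin mulr_ge0 ?ppow_ge0.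
have G0 := Gamma_gt0 xy0.
(* An infinite Beta integral is excluded: multiplied by a positive Gamma value it would be infinite,
   while the product of Gammas is finite. *)
case: (eBeta x y) => [b _| _|//]; last by rewrite gt0_muley ?lte_fin// -EFinM.
by rewrite -!EFinM => -[->]; rewrite mulrC mulKf ?gt_eqF.
Qed.

Lemma eBallE (c : R) : 0 < c -> eBall c = (Num.sqrt pi * Gamma c / Gamma (c + 2^-1))%:E.
Proof.
move=> c0; have c20 : 0 < c + 2^-1 by rewrite addr_gt0.
have := eGamma_half_shift c; rewrite !eGammaE//.
have : (0 <= eBall c)%E by apply: integral_ge0 => s _; rewrite lee_fin ppow_ge0.
have G0 := Gamma_gt0 c20.
case: (eBall c) => [b _| _|//]; last by rewrite gt0_muley ?lte_fin// -EFinM.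
by rewrite -!EFinM => -[->]; rewrite mulrC mulKf ?gt_eqF.
Qed.

(** At c = 1 the slice integral is the length 2 of ]-1, 1[, while [eBallE] evaluates it as sqrt pi /
    Gamma (3/2). *)
Lemma Gamma_half : Gamma (2^-1 : R) = Num.sqrt pi.
Proof.
have eB : eBall (1 : R) = 2%:E.
  transitivity (\int[mu]_(x in `](-1)%R, 1%R[) (cst 1%:E) x)%E.
    rewrite integral_mkcond; apply: eq_integral => x _; rewrite patchE subrr.
    have [x1|x1] := ltP (x ^+ 2) 1.
      rewrite ppow_gt0 ?subr_gt0// powRr0 mem_set//= in_itv/= -ltr_norml.
      by rewrite -(ltr_pXn2r (n:=2)) ?nnegrE// expr1n real_normK// num_real.
    rewrite ppow_le0 ?subr_le0// memNset//= in_itv/= -ltr_norml; apply/negP.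
    by rewrite -leNgt -(ler_pXn2r (n:=2)) ?nnegrE// expr1n real_normK// num_real.
  rewrite integral_cst//= mul1e lebesgue_measure_itv/= lte_fin gtrN// -EFinB; congr (_%:E).
  by ring.
have := eBallE (@ltr01 R); rewrite eB Gamma1 mulr1 addrC GammaS// => -[].
have := @Gamma_gt0 2^-1; rewrite invr_gt0 ltr0n => /(_ isT) G0 H.
have : 2 * (2^-1 * Gamma 2^-1) = Num.sqrt pi :> R.
  by rewrite {1}H divfK// gt_eqF// mulr_gt0.
by rewrite mulrA divff ?mul1r// pnatr_eq0.
Qed.

End GammaFunction.

(* The library's instance of sigma-finiteness for products only fires for products of
   probabilities; a separate constant is needed to carry it for the plane. *)
Definition lebesgue_measure2 (R : realType) :
    set (measurableTypeR R * measurableTypeR R)%type -> \bar R :=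
  (@lebesgue_measure R \x @lebesgue_measure R)%E.

HB.instance Definition _ (R : realType) := Measure.on (@lebesgue_measure2 R).

Lemma sigma_finite_lebesgue_measure2 (R : realType) : sigma_finite setT (@lebesgue_measure2 R).
Proof.
have /sigma_finiteP[F [TF ndF Foo]] := sigma_finiteT (@lebesgue_measure R).
exists (fun n => F n `*` F n) => [|k].
  rewrite -setXTT TF predeqE => -[x y]; split => [[[n _ Fx] [k _ Fy]]|[n _ [Fx Fy]]].
    exists (maxn n k) => //; split; first exact: (subsetPset _ _ (ndF _ _ (leq_maxl n k))) Fx.
    exact: (subsetPset _ _ (ndF _ _ (leq_maxr n k))) Fy.
  by split; exists n.
have [mF Fy] := Foo k; split; first exact: measurableX.
by rewrite [ltLHS]product_measure1E// lte_mul_pinfty// ge0_fin_numE.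
Qed.

HB.instance Definition _ (R : realType) :=
  Measure_isSigmaFinite.Build _ _ _ (@lebesgue_measure2 R) (@sigma_finite_lebesgue_measure2 R).

(** * Integrals over the ball of functions of the height *)

Section BallIntegral.
Context {R : realType}.
Notation mu := (@lebesgue_measure R).
Notation mu2 := (@lebesgue_measure2 R).
Notation mu3 := (@lebesgue_measure2 R \x @lebesgue_measure R)%E.

Lemma measurable_fun_fst2 d1 d2 d3 (T1 : measurableType d1) (T2 : measurableType d2) (T3 : measurableType d3) :
  measurable_fun setT (fun p : T1 * T2 * T3 => p.1.1).
Proof. by apply: measurableT_comp. Qed.

Lemma measurable_fun_snd2 d1 d2 d3 (T1 : measurableType d1) (T2 : measurableType d2) (T3 : measurableType d3) :
  measurable_fun setT (fun p : T1 * T2 * T3 => p.1.2).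
Proof. by apply: measurableT_comp. Qed.

Lemma measurable_normsq3 : measurable_fun setT (@normsq3 R).
Proof.
apply: measurable_funD; first apply: measurable_funD; apply: measurable_funX => //.
- exact: measurable_fun_fst2.
- exact: measurable_fun_snd2.
Qed.

(** Over two half shifts the Gamma quotients telescope to Gamma c / Gamma (c + 1) = 1 / c. *)
Lemma eBall_half_shift (c : R) : 0 < c -> (eBall c * eBall (c + 2^-1) = (pi / c)%:E)%E.
Proof.
move=> c0; have c2 : 0 < c + 2^-1 by rewrite addr_gt0.
rewrite !eBallE// -EFinM; congr (_%:E).
rewrite -addrA (_ : 2^-1 + 2^-1 = 1); last by field.
rewrite GammaS// -[in RHS](sqr_sqrtr (pi_ge0 R)).
have := Gamma_gt0 c0; have := Gamma_gt0 c2 => g2 g0.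
have := gt_eqF g2; have := gt_eqF g0; have := gt_eqF c0.
move: (Num.sqrt pi) (Gamma c) (Gamma _) => p g h cn gn hn.
by field; rewrite cn gn hn.
Qed.

(** Integrating out [y] raises the exponent from c - 1 to c - 1/2, integrating out [x] raises it to
    c, and the two slice constants multiply to pi / c. Cartesian slices thus replace polar
    coordinates. *)
Lemma ge0_ball_integral (F : R -> R) (c : R) : 0 < c -> measurable_fun setT F -> (forall z, 0 <= F z) ->
  (\int[mu3]_p (F p.2 * ppow (1 - normsq3 p) (c - 1))%:E =
   (pi / c)%:E * \int[mu]_z (F z * ppow (1 - z ^+ 2) c)%:E)%E.
Proof.
move=> c0 mF F0.
have pic0 : 0 <= pi / c by rewrite divr_ge0 ?pi_ge0// ltW.
have mG : measurable_fun setT (fun z : R => F z * ppow (1 - z ^+ 2) c).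
  apply: measurable_funM => //; apply: measurable_ppow; apply: measurable_funB => //; exact: measurable_funX.
rewrite (ge0_EFin_integralZl mu pic0 mG); last by move=> z; rewrite mulr_ge0 ?ppow_ge0.
rewrite [LHS](@fubini_tonelli2 _ _ _ _ R mu2 mu); last 2 first.
- apply/measurable_EFinP; apply: measurable_funM.
    by apply: measurableT_comp.
  by apply: measurable_ppow; apply: measurable_funB => //; exact: measurable_normsq3.
- by move=> p; rewrite lee_fin mulr_ge0 ?ppow_ge0.
apply: eq_integral => z _; rewrite /fubini_G/=.
have mf2 a : measurable_fun setT (fun p : R * R => ppow (1 - z ^+ 2 - p.1 ^+ 2 - p.2 ^+ 2) a).
  apply: measurable_ppow; apply: measurable_funB; last by apply: measurable_funX.
  by apply: measurable_funB => //; apply: measurable_funX.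
have mf1 a : measurable_fun setT (fun x : R => ppow (1 - z ^+ 2 - x ^+ 2) a).
  by apply: measurable_ppow; apply: measurable_funB => //; apply: measurable_funX.
transitivity (\int[mu2]_p (F z * ppow (1 - z ^+ 2 - p.1 ^+ 2 - p.2 ^+ 2) (c - 1))%:E)%E.
  by apply: eq_integral => p _; rewrite /normsq3/=; congr ((_ * ppow _ _)%:E); ring.
rewrite -(ge0_EFin_integralZl mu2 (F0 z) (mf2 (c - 1)) (fun p => ppow_ge0 _ _)).
rewrite [X in (_ * X)%E](@fubini_tonelli1 _ _ _ _ R mu mu); last 2 first.
- by apply/measurable_EFinP; exact: (mf2 (c - 1)).
- by move=> p; rewrite lee_fin ppow_ge0.
rewrite /fubini_F/=.
under eq_integral do rewrite eBall_scale muleC.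
rewrite ge0_integralZl//; last 3 first.
- by apply/measurable_EFinP; exact: mf1.
- by move=> x _; rewrite lee_fin ppow_ge0.
- by apply: integral_ge0 => s _; rewrite lee_fin ppow_ge0.
have := eBall_scale (c + 2^-1) (1 - z ^+ 2).
have e1 : c + 2^-1 - 1 = c - 2^-1 by field.
have e2 : c + 2^-1 - 2^-1 = c by ring.
rewrite e1 e2 => ->.
by rewrite (muleCA (eBall c)) eBall_half_shift// -!EFinM; congr (_%:E); ring.
Qed.

(* The substitution z = 2 s - 1 turns the integral over [-1, 1] into a Beta integral. *)
Lemma ball_beta_integral (m : nat) (c : R) : 0 < c ->
  (\int[mu3]_p (`|(1 + p.2) / 2| ^+ m * ppow (1 - normsq3 p) (c - 1))%:E =
   (pi / c * (2 * 4 `^ c * (Gamma (m%:R + c + 1) * Gamma (c + 1) / Gamma (m%:R + 2 * c + 2))))%:E)%E.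
Proof.
move=> c0.
have mF : measurable_fun setT (fun z : R => `|(1 + z) / 2| ^+ m).
  apply: measurable_funX; apply: measurableT_comp => //; apply: measurable_funM => //.
  exact: measurable_funD.
rewrite (@ge0_ball_integral (fun z => `|(1 + z) / 2| ^+ m))//.
rewrite [in RHS]EFinM; congr (_ * _)%E.
have mG : measurable_fun setT (fun z : R => `|(1 + z) / 2| ^+ m * ppow (1 - z ^+ 2) c).
  apply: measurable_funM => //; apply: measurable_ppow; apply: measurable_funB => //; exact: measurable_funX.
rewrite -[LHS](@ge0_integral_affine R 2 (-1) (fun z => (`|(1 + z) / 2| ^+ m * ppow (1 - z ^+ 2) c)%:E)); last 3 first.
- by [].
- exact/measurable_EFinP.
- by move=> z; rewrite lee_fin mulr_ge0 ?ppow_ge0 ?exprn_ge0.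
rewrite -[in RHS](mulrA 2) [in RHS]EFinM; congr (_ * _)%E.
have := @eBetaE R (m%:R + c + 1) (c + 1).
rewrite (_ : m%:R + c + 1 + (c + 1) = m%:R + 2 * c + 2); last by ring.
have c10 : 0 < c + 1 by rewrite addr_gt0.
have mc10 : 0 < m%:R + c + 1 by rewrite -addrA ltr_wpDl.
move=> /(_ mc10 c10) eB; rewrite [in RHS]EFinM -eB.
rewrite /eBeta ge0_EFin_integralZl ?powR_ge0//; last 2 first.
- by apply: measurable_funM; apply: measurable_ppow => //; exact: measurable_funB.
- by move=> s; rewrite mulr_ge0 ?ppow_ge0.
apply: eq_integral => s _; congr (_%:E).
rewrite (_ : (1 + (2 * s - 1)) / 2 = s); last by field.
rewrite (_ : 1 - (2 * s - 1) ^+ 2 = 4 * (s * (1 - s))); last by ring.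
rewrite ppowM// (@ppow_gt0 _ 4)//.
have [s0|s0] := leP s 0.
  rewrite (ppow_le0 _ s0) (@ppow_le0 _ (s * (1 - s))) ?mul0r ?mulr0//.
  by rewrite mulr_le0_ge0// subr_ge0 (le_trans s0).
have [s1|s1] := leP 1 s.
  rewrite (@ppow_le0 _ (s * (1 - s))) ?(@ppow_le0 _ (1 - s)) ?mulr0// ?subr_le0//.
  by rewrite pmulr_rle0// subr_le0.
have s10 : 0 < 1 - s by rewrite subr_gt0.
rewrite ger0_norm ?ltW// !ppow_gt0 ?mulr_gt0// powRM ?ltW//.
rewrite (_ : m%:R + c + 1 - 1 = m%:R + c); last by ring.
rewrite (_ : c + 1 - 1 = c); last by ring.
rewrite powRD ?(gt_eqF s0) ?implybT// powR_mulrn ?ltW//.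
by rewrite !mulrA (mulrC (s ^+ m)).
Qed.

Lemma measurable_sphere (r : R) : measurable [set p : R * R * R | normsq3 p = r].
Proof.
rewrite [X in measurable X](_ : _ = setT `&` (@normsq3 R) @^-1` [set r]); last by rewrite setTI.
exact: measurable_normsq3.
Qed.

(** Every vertical line meets the sphere in at most two points, so all sections are null. *)
Lemma lebesgue_measure_sphere (r : R) : mu3 [set p : R * R * R | normsq3 p = r] = 0%E.
Proof.
rewrite [LHS]integral0_eq// => p _ /=.
apply: countable_lebesgue_measure0; apply: (@sub_countable _ _ _ [set Num.sqrt (r - p.1 ^+ 2 - p.2 ^+ 2); - Num.sqrt (r - p.1 ^+ 2 - p.2 ^+ 2)]).
  apply: subset_card_le => z; rewrite /xsection/= inE /normsq3/= => h.
  have -> : r - p.1 ^+ 2 - p.2 ^+ 2 = z ^+ 2 by rewrite -h; ring.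
  rewrite sqrtr_sqr; have [z0|z0] := ger0P z; first by left.
  by right; rewrite opprK.
by apply: finite_set_countable; exact: finite_set2.
Qed.
End BallIntegral.

(** * Rotations of space *)

Section MeasurePreserving.
Local Open Scope ereal_scope.
Context {R : realType}.

(** Stated through integrals of nonnegative functions, a form that composes directly and that
    Tonelli passes from slices to products. *)
Definition preserves d (T : measurableType d) (m : {measure set T -> \bar R}) (f : T -> T) :=
  measurable_fun setT f /\
  forall g : T -> \bar R, measurable_fun setT g -> (forall x, 0 <= g x) ->
    \int[m]_x g (f x) = \int[m]_x g x.

Lemma preserves_comp d (T : measurableType d) (m : {measure set T -> \bar R}) (f h : T -> T) :
  preserves m f -> preserves m h -> preserves m (f \o h).
Proof.
move=> [mf f_] [mh h_]; split; first exact: measurableT_comp.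
move=> g mg g0; rewrite -(f_ g mg g0); apply: (h_ (g \o f)); last by move=> x; exact: g0.
exact: measurableT_comp.
Qed.

Lemma preserves_integral d (T : measurableType d) (m : {measure set T -> \bar R}) (f : T -> T) (g : T -> \bar R) :
  preserves m f -> measurable_fun setT g -> \int[m]_x g (f x) = \int[m]_x g x.
Proof.
move=> [mf f_] mg; rewrite (_ : (fun x => g (f x)) = g \o f)// [LHS]integralE [RHS]integralE; congr (_ - _).
  transitivity (\int[m]_x g^\+ (f x)); first by apply: eq_integral => x _; rewrite funepos_comp.
  exact: (f_ _ (measurable_funepos mg) (funepos_ge0 g)).
transitivity (\int[m]_x g^\- (f x)); first by apply: eq_integral => x _; rewrite funeneg_comp.
exact: (f_ _ (measurable_funeneg mg) (funeneg_ge0 g)).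
Qed.

Context d1 d2 (T1 : measurableType d1) (T2 : measurableType d2).
Variables (m1 : {sigma_finite_measure set T1 -> \bar R}) (m2 : {sigma_finite_measure set T2 -> \bar R}).

(** Tonelli reduces a map that moves one factor only to its slices. For a shear these slices are
    translations. *)
Lemma preserves_fst (phi : T2 -> T1 -> T1) :
  measurable_fun setT (fun p : T1 * T2 => phi p.2 p.1) ->
  (forall b, preserves m1 (phi b)) ->
  preserves (m1 \x m2) (fun p => (phi p.2 p.1, p.2)).
Proof.
move=> mphi phi_; have mpair : measurable_fun setT (fun p : T1 * T2 => (phi p.2 p.1, p.2)).
  exact: measurable_fun_pair.
split=> // g mg g0; rewrite fubini_tonelli2 => [|| p]; last 2 first.
- exact: measurableT_comp mg mpair.
- exact: g0.
rewrite (fubini_tonelli2 g mg g0); apply: eq_integral => b _; rewrite /fubini_G/=.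
have [_ /(_ (fun x => g (x, b)))] := phi_ b; apply; last by move=> x; exact: g0.
exact: measurableT_comp mg (measurable_pair2 b).
Qed.

Lemma preserves_snd (phi : T1 -> T2 -> T2) :
  measurable_fun setT (fun p : T1 * T2 => phi p.1 p.2) ->
  (forall a, preserves m2 (phi a)) ->
  preserves (m1 \x m2) (fun p => (p.1, phi p.1 p.2)).
Proof.
move=> mphi phi_; have mpair : measurable_fun setT (fun p : T1 * T2 => (p.1, phi p.1 p.2)).
  exact: measurable_fun_pair.
split=> // g mg g0; rewrite fubini_tonelli1 => [|| p]; last 2 first.
- exact: measurableT_comp mg mpair.
- exact: g0.
rewrite (fubini_tonelli1 g mg g0); apply: eq_integral => a _; rewrite /fubini_F/=.
have [_ /(_ (fun x => g (a, x)))] := phi_ a; apply; last by move=> x; exact: g0.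
exact: measurableT_comp mg (measurable_pair1 a).
Qed.

End MeasurePreserving.

Section Rotations.
Context {R : realType}.
Notation mu := (@lebesgue_measure R).
Notation mu2 := (@lebesgue_measure2 R).
Notation mu3 := (@lebesgue_measure2 R \x @lebesgue_measure R)%E.

Lemma preserves_translate (b : R) : preserves mu (fun x => x + b).
Proof.
split; first exact: measurable_funD.
by move=> g mg g0; rewrite ge0_integral_translate.
Qed.

Lemma preserves_shear_xy (a : R) : preserves mu3 (fun p => ((p.1.1 + a * p.1.2, p.1.2), p.2)).
Proof.
apply: (@preserves_fst _ _ _ _ _ mu2 mu (fun _ q => (q.1 + a * q.2, q.2))).
  apply: measurable_fun_pair; last exact: measurable_fun_snd2.
  apply: measurable_funD; first exact: measurable_fun_fst2.
  by apply: measurable_funM => //; exact: measurable_fun_snd2.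
move=> _; apply: (@preserves_fst _ _ _ _ _ mu mu (fun y x => x + a * y)).
  by apply: measurable_funD => //; apply: measurable_funM.
by move=> y; exact: preserves_translate.
Qed.

Lemma preserves_shear_yx (a : R) : preserves mu3 (fun p => ((p.1.1, p.1.2 + a * p.1.1), p.2)).
Proof.
apply: (@preserves_fst _ _ _ _ _ mu2 mu (fun _ q => (q.1, q.2 + a * q.1))).
  apply: measurable_fun_pair; first exact: measurable_fun_fst2.
  apply: measurable_funD; first exact: measurable_fun_snd2.
  by apply: measurable_funM => //; exact: measurable_fun_fst2.
move=> _; apply: (@preserves_snd _ _ _ _ _ mu mu (fun x y => y + a * x)).
  by apply: measurable_funD => //; apply: measurable_funM.
by move=> x; exact: preserves_translate.
Qed.

Lemma preserves_shear_xz (a : R) : preserves mu3 (fun p => ((p.1.1 + a * p.2, p.1.2), p.2)).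
Proof.
apply: (@preserves_fst _ _ _ _ _ mu2 mu (fun z q => (q.1 + a * z, q.2))).
  apply: measurable_fun_pair; last exact: measurable_fun_snd2.
  apply: measurable_funD; first exact: measurable_fun_fst2.
  by apply: measurable_funM => //.
move=> z; apply: (@preserves_fst _ _ _ _ _ mu mu (fun _ x => x + a * z)).
  by apply: measurable_funD.
by move=> y; exact: preserves_translate.
Qed.

Lemma preserves_shear_zx (a : R) : preserves mu3 (fun p => (p.1, p.2 + a * p.1.1)).
Proof.
apply: (@preserves_snd _ _ _ _ _ mu2 mu (fun q z => z + a * q.1)).
  by apply: measurable_funD => //; apply: measurable_funM => //; exact: measurable_fun_fst2.
by move=> q; exact: preserves_translate.
Qed.

(** Cosine and sine of the angle 2 arctan t. The half turn is not reached by any t, which is why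
    [half_angle] leaves the sign of [rho] free and [comm_tpow_flip] squares a quarter turn. *)
Definition rot_cos (t : R) := (1 - t ^+ 2) / (1 + t ^+ 2).
Definition rot_sin (t : R) := 2 * t / (1 + t ^+ 2).

Lemma one_add_sqr_neq0 (t : R) : 1 + t ^+ 2 != 0.
Proof. by rewrite gt_eqF// ltr_pwDl ?sqr_ge0. Qed.

Definition rotz (t : R) (p : R * R * R) : R * R * R :=
  ((rot_cos t * p.1.1 - rot_sin t * p.1.2, rot_sin t * p.1.1 + rot_cos t * p.1.2), p.2).

Definition roty (t : R) (p : R * R * R) : R * R * R :=
  ((rot_cos t * p.1.1 + rot_sin t * p.2, p.1.2), rot_cos t * p.2 - rot_sin t * p.1.1).

(* A plane rotation of angle 2 arctan t is a product of three shears. *)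
Lemma preserves_rotz (t : R) : preserves mu3 (rotz t).
Proof.
have := preserves_comp (preserves_shear_xy (- t))
  (preserves_comp (preserves_shear_yx (rot_sin t)) (preserves_shear_xy (- t))).
congr preserves; apply/funext => -[[x y] z]; rewrite /rotz/= /rot_cos /rot_sin.
have := one_add_sqr_neq0 t => t2.
by congr ((_, _), _); field.
Qed.

Lemma preserves_roty (t : R) : preserves mu3 (roty t).
Proof.
have := preserves_comp (preserves_shear_zx (- t))
  (preserves_comp (preserves_shear_xz (rot_sin t)) (preserves_shear_zx (- t))).
congr preserves; apply/funext => -[[x y] z]; rewrite /roty/= /rot_cos /rot_sin.
have := one_add_sqr_neq0 t => t2.
by congr ((_, _), _); field.
Qed.

Lemma normsq3_rotz t p : normsq3 (rotz t p) = normsq3 p.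
Proof.
case: p => [[x y] z]; rewrite /normsq3/= /rot_cos /rot_sin.
by have := one_add_sqr_neq0 t => t2; field.
Qed.

Lemma normsq3_roty t p : normsq3 (roty t p) = normsq3 p.
Proof.
case: p => [[x y] z]; rewrite /normsq3/= /rot_cos /rot_sin.
by have := one_add_sqr_neq0 t => t2; field.
Qed.

End Rotations.

(** * Tensor powers of two by two matrices *)

Section TensorAlgebra.
Local Open Scope sesquilinear_scope.
Variable C : numClosedFieldType.

Lemma tensmxDl m n p q (A B : 'M[C]_(m, n)) (D : 'M[C]_(p, q)) : (A + B) *t D = A *t D + B *t D.
Proof. by apply/matrixP => i j; rewrite !mxE mulrDl. Qed.

Lemma tensmxDr m n p q (D : 'M[C]_(m, n)) (A B : 'M[C]_(p, q)) : D *t (A + B) = D *t A + D *t B.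
Proof. by apply/matrixP => i j; rewrite !mxE mulrDr. Qed.

Lemma tensmxZl m n p q (a : C) (A : 'M[C]_(m, n)) (D : 'M[C]_(p, q)) : (a *: A) *t D = a *: (A *t D).
Proof. by apply/matrixP => i j; rewrite !mxE mulrA. Qed.

Lemma tensmxZr m n p q (a : C) (D : 'M[C]_(m, n)) (A : 'M[C]_(p, q)) : D *t (a *: A) = a *: (D *t A).
Proof. by apply/matrixP => i j; rewrite !mxE mulrCA. Qed.

Lemma tensmxNl m n p q (A : 'M[C]_(m, n)) (D : 'M[C]_(p, q)) : (- A) *t D = - (A *t D).
Proof. by rewrite -scaleN1r tensmxZl scaleN1r. Qed.

Lemma tensmxNr m n p q (A : 'M[C]_(m, n)) (D : 'M[C]_(p, q)) : A *t (- D) = - (A *t D).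
Proof. by rewrite -scaleN1r tensmxZr scaleN1r. Qed.

Lemma tensmx_sumr m n p q (I : Type) (r : seq I) (P : pred I) (D : 'M[C]_(m, n)) (F : I -> 'M[C]_(p, q)) :
  D *t (\sum_(i <- r | P i) F i) = \sum_(i <- r | P i) D *t F i.
Proof. by apply: (big_morph _ (tensmxDr D)); rewrite tensmx0. Qed.

Lemma tensmx11 m n : (1%:M : 'M[C]_m) *t (1%:M : 'M[C]_n) = 1%:M.
Proof.
apply/matrixP => i j; case: (mxtens_indexP i) => i0 i1; case: (mxtens_indexP j) => j0 j1.
rewrite tensmxE !mxE -natrM mulnb -xpair_eqE.
by rewrite (inj_eq (can_inj (@mxtens_indexK _ _))).
Qed.

Lemma trace_tensmx m n (A : 'M[C]_m) (B : 'M[C]_n) : \tr (A *t B) = \tr A * \tr B.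
Proof.
rewrite /mxtrace mulr_sum; apply: eq_bigr => i _.
by rewrite mxE.
Qed.

(* The dimension 2 ^ n, with a successor case that is definitionally a product. *)
Fixpoint pw n : nat := if n is n'.+1 then (2 * pw n')%N else 1.

Fixpoint tpow (A : 'M[C]_2) n : 'M[C]_(pw n) :=
  if n is n'.+1 then A *t tpow A n' else 1%:M.

(** The coefficient of t^k in the n-th tensor power of 1 + t X: the sum, over all sets of k sites,
    of the operators acting by X on these sites. *)
Fixpoint tcoef (X : 'M[C]_2) n k : 'M[C]_(pw n) :=
  if n is n'.+1 then 1%:M *t tcoef X n' k + (if k is k'.+1 then X *t tcoef X n' k' else 0)
  else if k is 0 then 1%:M else 0.

(** The Lie algebra action on the tensor power: X acts at one site at a time. *)
Fixpoint tsum (X : 'M[C]_2) n : 'M[C]_(pw n) :=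
  if n is n'.+1 then X *t 1%:M + 1%:M *t tsum X n' else 0.

Definition e00 : 'M[C]_2 := delta_mx 0 0.
Definition e01 : 'M[C]_2 := delta_mx 0 1.
Definition e10 : 'M[C]_2 := delta_mx 1 0.
Definition e11 : 'M[C]_2 := delta_mx 1 1.

(* The projection onto the span of the basis vectors with exactly k ones. *)
Fixpoint wproj n k : 'M[C]_(pw n) :=
  if n is n'.+1 then e00 *t wproj n' k + (if k is k'.+1 then e11 *t wproj n' k' else 0)
  else if k is 0 then 1%:M else 0.

Lemma mxE2 (A B : 'M[C]_2) : A 0 0 = B 0 0 -> A 0 1 = B 0 1 -> A 1 0 = B 1 0 -> A 1 1 = B 1 1 -> A = B.
Proof.
move=> h1 h2 h3 h4; apply/matrixP => i j.
by case: i => [[|[|//]] ?]; case: j => [[|[|//]] ?];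
  [move: h1|move: h2|move: h3|move: h4]; congr (A _ _ = B _ _); apply: val_inj.
Qed.

Lemma mulmxE2 (A B : 'M[C]_2) i j : (A *m B) i j = A i 0 * B 0 j + A i 1 * B 1 j.
Proof.
rewrite mxE !big_ord_recl big_ord0 addr0.
by congr (A i _ * B _ j + A i _ * B _ j); apply: val_inj.
Qed.

Ltac mx2 := apply: mxE2; rewrite ?(mulmxE2, mxE) /= ?(mulr0, mul0r, mulr1, mul1r, addr0, add0r, subr0, sub0r, oppr0, mulr0n, mulr1n) //.

Lemma e00_e00 : e00 *m e00 = e00. Proof. by mx2. Qed.
Lemma e00_e01 : e00 *m e01 = e01. Proof. by mx2. Qed.
Lemma e00_e10 : e00 *m e10 = 0. Proof. by mx2. Qed.
Lemma e00_e11 : e00 *m e11 = 0. Proof. by mx2. Qed.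
Lemma e01_e00 : e01 *m e00 = 0. Proof. by mx2. Qed.
Lemma e01_e01 : e01 *m e01 = 0. Proof. by mx2. Qed.
Lemma e01_e10 : e01 *m e10 = e00. Proof. by mx2. Qed.
Lemma e01_e11 : e01 *m e11 = e01. Proof. by mx2. Qed.
Lemma e10_e00 : e10 *m e00 = e10. Proof. by mx2. Qed.
Lemma e10_e01 : e10 *m e01 = e11. Proof. by mx2. Qed.
Lemma e10_e10 : e10 *m e10 = 0. Proof. by mx2. Qed.
Lemma e10_e11 : e10 *m e11 = 0. Proof. by mx2. Qed.
Lemma e11_e00 : e11 *m e00 = 0. Proof. by mx2. Qed.
Lemma e11_e01 : e11 *m e01 = 0. Proof. by mx2. Qed.
Lemma e11_e10 : e11 *m e10 = e10. Proof. by mx2. Qed.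
Lemma e11_e11 : e11 *m e11 = e11. Proof. by mx2. Qed.
Lemma e00D11 : e00 + e11 = 1%:M. Proof. by mx2. Qed.

Definition eij_mul := (e00_e00, e00_e01, e00_e10, e00_e11, e01_e00, e01_e01, e01_e10, e01_e11,
  e10_e00, e10_e01, e10_e10, e10_e11, e11_e00, e11_e01, e11_e10, e11_e11).

Lemma tpowM (A B : 'M[C]_2) n : tpow (A *m B) n = tpow A n *m tpow B n.
Proof. by elim: n => [|n IHn] /=; rewrite ?mulmx1// IHn tensmx_mul. Qed.

Lemma tpow1 n : tpow 1%:M n = 1%:M.
Proof. by elim: n => [//|n IHn] /=; rewrite IHn tensmx11. Qed.

Lemma tpowZ (a : C) (A : 'M[C]_2) n : tpow (a *: A) n = a ^+ n *: tpow A n.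
Proof.
elim: n => [|n IHn] /=; first by rewrite expr0 scale1r.
by rewrite IHn tensmxZl tensmxZr scalerA exprS.
Qed.

Lemma tpow_unit (A : 'M[C]_2) n : A \in unitmx -> tpow A n \in unitmx.
Proof.
move=> uA; have : tpow A n *m tpow (invmx A) n = 1%:M by rewrite -tpowM mulmxV// tpow1.
by move=> /mulmx1_unit [].
Qed.

Lemma tcoef_gt X n k : (n < k)%N -> tcoef X n k = 0.
Proof.
elim: n k => [|n IHn] [|k]//= nk.
by rewrite !IHn// 1?ltnW// !tensmx0 addr0.
Qed.

Lemma tcoef0 X n : tcoef X n 0 = 1%:M.
Proof. by elim: n => [//|n IHn] /=; rewrite IHn tensmx11 addr0. Qed.

Lemma tcoef1 X n : tcoef X n 1 = tsum X n.
Proof. by elim: n => [//|n IHn] /=; rewrite IHn tcoef0 addrC. Qed.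

Lemma tpow_expand X n (t : C) : tpow (1%:M + t *: X) n = \sum_(k < n.+1) t ^+ k *: tcoef X n k.
Proof.
elim: n => [|n IHn] /=; first by rewrite big_ord1 expr0 scale1r.
rewrite IHn tensmxDl tensmxZl !tensmx_sumr.
under [RHS]eq_bigr do rewrite scalerDr.
rewrite big_split/= [in RHS]big_ord_recr/= tcoef_gt// tensmx0 scaler0 addr0.
congr (_ + _); first by apply: eq_bigr => k _; rewrite tensmxZr.
rewrite [in RHS]big_ord_recl/= scaler0 add0r scaler_sumr; apply: eq_bigr => k _.
by rewrite tensmxZr scalerA exprS.
Qed.

Lemma tsumD X Y n : tsum (X + Y) n = tsum X n + tsum Y n.
Proof. elim: n => [|n IHn] /=; rewrite ?addr0// IHn tensmxDl tensmxDr; exact: addrACA. Qed.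

Lemma tsumZ a X n : tsum (a *: X) n = a *: tsum X n.
Proof. by elim: n => [|n IHn] /=; rewrite ?scaler0// IHn tensmxZl tensmxZr scalerDr. Qed.

Lemma tsumN X n : tsum (- X) n = - tsum X n.
Proof. by rewrite -scaleN1r tsumZ scaleN1r. Qed.

Lemma tsumB X Y n : tsum (X - Y) n = tsum X n - tsum Y n.
Proof. by rewrite tsumD tsumN. Qed.

(** Operators at distinct sites commute, so only the commutators at a single site survive. *)
Lemma tsum_commutator X Y n :
  tsum X n *m tsum Y n - tsum Y n *m tsum X n = tsum (X *m Y - Y *m X) n.
Proof.
elim: n => [|n IHn] /=; first by rewrite mul0mx subrr.
rewrite -IHn !(mulmxDl, mulmxDr) !tensmx_mul !(mul1mx, mulmx1) tensmxDl tensmxNl tensmxDr.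
rewrite tensmxNr.
move: (_ *t 1%:M) (X *t _) (Y *t _) (1%:M *t _) (_ *t 1%:M) (1%:M *t _) => a b c d e f.
by apply/matrixP => i j; rewrite !mxE; ring.
Qed.

(* X is nilpotent of order two, so that tpow (1 + t X) is the exponential of t (tsum X). *)
Lemma tcoef_nilp X n k : X *m X = 0 -> tcoef X n k *m tsum X n = k.+1%:R *: tcoef X n k.+1.
Proof.
move=> X2; elim: n k => [|n IHn] k /=.
  by rewrite mulmx0 scaler0.
case: k => [|k].
  by rewrite addr0 mulmxDr !tensmx_mul !(mul1mx, mulmx1) IHn tcoef0 !scale1r addrC.
rewrite !(mulmxDl, mulmxDr) !tensmx_mul !(mul1mx, mulmx1) X2 tens0mx add0r !IHn !tensmxZr.
move: (X *t _) (1%:M *t _) => a b; apply/matrixP => i j; rewrite !mxE; ring.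
Qed.

Lemma tcoef_nilp0 X n k m (v : 'M[C]_(pw n, m)) : X *m X = 0 -> tsum X n *m v = 0 ->
  tcoef X n k.+1 *m v = 0.
Proof.
move=> X2 v0; have /(congr1 (mulmx^~ v)) := tcoef_nilp n k X2.
rewrite -mulmxA v0 mulmx0 -scalemxAl => /esym/eqP.
by rewrite scaler_eq0 pnatr_eq0/= => /eqP.
Qed.

Lemma tpow_unipotent_fix X n t m (v : 'M[C]_(pw n, m)) : X *m X = 0 -> tsum X n *m v = 0 ->
  tpow (1%:M + t *: X) n *m v = v.
Proof.
move=> X2 v0; rewrite tpow_expand big_ord_recl/= expr0 scale1r tcoef0 mulmxDl mul1mx.
rewrite mulmx_suml big1 ?addr0// => k _.
by rewrite -scalemxAl tcoef_nilp0// scaler0.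
Qed.

Lemma wproj_gt n k : (n < k)%N -> wproj n k = 0.
Proof.
elim: n k => [|n IHn] [|k]//= nk.
by rewrite !IHn// 1?ltnW// !tensmx0 addr0.
Qed.

Lemma wproj_mul n k l : wproj n k *m wproj n l = if k == l then wproj n k else 0.
Proof.
elim: n k l => [|n IHn] [|k] [|l] /=; rewrite ?(mulmx1, mulmx0, mul0mx)//.
- by case: eqP.
- by rewrite addr0 tensmx_mul eij_mul IHn eqxx.
- by rewrite addr0 mulmxDr !tensmx_mul !eij_mul tens0mx IHn tensmx0 addr0.
- by rewrite addr0 mulmxDl !tensmx_mul !eij_mul tens0mx IHn tensmx0 addr0.
rewrite mulmxDl !mulmxDr !tensmx_mul !eij_mul !tens0mx !IHn addr0 add0r eqSS.
by case: eqP => _; rewrite ?tensmx0 ?addr0.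
Qed.

Lemma tpow_diag (s t : C) n :
  tpow (s *: e00 + t *: e11) n = \sum_(k < n.+1) (s ^+ (n - k) * t ^+ k) *: wproj n k.
Proof.
elim: n => [|n IHn] /=; first by rewrite big_ord1 expr0 mulr1 scale1r.
rewrite IHn tensmxDl !tensmxZl !tensmx_sumr.
under [RHS]eq_bigr do rewrite scalerDr.
rewrite big_split/= [in RHS]big_ord_recr/= wproj_gt// tensmx0 scaler0 addr0.
congr (_ + _).
  rewrite scaler_sumr; apply: eq_bigr => k _.
  by rewrite tensmxZr scalerA mulrA -exprS subSn// -ltnS.
rewrite [in RHS]big_ord_recl/= scaler0 add0r scaler_sumr; apply: eq_bigr => k _.
by rewrite tensmxZr scalerA mulrCA -exprS.
Qed.

Lemma sum_wproj n : \sum_(k < n.+1) wproj n k = 1%:M.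
Proof.
have := tpow_diag 1 1 n; rewrite !scale1r e00D11 tpow1 => ->.
by apply: eq_bigr => k _; rewrite !expr1n mulr1 scale1r.
Qed.

Lemma mxtrace2 (A : 'M[C]_2) : \tr A = A 0 0 + A 1 1.
Proof.
rewrite /mxtrace !big_ord_recl big_ord0 addr0.
by congr (_ + A _ _); apply: val_inj.
Qed.

Lemma trace_wproj n k : \tr (wproj n k) = 'C(n, k)%:R.
Proof.
have t00 : \tr e00 = 1 by rewrite mxtrace2 !mxE /= addr0.
have t11 : \tr e11 = 1 by rewrite mxtrace2 !mxE /= add0r.
elim: n k => [|n IHn] [|k] /=; rewrite ?mxtrace1 ?mxtrace0 ?bin0//.
  by rewrite addr0 trace_tensmx IHn bin0 t00 mulr1.
by rewrite mxtraceD !trace_tensmx !IHn t00 t11 !mul1r binS natrD.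
Qed.

Lemma det2 (A : 'M[C]_2) : \det A = A 0 0 * A 1 1 - A 0 1 * A 1 0.
Proof.
rewrite (expand_det_row _ 0) !big_ord_recl big_ord0 addr0 /cofactor !det_mx11 !mxE /=.
rewrite expr0 expr1 mul1r mulN1r mulrN.
by congr (_ * A _ _ - A _ _ * A _ _); apply: val_inj.
Qed.

Lemma tsum_e01_wproj0 n : tsum e01 n *m wproj n 0 = 0.
Proof.
elim: n => [|n IHn] /=; rewrite ?mul0mx// addr0 !mulmxDl !tensmx_mul !eij_mul IHn.
by rewrite tens0mx tensmx0 addr0.
Qed.

Lemma tsum_e01_wproj n k : tsum e01 n *m wproj n k.+1 = wproj n k *m tsum e01 n.
Proof.
elim: n k => [|n IHn] [|k] /=; rewrite ?(mulmx0, mul0mx, addr0)// !(mulmxDl, mulmxDr) !tensmx_mul.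
  rewrite !eij_mul !(mul1mx, mulmx1) tens0mx add0r !IHn tsum_e01_wproj0 tensmx0 addr0.
  by [].
by rewrite !eij_mul !(mul1mx, mulmx1) !tens0mx !add0r !IHn addrA.
Qed.

Lemma wproj0_tsum_e10 n : wproj n 0 *m tsum e10 n = 0.
Proof.
elim: n => [|n IHn] /=; rewrite ?mulmx0// addr0 !mulmxDr !tensmx_mul !eij_mul IHn.
by rewrite tens0mx tensmx0 addr0.
Qed.

Lemma tsum_e10_wproj n k : tsum e10 n *m wproj n k = wproj n k.+1 *m tsum e10 n.
Proof.
elim: n k => [|n IHn] [|k] /=; rewrite ?(mulmx0, mul0mx, addr0)// !(mulmxDl, mulmxDr) !tensmx_mul.
  rewrite !eij_mul !(mul1mx, mulmx1) !tens0mx add0r !IHn wproj0_tsum_e10 tensmx0 addr0.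
  exact: addrC.
rewrite !eij_mul !(mul1mx, mulmx1) !tens0mx !IHn add0r addr0.
exact: addrCA.
Qed.

Lemma tsum_sigmaz_wproj n k :
  tsum (e00 - e11) n *m wproj n k = (n%:R - 2 * k%:R) *: wproj n k.
Proof.
elim: n k => [|n IHn] [|k] /=; rewrite ?(mul0mx, mulr0, subr0, scale0r, scaler0)//.
- rewrite addr0 mulmxDl !tensmx_mul mulmxBl !eij_mul subr0 !mul1mx IHn mulr0 subr0 tensmxZr.
  by rewrite -[X in X + _]scale1r -scalerDl nat1r.
rewrite !(mulmxDl, mulmxDr) !tensmx_mul !mulmxBl !eij_mul !(mul1mx, subr0, sub0r) !IHn !tensmxZr tensmxNl.
move: (e00 *t _) (e11 *t _) => a b; apply/matrixP => i j; rewrite !mxE; ring.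
Qed.

Lemma wproj_tsum_sigmaz n k :
  wproj n k *m tsum (e00 - e11) n = (n%:R - 2 * k%:R) *: wproj n k.
Proof.
elim: n k => [|n IHn] [|k] /=; rewrite ?(mulmx0, mulr0, subr0, scale0r, scaler0)//.
- rewrite addr0 mulmxDr !tensmx_mul mulmxBr !eij_mul subr0 !mulmx1 IHn mulr0 subr0 tensmxZr.
  by rewrite -[X in X + _]scale1r -scalerDl nat1r.
rewrite !(mulmxDl, mulmxDr) !tensmx_mul !mulmxBr !eij_mul !(mulmx1, subr0, sub0r) !IHn !tensmxZr tensmxNl.
move: (e00 *t _) (e11 *t _) => a b; apply/matrixP => i j; rewrite !mxE; ring.
Qed.

(** The matrices [wproj n k] are the spectral projections of [tsum (e00 - e11) n], for the distinct
    eigenvalues n - 2 k, so the off-diagonal blocks of Z vanish. *)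
Lemma comm_wproj n (Z : 'M[C]_(pw n)) k :
  Z *m tsum (e00 - e11) n = tsum (e00 - e11) n *m Z -> Z *m wproj n k = wproj n k *m Z.
Proof.
move=> ZT.
have off l j : l != j -> wproj n l *m Z *m wproj n j = 0.
  move=> lj; have : wproj n l *m (Z *m tsum (e00 - e11) n) *m wproj n j =
     wproj n l *m (tsum (e00 - e11) n *m Z) *m wproj n j by rewrite ZT.
  rewrite -!mulmxA tsum_sigmaz_wproj !mulmxA wproj_tsum_sigmaz -scalemxAr -!scalemxAl => /eqP.
  rewrite -subr_eq0 -scalerBl scaler_eq0 => /orP[|/eqP//].
  have -> : n%:R - 2 * j%:R - (n%:R - 2 * l%:R) = 2 * (l%:R - j%:R) :> C by ring.
  by rewrite mulf_eq0 pnatr_eq0/= subr_eq0 eqr_nat (negbTE lj).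
have [kn|kn] := leqP k n; last by rewrite wproj_gt// mulmx0 mul0mx.
have jk0 (j : 'I_n.+1) : j != inord k -> (j : nat) != k.
  by apply: contraNneq => jk; apply/eqP/val_inj; rewrite /= inordK.
transitivity (wproj n k *m Z *m wproj n k).
  rewrite -{1}[Z]mul1mx -(sum_wproj n) mulmx_suml mulmx_suml (bigD1 (inord k))//= inordK ?ltnS//.
  by rewrite big1 ?addr0// => j /jk0 jk; rewrite off.
rewrite -[in RHS](mulmx1 Z) -(sum_wproj n) !mulmx_sumr (bigD1 (inord k))//= inordK ?ltnS//.
by rewrite big1 ?addr0 ?mulmxA// => j /jk0 jk; rewrite mulmxA off// eq_sym.
Qed.

Lemma tcoef_e10_wproj n j k : tcoef e10 n j *m wproj n k = wproj n (j + k) *m tcoef e10 n j.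
Proof.
elim: j k => [|j IHj] k; first by rewrite !tcoef0 mul1mx mulmx1.
apply: (@scalerI _ _ j.+1%:R); first by rewrite pnatr_eq0.
rewrite scalemxAl scalemxAr -!(tcoef_nilp _ _ e10_e10).
by rewrite -mulmxA tsum_e10_wproj mulmxA IHj addnS addSn -mulmxA.
Qed.

(** Every term of positive degree in t strictly increases the number of ones, so only the identity
    is left on the diagonal block. *)
Lemma wproj_tpow_lower n t k : wproj n k *m tpow (1%:M + t *: e10) n *m wproj n k = wproj n k.
Proof.
rewrite tpow_expand big_ord_recl/= expr0 scale1r tcoef0 mulmxDr mulmx1 mulmxDl wproj_mul eqxx.
rewrite mulmx_sumr mulmx_suml big1 ?addr0// => j _.
rewrite -scalemxAr -scalemxAl -mulmxA tcoef_e10_wproj mulmxA wproj_mul.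
by rewrite -[X in X == _]add0n eqn_add2r/= mul0mx scaler0.
Qed.

Lemma tpow_diag_wproj (s t : C) n k : (k <= n)%N ->
  tpow (s *: e00 + t *: e11) n *m wproj n k = (s ^+ (n - k) * t ^+ k) *: wproj n k.
Proof.
move=> kn; rewrite tpow_diag mulmx_suml (bigD1 (inord k))//= big1 => [|j jk].
  by rewrite addr0 inordK ?ltnS// -scalemxAl wproj_mul eqxx.
rewrite -scalemxAl wproj_mul ifF ?scaler0//; apply: contraNF jk => /eqP jk.
by apply/eqP/val_inj; rewrite /= inordK ?ltnS.
Qed.

Lemma gauss_decomposition (A : 'M[C]_2) : A 0 0 != 0 ->
  A = (1%:M + (A 1 0 / A 0 0) *: e10) *m (A 0 0 *: e00 + (\det A / A 0 0) *: e11)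
      *m (1%:M + (A 0 1 / A 0 0) *: e01).
Proof.
move=> a0; rewrite det2; apply: mxE2; rewrite !(mulmxE2, mxE) /=
  !(mulr0, mul0r, mulr1, mul1r, addr0, add0r, mulr0n, mulr1n) //; by field.
Qed.

(** In the Gauss decomposition the upper factor fixes [v], the diagonal factor is the scalar a^(n -
    k) (det A / a)^k on the weight space, with a = A 0 0, and the lower factor disappears under the
    projection. *)
Lemma wproj_tpow_highest (A : 'M[C]_2) n k m (v : 'M[C]_(pw n, m)) : A 0 0 != 0 ->
  (2 * k <= n)%N -> wproj n k *m v = v -> tsum e01 n *m v = 0 ->
  wproj n k *m tpow A n *m v = (A 0 0 ^+ (n - 2 * k) * \det A ^+ k) *: v.
Proof.
move=> a0 kn vk v0; rewrite {1}(gauss_decomposition a0) !tpowM -!mulmxA.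
rewrite (tpow_unipotent_fix _ e01_e01 v0) -{1}vk [X in _ *m (_ *m X)]mulmxA tpow_diag_wproj; last first.
  by rewrite (leq_trans _ kn)// mul2n -addnn leq_addr.
rewrite -scalemxAl -!scalemxAr !mulmxA wproj_tpow_lower vk; congr (_ *: _).
have [k' nk] : exists k', n = (k' + 2 * k)%N by exists (n - 2 * k)%N; rewrite subnK.
rewrite nk addnK (_ : k' + 2 * k - k = k' + k)%N; last by rewrite mul2n -addnn addnA addnK.
by rewrite exprD expr_div_n -mulrA; congr (_ * _); rewrite mulrC divfK// expf_neq0.
Qed.

Lemma tpow_adjoint (A : 'M[C]_2) n : (tpow A n)^t* = tpow (A^t*) n.
Proof.
elim: n => [|n IHn] /=; first by rewrite trmx1 map_mx1.
by rewrite -IHn trmx_tens map_mxT.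
Qed.

Lemma tsum_adjoint (A : 'M[C]_2) n : (tsum A n)^t* = tsum (A^t*) n.
Proof.
elim: n => [|n IHn] /=; first by rewrite trmx0 map_mx0.
by rewrite -IHn linearD/= map_mxD !trmx_tens !map_mxT !trmx1 !map_mx1.
Qed.

Lemma e10_adjoint : e10^t* = e01.
Proof. by rewrite trmx_delta map_delta_mx. Qed.

(** Plays two roles: the generator of the rotations about the y axis, and the lift of the half turn
    about that axis, which exchanges zeros and ones. *)
Definition eflip : 'M[C]_2 := e10 - e01.

Lemma tpow_flip_wproj n k : (k <= n)%N ->
  tpow eflip n *m wproj n k = wproj n (n - k) *m tpow eflip n.
Proof.
have f0 : eflip *m e00 = e11 *m eflip by rewrite mulmxBl mulmxBr !eij_mul !subr0.
have f1 : eflip *m e11 = e00 *m eflip by rewrite mulmxBl mulmxBr !eij_mul !sub0r.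
elim: n k => [|n IHn] [|k]//= kn.
  rewrite addr0 tensmx_mul f0 IHn// !subn0 (@wproj_gt n n.+1)// tensmx0 add0r.
  by rewrite -tensmx_mul.
rewrite mulmxDr !tensmx_mul f0 f1 subSS (IHn _ kn); have [kn'|kn'] := ltnP k n.
  rewrite (IHn _ kn') subnS; case E : (n - k)%N => [|m]/=; first by move/eqP: E; rewrite subn_eq0 leqNgt kn'.
  by rewrite mulmxDl !tensmx_mul addrC.
have -> : (n - k)%N = 0 by apply/eqP; rewrite subn_eq0.
by rewrite (@wproj_gt n k.+1)// mulmx0 tensmx0 add0r addr0 tensmx_mul.
Qed.

Lemma sqnorm_ge0 m (u : 'rV[C]_m) : 0 <= (u *m u^t*) 0 0.
Proof. by rewrite mxE sumr_ge0// => i _; rewrite !mxE mul_conjC_ge0. Qed.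

Lemma sqnorm_eq0 m (u : 'rV[C]_m) : (u *m u^t*) 0 0 = 0 -> u = 0.
Proof.
move=> /eqP; rewrite mxE psumr_eq0 => [/allP u0|i _]; last by rewrite !mxE mul_conjC_ge0.
apply/rowP => i; have := u0 i (mem_index_enum _).
by rewrite !mxE mul_conjC_eq0 => /eqP.
Qed.

(** The matrix is positive definite: a vector u in its left kernel satisfies |u A^*|^2 + c |u|^2 =
    0. *)
Lemma adjoint_add_scalar_unit m (A : 'M[C]_m) (c : C) : 0 < c -> A^t* *m A + c%:M \in unitmx.
Proof.
move=> c0; rewrite -row_free_unit -kermx_eq0; apply/eqP/row_matrixP => i; rewrite row0.
set u := row i _.
have uH : u *m (A^t* *m A + c%:M) = 0 by rewrite -row_mul mulmx_ker row0.
apply: sqnorm_eq0; apply/eqP; rewrite eq_le sqnorm_ge0 andbT.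
have /matrixP/(_ 0 0) := congr1 (mulmx^~ (u^t*)) uH.
rewrite mul0mx mulmxDr mulmxDl mul_mx_scalar -scalemxAl.
have -> : u *m (A^t* *m A) *m u^t* = (u *m A^t*) *m (u *m A^t*)^t*.
  by rewrite trmx_mul map_mxM trmxCK !mulmxA.
rewrite mxE [X in _ + X]mxE [RHS]mxE => h.
rewrite -(pmulr_rle0 _ c0) -h -[leLHS]add0r lerD2r.
exact: sqnorm_ge0.
Qed.

(** The commutator of the generators about the z and y axes gives, up to a factor, the third one,
    and the ladder operators are combinations of the last two. *)
Lemma comm_ladder n (Z : 'M[C]_(pw n)) :
  Z *m tsum (e00 - e11) n = tsum (e00 - e11) n *m Z ->
  Z *m tsum (e10 - e01) n = tsum (e10 - e01) n *m Z ->
  Z *m tsum e01 n = tsum e01 n *m Z /\ Z *m tsum e10 n = tsum e10 n *m Z.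
Proof.
move=> ZS ZF.
have SF : tsum (e00 - e11) n *m tsum (e10 - e01) n - tsum (e10 - e01) n *m tsum (e00 - e11) n
    = (- 2) *: tsum (e10 + e01) n.
  rewrite tsum_commutator -tsumZ; congr (tsum _ n).
  rewrite !(mulmxBl, mulmxBr) !eij_mul; move: e10 e01 => a b.
  by apply/matrixP => i j; rewrite !mxE; ring.
have ZG : Z *m tsum (e10 + e01) n = tsum (e10 + e01) n *m Z.
  apply: (@scalerI _ _ (-2 : C)); first by rewrite oppr_eq0 pnatr_eq0.
  rewrite scalemxAr scalemxAl -SF mulmxBr mulmxBl !mulmxA ZS ZF -!mulmxA ZF ZS.
  by rewrite !mulmxA.
have two : (2 : C) != 0 by rewrite pnatr_eq0.
split; apply: (scalerI two); rewrite scalemxAr scalemxAl -tsumZ.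
  have -> : 2 *: e01 = (e10 + e01) - (e10 - e01).
    by move: e10 e01 => a b; apply/matrixP => i j; rewrite !mxE; ring.
  by rewrite tsumB mulmxBr mulmxBl ZG ZF.
have -> : 2 *: e10 = (e10 + e01) + (e10 - e01).
  by move: e10 e01 => a b; apply/matrixP => i j; rewrite !mxE; ring.
by rewrite tsumD mulmxDr mulmxDl ZG ZF.
Qed.

(** The half turn lies outside the family 1 + t X, but 1 + [eflip] is a quarter turn whose square is
    2 [eflip]. *)
Lemma comm_tpow_flip n (Z : 'M[C]_(pw n)) :
  Z *m tpow (1%:M + eflip) n = tpow (1%:M + eflip) n *m Z ->
  Z *m tpow eflip n = tpow eflip n *m Z.
Proof.
set V := _ + _ => ZV.
have {}ZV : Z *m (tpow V n *m tpow V n) = (tpow V n *m tpow V n) *m Z.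
  by rewrite mulmxA ZV -mulmxA ZV mulmxA.
have E : V *m V = 2 *: eflip.
  have : eflip *m eflip = - 1%:M.
    rewrite /eflip !(mulmxBl, mulmxBr) !eij_mul -e00D11 sub0r subr0.
    by rewrite opprD addrC.
  rewrite /V; move: eflip => f ff; rewrite mulmxDl !mulmxDr !mul1mx !mulmx1 ff.
  by move: (1%:M) => a; apply/matrixP => i j; rewrite !mxE; ring.
move: ZV; rewrite -tpowM E tpowZ -scalemxAr -scalemxAl.
by apply: scalerI; rewrite expf_neq0// pnatr_eq0.
Qed.

Lemma trace_wproj_sym n (L : 'M[C]_(pw n)) k : (k <= n)%N ->
  L *m tpow eflip n = tpow eflip n *m L ->
  \tr (L *m wproj n (n - k)) = \tr (L *m wproj n k).
Proof.
move=> kn LF.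
have uF : tpow eflip n \in unitmx.
  apply: tpow_unit; rewrite unitmxE det2 !mxE /= !(subr0, sub0r, mulr0, mulNr, mulr1, opprK).
  by rewrite unitfE oner_eq0.
have -> : wproj n (n - k) = tpow eflip n *m wproj n k *m invmx (tpow eflip n).
  by rewrite tpow_flip_wproj// mulmxK.
by rewrite !mulmxA LF -!mulmxA mxtrace_mulC -!mulmxA mulVmx// mulmx1.
Qed.

Lemma trace_scaled_conj m (c : C) (W P L : 'M[C]_m) : W \in unitmx -> L *m W = W *m L ->
  \tr (c *: (W *m P *m invmx W) *m L) = c * \tr (L *m P).
Proof.
move=> uW LW; rewrite -scalemxAl mxtraceZ mxtrace_mulC !mulmxA LW -!mulmxA mxtrace_mulC -!mulmxA.
by rewrite mulVmx// mulmx1.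
Qed.

Lemma sum_conj_wproj n (W M : 'M[C]_(pw n)) : W \in unitmx ->
  M = \sum_(k < n.+1) M *m (W *m wproj n k) *m invmx W.
Proof.
move=> uW; rewrite -mulmx_suml -mulmx_sumr -mulmx_sumr sum_wproj mulmx1.
by rewrite -mulmxA mulmxV// mulmx1.
Qed.

Lemma trace_scaled_eigen n (A W : 'M[C]_(pw n)) (l mu : C) k : W \in unitmx ->
  A *m (W *m wproj n k) = mu *: (W *m wproj n k) ->
  \tr (A *m (l *: (W *m wproj n k *m invmx W))) = l * mu * 'C(n, k)%:R.
Proof.
move=> uW AW; rewrite -scalemxAr mxtraceZ mulmxA AW -scalemxAl mxtraceZ mxtrace_mulC mulmxA mulVmx//.
by rewrite mul1mx trace_wproj mulrA.
Qed.

Lemma tpow_spectral n (A V : 'M[C]_2) (s t : C) : V \in unitmx ->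
  A *m V = V *m (s *: e00 + t *: e11) ->
  tpow A n = \sum_(k < n.+1) (s ^+ (n - k) * t ^+ k) *: (tpow V n *m wproj n k *m invmx (tpow V n)).
Proof.
move=> uV AV; have uW : tpow V n \in unitmx by exact: tpow_unit.
have := congr1 (fun M => tpow M n *m invmx (tpow V n)) AV.
rewrite /= !tpowM mulmxK// tpow_diag => ->.
by rewrite mulmx_sumr mulmx_suml; apply: eq_bigr => k _; rewrite -scalemxAr -scalemxAl.
Qed.

Lemma tpow_spectral_eigen n (A V : 'M[C]_2) (s t : C) k : (k <= n)%N ->
  A *m V = V *m (s *: e00 + t *: e11) ->
  tpow A n *m (tpow V n *m wproj n k) = (s ^+ (n - k) * t ^+ k) *: (tpow V n *m wproj n k).
Proof.
move=> kn AV; have := congr1 (fun M => tpow M n *m wproj n k) AV.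
by rewrite /= !tpowM -!mulmxA tpow_diag_wproj// => ->; rewrite scalemxAr.
Qed.

(** * Traces on weight spaces from the action on highest weight vectors *)

Section HighestWeight.
Variables (n : nat) (L : 'M[C]_(pw n)) (g : nat -> C).
Hypothesis Lup : L *m tsum e01 n = tsum e01 n *m L.
Hypothesis Ldn : L *m tsum e10 n = tsum e10 n *m L.
Hypothesis Lwp : forall k, L *m wproj n k = wproj n k *m L.
Hypothesis Lhw : forall k (X : 'M[C]_(pw n)), (2 * k <= n)%N ->
  wproj n k *m X = X -> tsum e01 n *m X = 0 -> L *m X = g k *: X.

Lemma trace_wproj0 : \tr (L *m wproj n 0) = g 0.
Proof.
rewrite (Lhw (k := 0))//; last exact: tsum_e01_wproj0; last by rewrite wproj_mul.
by rewrite mxtraceZ trace_wproj bin0 mulr1.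
Qed.

(** The weight space k + 1 splits into the image of the weight space k under [Jm], cut out by [Q],
    and highest weight vectors, on which L is the scalar g (k + 1). By cyclicity the trace of L on
    the first piece is its trace on the weight space k. The condition 2 (k + 1) <= n makes [c]
    positive, hence [H] invertible. *)
Lemma trace_wprojS k : (2 * k.+1 <= n)%N ->
  \tr (L *m wproj n k.+1) = \tr (L *m wproj n k) + g k.+1 * ('C(n, k.+1)%:R - 'C(n, k)%:R).
Proof.
move=> kn; pose Jp := tsum e01 n; pose Jm := tsum e10 n; pose P := wproj n.
pose c : C := n%:R - 2 * k%:R.
have c0 : 0 < c.
  by rewrite subr_gt0 -natrM ltr_nat (leq_trans _ kn)// ltn_pmul2l.
pose H := Jm *m Jp + c%:M.
have Hu : H \in unitmx.
  rewrite /H /Jm (_ : tsum e10 n = Jp^t*) ?adjoint_add_scalar_unit//.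
  by rewrite /Jp tsum_adjoint -e10_adjoint trmxCK.
have JJ : Jp *m Jm = Jm *m Jp + tsum (e00 - e11) n.
  have := tsum_commutator e01 e10 n; rewrite !eij_mul => <-.
  by rewrite addrC subrK.
have HP : Jp *m Jm *m P k = H *m P k.
  by rewrite JJ !mulmxDl tsum_sigmaz_wproj mul_scalar_mx.
have PH : P k *m H = H *m P k.
  rewrite mulmxDr mulmxDl mul_scalar_mx mul_mx_scalar; congr (_ + _); rewrite /P /Jm /Jp.
  case: k {kn c c0 H Hu HP} => [|k]; first by rewrite mulmxA wproj0_tsum_e10 -mulmxA tsum_e01_wproj0 mul0mx mulmx0.
  by rewrite mulmxA -tsum_e10_wproj -!mulmxA tsum_e01_wproj.
pose K := invmx H.
have HK : H *m K = 1%:M by rewrite mulmxV.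
have KH : K *m H = 1%:M by rewrite mulVmx.
have KP : K *m P k = P k *m K.
  by rewrite -[P k *m K]mul1mx -KH -!mulmxA (mulmxA H) -PH -!mulmxA HK mulmx1.
(* On the weight space k the product Jp Jm equals H, so K = H^-1 is the normalization for which Jp Q
   = P k Jp; the columns of P (k + 1) - Q are then killed by Jp. *)
pose Q := Jm *m P k *m K *m Jp.
have trQ (M : 'M[C]_(pw n)) : M *m Jp = Jp *m M -> \tr (M *m Q) = \tr (M *m P k).
  move=> MJ; rewrite /Q !mulmxA mxtrace_mulC !mulmxA -MJ -!mulmxA (mulmxA Jp) (mulmxA _ (P k)) HP -PH.
  by rewrite -!mulmxA HK mulmx1.
have QP : P k.+1 *m Q = Q by rewrite /Q /Jm tsum_e10_wproj !mulmxA wproj_mul eqxx.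
have JQ : Jp *m Q = P k *m Jp.
  by rewrite /Q !mulmxA HP -PH -(mulmxA (P k)) HK mulmx1.
have LX := Lhw (X := P k.+1 - Q) kn.
have -> : L *m P k.+1 = L *m Q + g k.+1 *: (P k.+1 - Q).
  rewrite -LX ?mulmxBr; first by rewrite addrC subrK.
  - by rewrite QP wproj_mul eqxx.
  - by rewrite JQ /Jp /P tsum_e01_wproj subrr.
rewrite mxtraceD mxtraceZ linearB/= trQ// -[Q]mul1mx trQ ?mul1mx ?mulmx1//.
by rewrite /P !trace_wproj.
Qed.
End HighestWeight.

End TensorAlgebra.

(** * Bernstein polynomials and relative entropy *)

Section Bernstein.
Variable R : realType.

(* The expectation of f K for a binomial variable K with parameters n and q. *)
Fixpoint bern n (f : nat -> R) (q : R) : R :=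
  if n is n'.+1 then (1 - q) * bern n' f q + q * bern n' (fun k => f k.+1) q else f 0%N.

Lemma bernE n (f : nat -> R) q :
  bern n f q = \sum_(k < n.+1) 'C(n, k)%:R * ((1 - q) ^+ (n - k) * q ^+ k) * f k.
Proof.
elim: n f => [|n IHn] f /=; first by rewrite big_ord1 expr0 !mul1r.
rewrite !IHn big_ord_recl [in RHS]big_ord_recl/= !bin0 !subn0 !mul1r !expr0 !mulr1 mulrDr mulrA -exprS.
rewrite -addrA; congr (_ + _).
have -> : \sum_(i < n) 'C(n, bump 0 i)%:R * ((1 - q) ^+ (n - bump 0 i) * q ^+ bump 0 i) * f (bump 0 i) =
   \sum_(i < n.+1) 'C(n, i.+1)%:R * ((1 - q) ^+ (n - i.+1) * q ^+ i.+1) * f i.+1.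
  by rewrite big_ord_recr/= bin_small// !mul0r addr0; apply: eq_bigr.
rewrite !mulr_sumr -big_split/=; apply: eq_bigr => i _.
rewrite /bump/= add1n binS natrD subSS; have [ni|ni] := ltnP i n; last first.
  by rewrite bin_small// !mul0r mulr0 !add0r; rewrite exprS; ring.
by rewrite -(subnSK ni) !exprS; ring.
Qed.

Lemma eq_bern n (f g : nat -> R) q : (forall k, (k <= n)%N -> f k = g k) -> bern n f q = bern n g q.
Proof. by move=> fg; rewrite !bernE; apply: eq_bigr => k _; rewrite fg// -ltnS. Qed.

Lemma bern_affine n a b q : bern n (fun k => a + k%:R * b) q = a + n%:R * q * b.
Proof.
elim: n a => [|n IHn] a /=; first by rewrite !mul0r.
rewrite IHn (_ : (fun k => a + k.+1%:R * b) = (fun k => (a + b) + k%:R * b)) ?IHn -?natr1.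
  by ring.
by apply/funext => k; rewrite -natr1; ring.
Qed.

Lemma summation_by_parts n (l : nat -> R) (s t : R) : l n.+1 = 0 ->
  (s - t) * (\sum_(k < n.+1) s ^+ (n - k) * t ^+ k * l k) =
  s ^+ n.+1 * l 0%N + \sum_(k < n.+1) s ^+ (n - k) * t ^+ k.+1 * (l k.+1 - l k).
Proof.
move=> l0; rewrite mulrBl.
have -> : s * \sum_(k < n.+1) s ^+ (n - k) * t ^+ k * l k =
    s ^+ n.+1 * l 0%N + \sum_(k < n.+1) s ^+ (n - k) * t ^+ k.+1 * l k.+1.
  rewrite big_ord_recl [in RHS]big_ord_recr/= l0 mulr0 addr0 subn0 expr0 mulr1 mulrDr mulrA -exprS.
  congr (_ + _); rewrite mulr_sumr; apply: eq_bigr => k _.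
  by rewrite /bump/= add1n -(subnSK (ltn_ord k)) !exprS; ring.
rewrite -addrA; congr (_ + _); rewrite mulr_sumr -sumrB; apply: eq_bigr => k _.
by rewrite exprS; ring.
Qed.

(** After summation by parts, the terms with C(n, k + 1) reassemble into s times the Bernstein
    polynomial of g and those with C(n, k) into t times that of its shift. Keeping the factor s - t
    on the left makes the identity valid at s = t too. *)
Lemma binomial_difference_sum n (l g : nat -> R) (s t : R) : s + t = 1 -> l n.+1 = 0 -> l 0%N = g 0%N ->
  (forall k, (k <= n)%N -> l k.+1 - l k = ('C(n, k.+1)%:R - 'C(n, k)%:R) * g k.+1) ->
  (s - t) * (\sum_(k < n.+1) s ^+ (n - k) * t ^+ k * l k) =
  s * bern n g t - t * bern n (fun k => g k.+1) t.
Proof.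
move=> st ln l0 lS; rewrite summation_by_parts// l0 !bernE (_ : 1 - t = s); last by rewrite -st addrK.
rewrite [X in s * X]big_ord_recl/= bin0 mul1r subn0 expr0 mulr1 mulrDr mulrA -exprS -addrA; congr (_ + _).
have -> : \sum_(i < n) 'C(n, bump 0 i)%:R * (s ^+ (n - bump 0 i) * t ^+ bump 0 i) * g (bump 0 i) =
   \sum_(i < n.+1) 'C(n, i.+1)%:R * (s ^+ (n - i.+1) * t ^+ i.+1) * g i.+1.
  by rewrite big_ord_recr/= bin_small// !mul0r addr0; apply: eq_bigr.
rewrite !mulr_sumr -sumrB; apply: eq_bigr => k _.
have kn' : (k <= n)%N by rewrite -ltnS.
rewrite (lS _ kn').
have [kn|kn] := ltnP k n; last by rewrite bin_small// !mul0r mulr0 sub0r exprS; ring.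
by rewrite -(subnSK kn) !exprS; ring.
Qed.

Lemma sum_binomial_entropy n (s t : R) : 0 <= s -> 0 <= t -> s + t = 1 ->
  \sum_(k < n.+1) 'C(n, k)%:R * (s ^+ (n - k) * t ^+ k) * ln (s ^+ (n - k) * t ^+ k) =
  n%:R * (s * ln s + t * ln t).
Proof.
move=> s0 t0 st.
(* The endpoints are separate because ln of a product splits only for positive factors; there each
   term is 0 times a logarithm or contains ln 1. *)
have [s00|sn0] := eqVneq s 0.
  have t1 : t = 1 by rewrite -st s00 add0r.
  rewrite s00 t1 ln1 mulr0 mul0r addr0 mulr0 big1// => k _; rewrite expr1n mulr1.
  by case: (n - k)%N => [|m]; rewrite ?expr0 ?ln1 ?mulr0// exprS !(mul0r, mulr0).
have [t00|tn0] := eqVneq t 0.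
  have s1 : s = 1 by rewrite -st t00 addr0.
  rewrite s1 t00 ln1 mulr0 mul0r addr0 mulr0 big1// => k _; rewrite expr1n mul1r.
  by case: (k : nat) => [|m]; rewrite ?expr0 ?ln1 ?mulr0// exprS !(mul0r, mulr0).
have sp : 0 < s by rewrite lt_neqAle eq_sym sn0.
have tp : 0 < t by rewrite lt_neqAle eq_sym tn0.
transitivity (bern n (fun k => n%:R * ln s + k%:R * (ln t - ln s)) t).
  rewrite bernE (_ : 1 - t = s); last by rewrite -st addrK.
  apply: eq_bigr => k _; congr (_ * _).
  have kn : (k <= n)%N by rewrite -ltnS.
  have pw0 (x : R) m : 0 < x -> x ^+ m \is Num.pos by move=> x0; rewrite posrE exprn_gt0.
  rewrite (lnM (pw0 _ _ sp) (pw0 _ _ tp)) (lnXn _ sp) (lnXn _ tp) -(mulr_natl (ln s)) -(mulr_natl (ln t)) (natrB _ kn).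
  by ring.
rewrite bern_affine (_ : s * ln s = (1 - t) * ln s); first by ring.
by rewrite -st addrK.
Qed.

End Bernstein.

(** * The logarithm of a normal matrix *)

Section MatrixLog.
Local Open Scope sesquilinear_scope.
Variable R : realType.
Local Notation C := R[i].

(** In the chosen eigenbasis an entry of M is either 0 or links two equal eigenvalues, so any
    function of the eigenvalues acts the same way. Hence [mxlog] can be read off from arbitrary
    eigenvectors. *)
Lemma mxlog_eigen m p (A : 'M[C]_m) (M : 'M[C]_(m, p)) (d : 'rV[C]_p) :
  A \is normalmx -> A *m M = M *m diag_mx d ->
  mxlog A *m M = M *m diag_mx (map_mx (fun l => (ln (complex.Re l))%:C%C) d).
Proof.
move=> /orthomx_spectralP AE AM; set S := spectralmx A in AE *; set e := spectral_diag A in AE *.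
have uS : S \in unitmx by exact: spectral_unit.
have SX : diag_mx e *m (S *m M) = (S *m M) *m diag_mx d.
  by rewrite -mulmxA -AM {1}AE -!mulmxA (mulKVmx uS).
rewrite /mxlog -/S -/e -!mulmxA; apply: (canLR (mulKmx uS)); rewrite [RHS]mulmxA.
move: (S *m M) SX => X SX.
apply/matrixP => i j; move/matrixP/(_ i j): SX.
rewrite !mul_diag_mx !mul_mx_diag !mxE => /eqP.
rewrite mulrC -subr_eq0 -mulrBr mulf_eq0 => /orP[/eqP ->|]; first by rewrite mulr0 mul0r.
by rewrite subr_eq0 => /eqP ->; rewrite mulrC.
Qed.

(** M maps eigenvectors of A to eigenvectors for the same eigenvalue, so [mxlog_eigen] applies to
    the image under M of the eigenbasis. *)
Lemma mxlog_comm m (A M : 'M[C]_m) : A \is normalmx -> A *m M = M *m A -> mxlog A *m M = M *m mxlog A.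
Proof.
move=> nA AM; have /orthomx_spectralP AE := nA.
have uS : spectralmx A \in unitmx by exact: spectral_unit.
have : A *m (M *m invmx (spectralmx A)) = (M *m invmx (spectralmx A)) *m diag_mx (spectral_diag A).
  by rewrite mulmxA AM -mulmxA {1}AE -!mulmxA mulmxV// mulmx1.
move/(mxlog_eigen nA); rewrite mulmxA => /(congr1 (mulmx^~ (spectralmx A))).
by rewrite (mulmxKV uS) => ->; rewrite /mxlog !mulmxA.
Qed.

Lemma mxlog_scalar m p (A : 'M[C]_m) (M : 'M[C]_(m, p)) (l : C) : A \is normalmx ->
  A *m M = l *: M -> mxlog A *m M = (ln (complex.Re l))%:C%C *: M.
Proof.
move=> nA AM; rewrite (@mxlog_eigen _ _ _ _ (const_mx l)) ?map_const_mx ?diag_const_mx ?mul_mx_scalar//.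
Qed.

Lemma Re_sum (I : Type) (r : seq I) (P : pred I) (F : I -> C) :
  complex.Re (\sum_(i <- r | P i) F i) = \sum_(i <- r | P i) complex.Re (F i).
Proof. by apply: (big_morph (@complex.Re R)) => // -[a b] [c d]. Qed.

Lemma relative_entropy_cast m m' (e : m = m') (A B : 'M[C]_m) :
  relative_entropy (castmx (e, e) A) (castmx (e, e) B) = relative_entropy A B.
Proof. by case: m' / e. Qed.

Lemma pwE n : pw n = (2 ^ n)%N.
Proof. by elim: n => [//|n IHn] /=; rewrite expnS IHn. Qed.

Lemma castmx_tensr m p q (e : p = q) (e' : (m * p = m * q)%N) (A : 'M[C]_m) (B : 'M[C]_p) :
  castmx (e', e') (A *t B) = A *t castmx (e, e) B.
Proof. by case: q / e e' => e'; rewrite !castmx_id. Qed.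

Lemma ntensmx_tpow (A : 'M[C]_2) n : ntensmx A n = castmx (pwE n, pwE n) (tpow A n).
Proof.
case: n => [|n]; first by rewrite castmx_id.
elim: n => [|n IHn].
  apply/matrixP => i j; rewrite castmxE mxE !ord1 mxE eqxx mulr1.
  by congr (A _ _); apply: val_inj; rewrite /= divn1.
by rewrite ntensmxSS IHn -(castmx_tensr (pwE n.+1) (pwE n.+2)).
Qed.

(** Each entry is a polynomial of size at most K that vanishes at the K points 0, ..., K - 1. *)
Lemma poly_matrix_coef m (K : nat) (M : nat -> 'M[C]_m) :
  (forall t : R, \sum_(k < K) (t%:C%C) ^+ k *: M k = 0) -> forall k, (k < K)%N -> M k = 0.
Proof.
move=> M0 k kK; apply/matrixP => i j; rewrite mxE.
pose p := \poly_(l < K) M l i j.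
have -> : M k i j = p`_k by rewrite coef_poly kK.
suff -> : p = 0 by rewrite coef0.
apply/eqP; apply/negPn/negP => p0.
have := @max_poly_roots _ p [seq (l%:R : C) | l <- iota 0 K] p0.
rewrite size_map size_iota ltnNge size_poly /=.
have -> : all (root p) [seq (l%:R : C) | l <- iota 0 K].
  apply/allP => _ /mapP[l _ ->]; rewrite /root horner_poly.
  have /matrixP/(_ i j) := M0 l%:R; rewrite summxE mxE => {2}<-.
  by apply/eqP/eq_bigr => s _; rewrite mxE rmorph_nat mulrC.
have -> : uniq [seq (l%:R : C) | l <- iota 0 K].
  by rewrite map_inj_uniq ?iota_uniq// => x y /eqP; rewrite eqr_nat => /eqP.
by move=> /(_ isT isT).
Qed.

(** [tsum X n] is the coefficient of t, extracted algebraically from an identity between polynomials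
    in t. *)
Lemma comm_tsum n (X : 'M[C]_2) (Z : 'M[C]_(pw n)) :
  (forall t : R, Z *m tpow (1%:M + t%:C%C *: X) n = tpow (1%:M + t%:C%C *: X) n *m Z) ->
  Z *m tsum X n = tsum X n *m Z.
Proof.
move=> ZT; case: n Z ZT => [|n] Z ZT; first by rewrite /= mulmx0 mul0mx.
apply/eqP; rewrite -subr_eq0 -tcoef1; apply/eqP.
apply: (@poly_matrix_coef _ n.+2 (fun k => Z *m tcoef X n.+1 k - tcoef X n.+1 k *m Z) _ 1%N) => // t.
have := ZT t; rewrite tpow_expand mulmx_sumr mulmx_suml => /eqP; rewrite -subr_eq0 -sumrB => /eqP {2}<-.
by apply: eq_bigr => k _; rewrite scalerBr -scalemxAr -scalemxAl.
Qed.


(** * Relative entropy with respect to a rotation invariant matrix *)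

Section EntropyFormula.
Variables (n : nat) (Z : 'M[C]_(pw n)) (lam : nat -> R).
Hypothesis Znormal : Z \is normalmx.
Hypothesis ZVz : forall t : R, Z *m tpow (1%:M + t%:C%C *: ((- 'i%C) *: (e00 C - e11 C))) n =
  tpow (1%:M + t%:C%C *: ((- 'i%C) *: (e00 C - e11 C))) n *m Z.
Hypothesis ZVy : forall t : R, Z *m tpow (1%:M + t%:C%C *: eflip C) n =
  tpow (1%:M + t%:C%C *: eflip C) n *m Z.
Hypothesis Zhw : forall k (X : 'M[C]_(pw n)), (2 * k <= n)%N ->
  wproj C n k *m X = X -> tsum (e01 C) n *m X = 0 -> Z *m X = (lam k)%:C%C *: X.

Definition logtrace k : R := complex.Re (\tr (mxlog Z *m wproj C n k)).

Lemma comm_sigmaz : Z *m tsum (e00 C - e11 C) n = tsum (e00 C - e11 C) n *m Z.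
Proof.
have := comm_tsum ZVz; rewrite tsumZ -scalemxAr -scalemxAl.
by apply: scalerI; rewrite oppr_eq0; exact: neq0Ci.
Qed.

Lemma comm_flip : Z *m tpow (eflip C) n = tpow (eflip C) n *m Z.
Proof.
apply: comm_tpow_flip.
by have := ZVy 1; rewrite (rmorph1 (real_complex R)) scale1r.
Qed.

Lemma logtrace_gt k : (n < k)%N -> logtrace k = 0.
Proof. by move=> nk; rewrite /logtrace wproj_gt// mulmx0 mxtrace0. Qed.

Lemma logtrace_sym k : (k <= n)%N -> logtrace (n - k) = logtrace k.
Proof.
move=> kn; rewrite /logtrace trace_wproj_sym//.
exact: mxlog_comm Znormal comm_flip.
Qed.

Lemma logtrace0 : logtrace 0 = ln (lam 0).
Proof.
have [Zup Zdn] := comm_ladder comm_sigmaz (comm_tsum ZVy).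
rewrite /logtrace (@trace_wproj0 _ _ _ (fun k => (ln (lam k))%:C%C))// => k X kn XP XJ.
by rewrite (mxlog_scalar Znormal (Zhw kn XP XJ)).
Qed.

Lemma logtraceS k : (2 * k.+1 <= n)%N ->
  logtrace k.+1 = logtrace k + ln (lam k.+1) * ('C(n, k.+1)%:R - 'C(n, k)%:R).
Proof.
have [Zup Zdn] := comm_ladder comm_sigmaz (comm_tsum ZVy).
move=> kn; rewrite /logtrace (@trace_wprojS _ _ _ (fun k => (ln (lam k))%:C%C))//; first last.
- by move=> j X jn XP XJ; rewrite (mxlog_scalar Znormal (Zhw jn XP XJ)).
- exact: mxlog_comm.
rewrite raddfD/=; congr (_ + _).
by rewrite -!(rmorph_nat (real_complex R)) -rmorphB -rmorphM.
Qed.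

(** Highest weights give the increments only for 2 (k + 1) <= n. Beyond the middle they follow from
    the flip symmetry k -> n - k of [logtrace] and of the binomials, which is why g must be
    symmetric under j -> n + 1 - j. *)
Lemma logtrace_step (g : nat -> R) k : (k <= n)%N ->
  (forall j, (2 * j <= n)%N -> g j = ln (lam j)) -> (forall j, (j <= n.+1)%N -> g (n.+1 - j)%N = g j) ->
  logtrace k.+1 - logtrace k = ('C(n, k.+1)%:R - 'C(n, k)%:R) * g k.+1.
Proof.
move=> kn gl gs; have [kn1|kn1] := leqP (2 * k.+1) n.
  by rewrite logtraceS// gl// addrAC subrr add0r mulrC.
have sC j : (j <= n)%N -> 'C(n, n - j) = 'C(n, j) by move=> jn; rewrite bin_sub.
have skn : (n - k <= n)%N by rewrite leq_subr.
(* The middle step n = 2 k + 1, where k and k + 1 are exchanged by the symmetry, so both sides are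
   0. *)
have [kn2|kn2] := ltnP n (2 * k.+1).-1; last first.
  have kE : (n - k)%N = k.+1 by lia.
  rewrite -kE -logtrace_sym// subKn// subrr kE -{2}(subKn kn) kE sC ?subrr ?mul0r//; lia.
have kE : (n - k)%N = (n - k.+1).+1 \/ (k = n) by lia.
case: kE => [kE|->]; last first.
  rewrite logtrace_gt// -(logtrace_sym (leqnn n)) subnn logtrace0 bin_small// binn sub0r.
  by rewrite -(gs n.+1)// subnn gl// sub0r mulN1r.
have k1n : (k.+1 <= n)%N by lia.
rewrite -(logtrace_sym kn) -(logtrace_sym k1n) -(sC k kn) -(sC k.+1 k1n) kE logtraceS; last by lia.
rewrite -(gs k.+1); last by lia.
rewrite (_ : n.+1 - k.+1 = (n - k.+1).+1)%N; last by lia.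
rewrite gl; last by lia.
by rewrite opprD addNKr -mulrN opprB mulrC.
Qed.

(** The matrices [tpow V n *m wproj C n k] consist of eigenvectors of [tpow rho n], which gives the
    entropy term with multiplicity C(n, k). Since Z, hence its logarithm, commutes with [tpow V n],
    the conjugation drops out of the trace in the cross term. *)
Lemma relative_entropy_tpow (rho V : 'M[C]_2) (s t : R) :
  V \in unitmx -> rho *m V = V *m (s%:C%C *: e00 C + t%:C%C *: e11 C) ->
  tpow rho n \is normalmx -> Z *m tpow V n = tpow V n *m Z ->
  relative_entropy (tpow rho n) Z =
  \sum_(k < n.+1) 'C(n, k)%:R * (s ^+ (n - k) * t ^+ k) * ln (s ^+ (n - k) * t ^+ k)
  - \sum_(k < n.+1) s ^+ (n - k) * t ^+ k * logtrace k.
Proof.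
move=> uV rV nrho ZV.
have uW : tpow V n \in unitmx by exact: tpow_unit.
pose m k := s ^+ (n - k) * t ^+ k.
have mE k : s%:C%C ^+ (n - k) * t%:C%C ^+ k = (m k)%:C%C :> C by rewrite /m rmorphM !rmorphXn.
have eigen (k : 'I_n.+1) : tpow rho n *m (tpow V n *m wproj C n k) = (m k)%:C%C *: (tpow V n *m wproj C n k).
  have kn : (k <= n)%N by rewrite -ltnS.
  by rewrite (tpow_spectral_eigen kn rV) mE.
rewrite /relative_entropy mulmxBr linearB/= raddfB/=; congr (_ - _).
  have logE : mxlog (tpow rho n) =
      \sum_(k < n.+1) (ln (m k))%:C%C *: (tpow V n *m wproj C n k *m invmx (tpow V n)).
    rewrite (sum_conj_wproj (mxlog _) uW).
    by apply: eq_bigr => k _; rewrite (mxlog_scalar nrho (eigen k)) -scalemxAl.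
  rewrite logE mulmx_sumr (raddf_sum (@mxtrace _ _)) Re_sum; apply: eq_bigr => k _.
  transitivity (complex.Re ((ln (m k))%:C%C * (m k)%:C%C * 'C(n, k)%:R)).
    congr complex.Re; exact: trace_scaled_eigen.
  rewrite -(rmorph_nat (real_complex R)) -!rmorphM/=.
  by rewrite /m; ring.
rewrite (tpow_spectral n uV rV) mulmx_suml (raddf_sum (@mxtrace _ _)) Re_sum; apply: eq_bigr => k _.
rewrite mE; transitivity (complex.Re ((m k)%:C%C * \tr (mxlog Z *m wproj C n k))).
  by congr complex.Re; apply: trace_scaled_conj => //; exact: mxlog_comm.
by rewrite /logtrace; case: (\tr _) => a b /=; rewrite mul0r subr0.
Qed.

End EntropyFormula.
End MatrixLog.

(** * The averaged density matrix *)

Ltac complex_eq := apply/eqP; rewrite eq_complex /=; apply/andP; split; apply/eqP.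

Section ZetaMatrix.
Variable R : realType.
Local Notation C := R[i].
Notation mu := (@lebesgue_measure R).
Notation mu3 := (@lebesgue_measure2 R \x @lebesgue_measure R)%E.
Local Notation T3 := (measurableTypeR R * measurableTypeR R * measurableTypeR R)%type.
Variable u : R.
Hypothesis u1 : u < 1.

Definition prior_const : R := Gamma (5 / 2 - u) / (pi `^ (3 / 2) * Gamma (1 - u)).
(** The prior on the open ball, extended by zero to the whole space, so that rotations and Tonelli
    apply without a domain. *)
Definition weight (p : T3) : R := prior_const * ppow (1 - normsq3 p) (- u).

Lemma prior_const_gt0 : 0 < prior_const.
Proof.
have G1 : 0 < Gamma (1 - u) by apply: Gamma_gt0; rewrite subr_gt0.
have G2 : 0 < Gamma (5 / 2 - u) by apply: Gamma_gt0; move: u1; clear; lra.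
apply: (divr_gt0 G2); apply: mulr_gt0 G1; apply: powR_gt0; exact: pi_gt0.
Qed.

Lemma weight_ge0 p : 0 <= weight p.
Proof. by rewrite mulr_ge0 ?ppow_ge0// ltW// prior_const_gt0. Qed.

Lemma measurable_weight : measurable_fun setT weight.
Proof.
apply: measurable_funM => //; apply: measurable_ppow; apply: measurable_funB => //.
exact: measurable_normsq3.
Qed.

Lemma prior_weight p : normsq3 p < 1 -> prior u p = weight p.
Proof.
move=> p1; rewrite /prior /weight ppow_gt0 ?subr_gt0// powRN /prior_const.
by rewrite [in LHS]invfM mulrA.
Qed.

Lemma integral_weight_lty : (\int[mu3]_p (weight p)%:E < +oo)%E.
Proof.
have u0 : 0 < 1 - u by rewrite subr_gt0.
have := ball_beta_integral 0 u0.
rewrite (_ : 1 - u - 1 = - u); last by ring.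
under eq_integral do rewrite expr0 mul1r.
move=> E.
have mw : measurable_fun setT (fun p : T3 =>
    ppow (1 - normsq3 p) (- u)).
  apply: measurable_ppow; apply: measurable_funB => //; exact: measurable_normsq3.
have := @ge0_EFin_integralZl _ _ _ mu3 prior_const _ (ltW prior_const_gt0) mw (fun p => ppow_ge0 _ _).
by move=> <-; rewrite E -EFinM ltry.
Qed.

(** Boundedness is asked on the open ball only, as [weight] vanishes elsewhere; this admits the
    coordinate functions. *)
Definition good (f : T3 -> R) := measurable_fun setT f /\
  exists M : R, forall p, normsq3 p < 1 -> `|f p| <= M.

Lemma good_cst c : good (fun=> c).
Proof. by split => //; exists `|c|. Qed.

Lemma goodD f g : good f -> good g -> good (fun p => f p + g p).
Proof.
move=> [mf [M fM]] [mg [N gN]]; split; first exact: measurable_funD.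
by exists (M + N) => p p1; rewrite (le_trans (ler_normD _ _))// lerD ?fM ?gN.
Qed.

Lemma goodM f g : good f -> good g -> good (fun p => f p * g p).
Proof.
move=> [mf [M fM]] [mg [N gN]]; split; first exact: measurable_funM.
by exists (M * N) => p p1; rewrite normrM ler_pM ?fM ?gN.
Qed.

Lemma goodN f : good f -> good (fun p => - f p).
Proof.
move=> gf; have := goodM (good_cst (-1)) gf.
by congr good; apply/funext => p; rewrite mulN1r.
Qed.

Lemma good_integrable f : good f -> mu3.-integrable setT (fun p => (f p * weight p)%:E).
Proof.
move=> [mf [M fM]].
have M0 : 0 <= `|M| by [].
apply: (@le_integrable _ T3 R mu3 setT measurableT _ (fun p => (`|M| * weight p)%:E)).
- apply/measurable_EFinP; apply: measurable_funM => //; exact: measurable_weight.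
- move=> p _; suff H : `|f p * weight p| <= `|M| * weight p.
    by rewrite /= lee_fin (le_trans H)// ler_norm.
  have W := weight_ge0 p; rewrite normrM (ger0_norm W).
  have [p1|p1] := ltP (normsq3 p) 1.
    by rewrite ler_wpM2r// (le_trans (fM _ p1))// ler_norm.
  by rewrite /weight ppow_le0 ?subr_le0// !mulr0.
apply/integrableP; split.
  apply/measurable_EFinP; apply: measurable_funM => //; exact: measurable_weight.
rewrite (eq_integral (fun p => (`|M| * weight p)%:E)); last first.
  by move=> p _; rewrite abse_EFin ger0_norm// mulr_ge0 ?weight_ge0.
rewrite -(ge0_EFin_integralZl _ M0 measurable_weight weight_ge0).
exact: (lte_mul_pinfty _ _ integral_weight_lty).
Qed.

Definition wint (f : T3 -> R) : R := (\int[mu3]_p (f p * weight p))%R.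

Lemma wintD f g : good f -> good g -> wint (fun p => f p + g p) = wint f + wint g.
Proof.
move=> gf gg; rewrite /wint -RintegralD//; [|exact: good_integrable|exact: good_integrable].
by apply: eq_Rintegral => p _; rewrite mulrDl.
Qed.

Lemma wintZ c f : good f -> wint (fun p => c * f p) = c * wint f.
Proof.
move=> gf; rewrite /wint -RintegralZl//; last exact: good_integrable.
by apply: eq_Rintegral => p _; rewrite mulrA.
Qed.

Lemma wintN f : good f -> wint (fun p => - f p) = - wint f.
Proof.
move=> gf; rewrite -mulN1r -wintZ//; congr wint.
by apply/funext => p; rewrite mulN1r.
Qed.

Lemma eq_wint f g : (forall p, normsq3 p < 1 -> f p = g p) -> wint f = wint g.
Proof.
move=> fg; apply: eq_Rintegral => p _; have [p1|p1] := ltP (normsq3 p) 1; first by rewrite fg.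
by rewrite /weight ppow_le0 ?subr_le0// !mulr0.
Qed.

Lemma wint_preserves f phi : preserves mu3 phi -> (forall p, normsq3 (phi p) = normsq3 p) ->
  good f -> wint (fun p => f (phi p)) = wint f.
Proof.
move=> phi_ nphi [mf _]; rewrite /wint /Rintegral; congr fine.
transitivity (\int[mu3]_p ((fun p => (f p * weight p)%:E) (phi p)))%E.
  by apply: eq_integral => p _; rewrite /weight nphi.
apply: preserves_integral => //; apply/measurable_EFinP; apply: measurable_funM => //.
exact: measurable_weight.
Qed.

(* The prior and the weight differ only on the unit sphere, a null set. *)
Lemma wint_ball f : good f ->
  (\int[@lebesgue_measure3 R]_(p in @unit_ball3 R) (f p * prior u p))%R = wint f.
Proof.
move=> [mf _].
change ((\int[mu3]_(p in @unit_ball3 R) (f p * prior u p))%R = wint f).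
have mball : measurable (@unit_ball3 R).
  rewrite (_ : @unit_ball3 R = setT `&` (@normsq3 R) @^-1` `]-oo, 1]%classic).
    exact: measurable_normsq3.
  by rewrite setTI; apply/seteqP; split => p; rewrite /unit_ball3/= in_itv.
have mprior : measurable_fun [set: T3] (@prior R u).
  rewrite (_ : @prior R u = fun p : T3 => prior_const * (1 - normsq3 p) `^ (- u)).
    apply: measurable_funM => //; apply: (measurableT_comp (measurable_powR _)) => //.
    by apply: measurable_funB => //; exact: measurable_normsq3.
  by apply/funext => p; rewrite /prior powRN /prior_const [in LHS]invfM mulrA.
rewrite Rintegral_mkcond /wint /Rintegral; congr fine.
apply: ae_eq_integral => //.
- apply/measurable_EFinP; apply/(measurable_restrictT _ mball).
  by apply: measurable_funTS; apply: measurable_funM.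
- by apply/measurable_EFinP; apply: measurable_funM => //; exact: measurable_weight.
exists [set p | normsq3 p = 1]; split; [exact: measurable_sphere|exact: lebesgue_measure_sphere|].
move=> p /= /not_implyP[_ np]; apply: contrapT => /eqP p1; apply: np.
rewrite patchE; have [p1'|p1'] := ltP (normsq3 p) 1.
  by rewrite mem_set ?prior_weight//=; exact: ltW.
rewrite memNset/= ?/weight ?ppow_le0 ?subr_le0 ?mulr0// => p2.
by move: p1; rewrite (@le_anti _ _ (normsq3 p) 1) ?eqxx// p1' andbT.
Qed.

Definition cgood (F : T3 -> C) := good (fun p => complex.Re (F p)) /\ good (fun p => complex.Im (F p)).
Definition cint (F : T3 -> C) : C :=
  (wint (fun p => complex.Re (F p)) +i* wint (fun p => complex.Im (F p)))%C.

Lemma cgood_cst c : cgood (fun=> c).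
Proof. by split; exact: good_cst. Qed.

Lemma cgoodD F G : cgood F -> cgood G -> cgood (fun p => F p + G p).
Proof.
move=> [F1 F2] [G1 G2]; split.
  by have := goodD F1 G1; congr good; apply/funext => p; case: (F p) (G p) => [? ?] [].
by have := goodD F2 G2; congr good; apply/funext => p; case: (F p) (G p) => [? ?] [].
Qed.

Lemma cgoodM F G : cgood F -> cgood G -> cgood (fun p => F p * G p).
Proof.
move=> [F1 F2] [G1 G2]; split.
  have := goodD (goodM F1 G1) (goodN (goodM F2 G2)); congr good; apply/funext => p.
  by case: (F p) (G p) => [? ?] [].
have := goodD (goodM F1 G2) (goodM F2 G1); congr good; apply/funext => p.
by case: (F p) (G p) => [? ?] [].
Qed.

Lemma cgood_sum (I : Type) (r : seq I) (F : I -> T3 -> C) : (forall i, cgood (F i)) ->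
  cgood (fun p => \sum_(i <- r) F i p).
Proof.
move=> gF; elim: r => [|i r IHr].
  by under eq_fun do rewrite big_nil; exact: cgood_cst.
under eq_fun do rewrite big_cons; exact: cgoodD.
Qed.

Lemma cintD F G : cgood F -> cgood G -> cint (fun p => F p + G p) = cint F + cint G.
Proof.
move=> [F1 F2] [G1 G2]; complex_eq.
  by rewrite -wintD//; congr wint; apply/funext => p; case: (F p) (G p) => [? ?] [].
by rewrite -wintD//; congr wint; apply/funext => p; case: (F p) (G p) => [? ?] [].
Qed.

Lemma cintZ c F : cgood F -> cint (fun p => c * F p) = c * cint F.
Proof.
case: c => a b [F1 F2].
have gZ d f : good f -> good (fun p => d * f p) by move=> gf; apply: goodM => //; exact: good_cst.
complex_eq.
  rewrite -(wintZ a F1) -(wintZ b F2) -(wintN (gZ b _ F2)) -(wintD (gZ a _ F1) (goodN (gZ b _ F2))).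
  by congr wint; apply/funext => p; case: (F p).
rewrite -(wintZ a F2) -(wintZ b F1) -(wintD (gZ a _ F2) (gZ b _ F1)).
by congr wint; apply/funext => p; case: (F p).
Qed.

Lemma cint_sum (I : Type) (r : seq I) (F : I -> T3 -> C) : (forall i, cgood (F i)) ->
  cint (fun p => \sum_(i <- r) F i p) = \sum_(i <- r) cint (F i).
Proof.
move=> gF; elim: r => [|i r IHr].
  rewrite big_nil; under [X in cint X]eq_fun do rewrite big_nil.
  have := @cintZ 0 (fun=> 0) (cgood_cst 0); rewrite !mul0r.
  exact.
rewrite big_cons -IHr -cintD//; last exact: cgood_sum.
by congr cint; apply/funext => p; rewrite big_cons.
Qed.

Lemma eq_cint F G : (forall p, normsq3 p < 1 -> F p = G p) -> cint F = cint G.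
Proof. by move=> FG; congr (_ +i* _)%C; apply: eq_wint => p p1; rewrite FG. Qed.

Lemma cint_preserves F phi : preserves mu3 phi -> (forall p, normsq3 (phi p) = normsq3 p) ->
  cgood F -> cint (fun p => F (phi p)) = cint F.
Proof.
move=> phi_ nphi [F1 F2].
by rewrite /cint (wint_preserves phi_ nphi F1) (wint_preserves phi_ nphi F2).
Qed.

Definition mgood m1 m2 (M : T3 -> 'M[C]_(m1, m2)) := forall i j, cgood (fun p => M p i j).
Definition mint m1 m2 (M : T3 -> 'M[C]_(m1, m2)) := \matrix_(i, j) cint (fun p => M p i j).

Lemma mgood_tens m1 m2 m3 m4 (M : T3 -> 'M[C]_(m1, m2)) (N : T3 -> 'M[C]_(m3, m4)) :
  mgood M -> mgood N -> mgood (fun p => M p *t N p).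
Proof.
move=> gM gN i j; have := cgoodM (gM (mxtens_unindex i).1 (mxtens_unindex j).1)
  (gN (mxtens_unindex i).2 (mxtens_unindex j).2).
by congr cgood; apply/funext => p; rewrite [in RHS]mxE.
Qed.

Lemma mgood_tpow n (M : T3 -> 'M[C]_2) : mgood M -> mgood (fun p => tpow (M p) n).
Proof.
move=> gM; elim: n => [|n IHn] /=; first by move=> i j; exact: cgood_cst.
exact: mgood_tens.
Qed.

Lemma mint_mull m1 m2 m3 (A : 'M[C]_(m1, m2)) (M : T3 -> 'M[C]_(m2, m3)) : mgood M ->
  mint (fun p => A *m M p) = A *m mint M.
Proof.
move=> gM; apply/matrixP => i j; rewrite !mxE.
rewrite (_ : (fun p => (A *m M p) i j) = (fun p => \sum_k A i k * M p k j)); last first.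
  by apply/funext => p; rewrite mxE.
rewrite cint_sum => [|k]; last by apply: cgoodM; [exact: cgood_cst|exact: gM].
by apply: eq_bigr => k _; rewrite cintZ ?mxE.
Qed.

Lemma mgood_mull m1 m2 m3 (A : 'M[C]_(m1, m2)) (M : T3 -> 'M[C]_(m2, m3)) : mgood M ->
  mgood (fun p => A *m M p).
Proof.
move=> gM i j; under eq_fun do rewrite mxE.
by apply: cgood_sum => k; apply: cgoodM; [exact: cgood_cst|exact: gM].
Qed.

Lemma mint_mulr m1 m2 m3 (A : 'M[C]_(m2, m3)) (M : T3 -> 'M[C]_(m1, m2)) : mgood M ->
  mint (fun p => M p *m A) = mint M *m A.
Proof.
move=> gM; apply/matrixP => i j; rewrite !mxE.
rewrite (_ : (fun p => (M p *m A) i j) = (fun p => \sum_k A k j * M p i k)); last first.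
  by apply/funext => p; rewrite mxE; apply: eq_bigr => k _; rewrite mulrC.
rewrite cint_sum => [|k]; last by apply: cgoodM; [exact: cgood_cst|exact: gM].
by apply: eq_bigr => k _; rewrite cintZ ?mxE// mulrC.
Qed.

Lemma eq_mint m1 m2 (M N : T3 -> 'M[C]_(m1, m2)) : (forall p, normsq3 p < 1 -> M p = N p) ->
  mint M = mint N.
Proof. by move=> MN; apply/matrixP => i j; rewrite !mxE; apply: eq_cint => p p1; rewrite MN. Qed.

Lemma mint_preserves m1 m2 (M : T3 -> 'M[C]_(m1, m2)) phi : preserves mu3 phi ->
  (forall p, normsq3 (phi p) = normsq3 p) -> mgood M -> mint (fun p => M (phi p)) = mint M.
Proof.
by move=> phi_ nphi gM; apply/matrixP => i j; rewrite !mxE (cint_preserves phi_ nphi (gM i j)).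
Qed.

Lemma mint_scalar m1 m2 (f : T3 -> R) (X : 'M[C]_(m1, m2)) : good f ->
  mint (fun p => (f p)%:C%C *: X) = (wint f)%:C%C *: X.
Proof.
move=> gf; apply/matrixP => i j; rewrite !mxE.
have gF : cgood (fun p => (f p)%:C%C) by split => //=; exact: good_cst.
transitivity (cint (fun p => X i j * (f p)%:C%C)).
  by congr cint; apply/funext => p; rewrite mxE mulrC.
rewrite cintZ// mulrC; congr (_ * _); rewrite /cint /=; congr (_ +i* _)%C.
have := @wintZ 0 (fun=> 0) (good_cst 0); rewrite !mul0r.
exact.
Qed.

Lemma qubit00 (p : R * R * R) : qubit p 0 0 = ((1 + p.2) / 2)%:C%C.
Proof. by case: p => [[x y] z]; rewrite !mxE/= mulrC; complex_eq; ring. Qed.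

Lemma qubit01 (p : R * R * R) : qubit p 0 1 = (p.1.1 / 2 -i* (p.1.2 / 2))%C.
Proof. by case: p => [[x y] z]; rewrite !mxE/=; complex_eq; ring. Qed.

Lemma qubit10 (p : R * R * R) : qubit p 1 0 = (p.1.1 / 2 +i* (p.1.2 / 2))%C.
Proof. by case: p => [[x y] z]; rewrite !mxE/=; complex_eq; ring. Qed.

Lemma qubit11 (p : R * R * R) : qubit p 1 1 = ((1 - p.2) / 2)%:C%C.
Proof. by case: p => [[x y] z]; rewrite !mxE/= mulrC; complex_eq; ring. Qed.

Definition qubitE := (qubit00, qubit01, qubit10, qubit11).

Lemma good_x : good (fun p => p.1.1).
Proof.
split; first exact: measurable_fun_fst2.
by exists 1 => -[[x y] z]; rewrite /normsq3/= => n1; rewrite ler_norml; apply/andP; split; nra.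
Qed.

Lemma good_y : good (fun p => p.1.2).
Proof.
split; first exact: measurable_fun_snd2.
by exists 1 => -[[x y] z]; rewrite /normsq3/= => n1; rewrite ler_norml; apply/andP; split; nra.
Qed.

Lemma good_z : good (fun p => p.2).
Proof.
split; first exact: measurable_snd.
by exists 1 => -[[x y] z]; rewrite /normsq3/= => n1; rewrite ler_norml; apply/andP; split; nra.
Qed.

Lemma good_half f : good f -> good (fun p => f p / 2).
Proof. by move=> gf; apply: goodM => //; exact: good_cst. Qed.

Lemma mgood_qubit : mgood (fun p => qubit p).
Proof.
have gx := good_half good_x; have gy := good_half good_y.
have gz1 := good_half (goodD (good_cst 1) good_z).
have gz2 := good_half (goodD (good_cst 1) (goodN good_z)).
have g0 := good_cst 0.
move=> i j; suff: cgood (fun p => qubit p 0 0) /\ cgood (fun p => qubit p 0 1) /\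
    cgood (fun p => qubit p 1 0) /\ cgood (fun p => qubit p 1 1).
  move=> [h0 [h1 [h2 h3]]].
  case: i => [[|[|//]] ?]; case: j => [[|[|//]] ?].
  - by move: h0; congr cgood; apply/funext => p; congr (qubit p _ _); exact/val_inj.
  - by move: h1; congr cgood; apply/funext => p; congr (qubit p _ _); exact/val_inj.
  - by move: h2; congr cgood; apply/funext => p; congr (qubit p _ _); exact/val_inj.
  - by move: h3; congr cgood; apply/funext => p; congr (qubit p _ _); exact/val_inj.
under eq_fun do rewrite qubit00; under [X in _ /\ (cgood X /\ _)]eq_fun do rewrite qubit01.
under [X in _ /\ (_ /\ (cgood X /\ _))]eq_fun do rewrite qubit10.
under [X in _ /\ (_ /\ (_ /\ cgood X))]eq_fun do rewrite qubit11.
have gy' := goodN gy.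
by split; [split|split; [split|split; split]].
Qed.

(** V is sqrt (1 + t^2) times the unitary matrix covering [rotz t]. The intertwining form needs
    neither its inverse nor its normalization. *)
Lemma rotz_qubit (t : R) (p : R * R * R) :
  let V := 1%:M + t%:C%C *: ((- 'i%C) *: (e00 C - e11 C)) in
  qubit (rotz t p) *m V = V *m qubit p.
Proof.
move=> V; have V00 : V 0 0 = (1 -i* t)%C.
  by rewrite !mxE /=; complex_eq; ring.
have V01 : V 0 1 = 0.
  by rewrite !mxE /=; complex_eq; ring.
have V10 : V 1 0 = 0.
  by rewrite !mxE /=; complex_eq; ring.
have V11 : V 1 1 = (1 +i* t)%C.
  by rewrite !mxE /=; complex_eq; ring.
have t2 := one_add_sqr_neq0 t.
apply: (@mxE2 C); rewrite !(@mulmxE2 C) !(V00, V01, V10, V11, qubitE) /rotz/= /rot_cos /rot_sin;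
  by complex_eq; field.
Qed.

Lemma roty_qubit (t : R) (p : R * R * R) :
  let V := 1%:M + t%:C%C *: eflip C in
  qubit (roty t p) *m V = V *m qubit p.
Proof.
move=> V; have V00 : V 0 0 = 1.
  by rewrite !mxE /=; complex_eq; ring.
have V01 : V 0 1 = (- t)%:C%C.
  by rewrite !mxE /=; complex_eq; ring.
have V10 : V 1 0 = t%:C%C.
  by rewrite !mxE /=; complex_eq; ring.
have V11 : V 1 1 = 1.
  by rewrite !mxE /=; complex_eq; ring.
have t2 := one_add_sqr_neq0 t.
apply: (@mxE2 C); rewrite !(@mulmxE2 C) !(V00, V01, V10, V11, qubitE) /roty/= /rot_cos /rot_sin;
  by complex_eq; field.
Qed.

Definition Zm n := mint (fun p => tpow (qubit p) n).

Lemma mgood_tpow_qubit n : mgood (fun p => tpow (qubit p) n).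
Proof. exact: mgood_tpow mgood_qubit. Qed.

Lemma zeta_Zm n : zeta n u = castmx (pwE n, pwE n) (Zm n).
Proof.
apply/matrixP => i j; rewrite castmxE !mxE /cint.
have gT := @mgood_tpow_qubit n (cast_ord (esym (pwE n)) i) (cast_ord (esym (pwE n)) j).
case: gT => g1 g2; rewrite -(wint_ball g1) -(wint_ball g2).
by congr (_ +i* _)%C; apply: eq_Rintegral => p _; rewrite ntensmx_tpow castmxE.
Qed.

Lemma good_comp f phi : preserves mu3 phi -> (forall p, normsq3 (phi p) = normsq3 p) ->
  good f -> good (fun p => f (phi p)).
Proof.
move=> [mphi _] nphi [mf [M fM]]; split; first exact: (measurableT_comp mf mphi).
by exists M => p p1; apply: fM; rewrite nphi.
Qed.

Lemma Zm_comm n (V : 'M[C]_2) phi : preserves mu3 phi -> (forall p, normsq3 (phi p) = normsq3 p) ->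
  (forall p, qubit (phi p) *m V = V *m qubit p) -> Zm n *m tpow V n = tpow V n *m Zm n.
Proof.
move=> phi_ nphi phiV; have gT := @mgood_tpow_qubit n.
rewrite -(mint_mull _ gT) /Zm -[in LHS](mint_preserves phi_ nphi gT) -mint_mulr.
  by apply: eq_mint => p _; rewrite -!tpowM phiV.
move=> i j; have [g1 g2] := gT i j.
by split; [exact: (good_comp phi_ nphi g1)|exact: (good_comp phi_ nphi g2)].
Qed.

Lemma Zm_rotz n t :
  let V := tpow (1%:M + t%:C%C *: ((- 'i%C) *: (e00 C - e11 C))) n in Zm n *m V = V *m Zm n.
Proof.
apply: (Zm_comm n (preserves_rotz t)); first exact: normsq3_rotz.
exact: rotz_qubit.
Qed.

Lemma Zm_roty n t : let V := tpow (1%:M + t%:C%C *: eflip C) n in Zm n *m V = V *m Zm n.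
Proof.
apply: (Zm_comm n (preserves_roty t)); first exact: normsq3_roty.
exact: roty_qubit.
Qed.

Lemma qubit_adjoint p : (map_mx Num.conj (qubit p)^T : 'M[C]_2) = qubit p.
Proof.
by apply: (@mxE2 C); rewrite mxE mxE !qubitE; apply/eqP; rewrite eq_complex/= ?oppr0 ?opprK !eqxx.
Qed.

Lemma Zm_adjoint n : (map_mx Num.conj (Zm n)^T : 'M[C]__) = Zm n.
Proof.
apply/matrixP => i j; rewrite !mxE /cint.
have T (p : R * R * R) : tpow (qubit p) n i j = Num.conj (tpow (qubit p) n j i).
  have /matrixP/(_ i j) := tpow_adjoint (qubit p) n; rewrite (qubit_adjoint p) => <-.
  by rewrite !mxE.
have [g1 g2] := @mgood_tpow_qubit n j i.
complex_eq.
  by congr wint; apply/funext => p; rewrite T; case: (tpow _ _ _ _).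
by rewrite -wintN//; congr wint; apply/funext => p; rewrite T; case: (tpow _ _ _ _).
Qed.

Lemma Zm_normal n : Zm n \is normalmx.
Proof. by apply/normalmxP; rewrite Zm_adjoint. Qed.

Lemma tpow_qubit_normal (p : R * R * R) n : tpow (qubit p) n \is normalmx.
Proof.
apply/normalmxP; rewrite (tpow_adjoint (qubit p) n).
by rewrite (qubit_adjoint p).
Qed.

(** [ball_beta_integral] at m = n - 2 k and c = k + 1 - u: Gamma (c + 1) / c becomes Gamma c, and
    4^k cancels against the denominators of the determinants, so k survives in two Gamma factors
    only. *)
Definition zeta_eigen n k : R := prior_const * (pi * (2 * 4 `^ (1 - u))) *
  (Gamma ((n - k)%:R + 2 - u) * Gamma (k%:R + 1 - u) / Gamma (n%:R + 4 - 2 * u)).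

Lemma wint_highest n k : (2 * k <= n)%N ->
  wint (fun p => ((1 + p.2) / 2) ^+ (n - 2 * k) * ((1 - normsq3 p) / 4) ^+ k) = zeta_eigen n k.
Proof.
move=> kn; have c0 : 0 < k%:R + 1 - u by move: (ler0n R k) u1; lra.
(* The absolute value makes the integrand nonnegative on the whole space; on the ball 1 + z is
   nonnegative already. *)
pose f (p : T3) := `|(1 + p.2) / 2| ^+ (n - 2 * k) * ppow (1 - normsq3 p) (k%:R + 1 - u - 1).
have mf : measurable_fun setT f.
  apply: measurable_funM.
    apply: measurable_funX; apply: measurableT_comp => //; apply: measurable_funM => //.
    by apply: measurable_funD => //; exact: measurable_snd.
  by apply: measurable_ppow; apply: measurable_funB => //; exact: measurable_normsq3.
have f0 p : 0 <= f p by rewrite mulr_ge0 ?ppow_ge0// exprn_ge0.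
have pc0 : 0 <= prior_const / 4 ^+ k by rewrite divr_ge0 ?exprn_ge0// ltW// prior_const_gt0.
have := @ge0_EFin_integralZl R _ T3 mu3 _ f pc0 mf f0; rewrite /f ball_beta_integral// => E.
transitivity (fine (\int[mu3]_p (prior_const / 4 ^+ k * f p)%:E)).
  congr fine; apply: eq_integral => p _; congr (_%:E).
  have [p1|p1] := ltP (normsq3 p) 1; last first.
    by rewrite /f /weight !ppow_le0 ?subr_le0// !mulr0.
  have z1 : 0 <= 1 + p.2.
    by move: p1; case: (p) => [[x y] z]; rewrite /normsq3/=; move: (sqr_ge0 x) (sqr_ge0 y); nra.
  rewrite /f /weight !ppow_gt0 ?subr_gt0// ger0_norm ?divr_ge0//.
  rewrite (_ : k%:R + 1 - u - 1 = k%:R + - u); last by ring.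
  rewrite powRD; last by apply/implyP => _; rewrite gt_eqF// subr_gt0.
  rewrite powR_mulrn ?subr_ge0 1?ltW// [X in _ * X * _ = _]expr_div_n; ring.
rewrite -E -EFinM /=.
have -> : k%:R + 1 - u + 1 = (k%:R + 1 - u) + 1 by ring.
have e1 : (n - 2 * k)%:R + (k%:R + 1 - u) + 1 = (n - k)%:R + 2 - u :> R.
  by rewrite !natrB ?natrM//; [ring|lia].
have e2 : (n - 2 * k)%:R + 2 * (k%:R + 1 - u) + 2 = n%:R + 4 - 2 * u :> R.
  by rewrite natrB// natrM; ring.
rewrite e1 e2 GammaS// /zeta_eigen.
have -> : (4 : R) `^ (k%:R + 1 - u) = 4 ^+ k * 4 `^ (1 - u).
  by rewrite -powR_mulrn// -powRD ?addrA//; apply/implyP => _; rewrite gt_eqF.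
have k4 : (4 : R) ^+ k != 0 by rewrite expf_neq0.
have c1 := lt0r_neq0 c0.
have G1 : Gamma (n%:R + 4 - 2 * u) != 0.
  by rewrite gt_eqF// Gamma_gt0//; move: (ler0n R n) u1; lra.
move: (Gamma (n%:R + 4 - 2 * u)) (Gamma (_ + 2 - u)) (Gamma (_ + 1 - u)) G1 => g3 g1 g2 G1.
by field; rewrite k4 c1 G1.
Qed.

(** A single [tpow (qubit p) n] does not preserve weight spaces, but the average commutes with
    [wproj]. The projection can therefore be inserted under the integral, where [wproj_tpow_highest]
    gives a scalar for each p; it applies since 1 + z > 0 in the open ball. *)
Lemma Zm_highest n k (X : 'M[C]_(pw n)) : (2 * k <= n)%N ->
  wproj C n k *m X = X -> tsum (e01 C) n *m X = 0 -> Zm n *m X = (zeta_eigen n k)%:C%C *: X.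
Proof.
move=> kn PX JX.
have ZP : Zm n *m wproj C n k = wproj C n k *m Zm n.
  apply: comm_wproj; have := comm_tsum (@Zm_rotz n); rewrite tsumZ -scalemxAr -scalemxAl.
  by apply: scalerI; rewrite oppr_eq0; exact: neq0Ci.
rewrite -PX mulmxA ZP -(mint_mull _ (@mgood_tpow_qubit n)) -mint_mulr; last first.
  exact: mgood_mull (@mgood_tpow_qubit n).
rewrite -(wint_highest kn) PX -mint_scalar.
  apply: eq_mint => p p1.
  have z1 : 0 < 1 + p.2.
    by move: p1; case: (p) => [[x y] z]; rewrite /normsq3/=; move: (sqr_ge0 x) (sqr_ge0 y); nra.
  have A0 : qubit p 0 0 != 0.
    by rewrite qubit00; apply/eqP => -[] /eqP; rewrite gt_eqF// divr_gt0.
  rewrite (wproj_tpow_highest A0 kn PX JX); congr (_ *: X).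
  have -> : \det (qubit p) = ((1 - normsq3 p) / 4)%:C%C.
    rewrite (@det2 C) !qubitE /normsq3.
    by complex_eq; field.
  by rewrite qubit00 !(rmorphM, rmorphXn).
have goodX f m : good f -> good (fun p => f p ^+ m).
  move=> gf; elim: m => [|m IHm]; first by under eq_fun do rewrite expr0; exact: good_cst.
  by under eq_fun do rewrite exprS; exact: goodM.
apply: goodM; apply: goodX.
  apply: good_half; apply: goodD; [exact: good_cst|exact: good_z].
apply: goodM; last exact: good_cst.
apply: goodD; first exact: good_cst.
apply: goodN; split; first exact: measurable_normsq3.
exists 1 => p /ltW p1; have n0 : 0 <= normsq3 p by rewrite /normsq3 !addr_ge0 ?sqr_ge0.
by rewrite ger0_norm.
Qed.

(** The tangent of the half angle is b / (r + a), with r + a > 0 when b is nonzero. For b = 0, take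
    t = 0 and let [rho] carry the sign of a. *)
Lemma half_angle (a b : R) : exists t rho, [/\ a = rot_cos t * rho & b = rot_sin t * rho].
Proof.
have [->|b0] := eqVneq b 0.
  by exists 0, a; rewrite /rot_cos /rot_sin mulr0 mul0r mul0r expr0n/= subr0 addr0 divr1 mul1r.
pose r := Num.sqrt (a ^+ 2 + b ^+ 2).
have r2 : r ^+ 2 = a ^+ 2 + b ^+ 2 by rewrite sqr_sqrtr// addr_ge0 ?sqr_ge0.
have r0 : 0 <= r by exact: sqrtr_ge0.
have b2 : 0 < b ^+ 2 by rewrite exprn_even_gt0.
have ra : 0 < r + a by nra.
have rp : 0 < r by nra.
have t2 : 1 + (b / (r + a)) ^+ 2 = 2 * r / (r + a).
  rewrite expr_div_n (_ : b ^+ 2 = r ^+ 2 - a ^+ 2); last by rewrite r2; ring.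
  by field; rewrite gt_eqF.
have s2 : 1 - (b / (r + a)) ^+ 2 = 2 * a / (r + a).
  rewrite expr_div_n (_ : b ^+ 2 = r ^+ 2 - a ^+ 2); last by rewrite r2; ring.
  by field; rewrite gt_eqF.
exists (b / (r + a)), r; rewrite /rot_cos /rot_sin t2 s2.
by split; field; rewrite !gt_eqF.
Qed.

(** Every point is [rotz t] of [roty t'] of a point (0, 0, w) of the z axis, where the qubit is
    diagonal. Only the square of w is controlled, so w is r or - r. *)
Lemma qubit_diagonalization (p : R * R * R) : exists (V : 'M[C]_2) (w : R),
  [/\ w ^+ 2 = normsq3 p, V \in unitmx,
      qubit p *m V = V *m (((1 + w) / 2)%:C%C *: e00 C + ((1 - w) / 2)%:C%C *: e11 C) &
      forall n, Zm n *m tpow V n = tpow V n *m Zm n].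
Proof.
case: p => [[x y] z].
have [t [rho [xE yE]]] := half_angle x y.
have [t' [w [zE rE]]] := half_angle z rho.
have pE : rotz t (roty t' ((0, 0), w)) = ((x, y), z).
  by rewrite /roty /rotz/= !mulr0 !add0r !subr0 addr0 -rE -zE -xE -yE.
pose Vz : 'M[C]_2 := 1%:M + t%:C%C *: ((- 'i%C) *: (e00 C - e11 C)).
pose Vy : 'M[C]_2 := 1%:M + t'%:C%C *: eflip C.
have uVz : Vz \in unitmx.
  rewrite unitmxE (@det2 C) unitfE.
  have -> : Vz 0 0 * Vz 1 1 - Vz 0 1 * Vz 1 0 = (1 + t ^+ 2)%:C%C.
    by rewrite !mxE/=; complex_eq; ring.
  by apply/eqP => -[] /eqP; rewrite (negbTE (one_add_sqr_neq0 t)).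
have uVy : Vy \in unitmx.
  rewrite unitmxE (@det2 C) unitfE.
  have -> : Vy 0 0 * Vy 1 1 - Vy 0 1 * Vy 1 0 = (1 + t' ^+ 2)%:C%C.
    by rewrite !mxE/=; complex_eq; ring.
  by apply/eqP => -[] /eqP; rewrite (negbTE (one_add_sqr_neq0 t')).
exists (Vz *m Vy), w; split.
- by rewrite -pE normsq3_rotz normsq3_roty /normsq3/=; ring.
- by rewrite unitmx_mul uVz uVy.
- have qz q : qubit (rotz t q) *m Vz = Vz *m qubit q by exact: rotz_qubit.
  have qy q : qubit (roty t' q) *m Vy = Vy *m qubit q by exact: roty_qubit.
  rewrite -pE mulmxA qz -!mulmxA qy; congr (_ *m (_ *m _)).
  by apply: (@mxE2 C); rewrite !qubitE !mxE/=; complex_eq; field.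
- move=> n; have Zz : Zm n *m tpow Vz n = tpow Vz n *m Zm n by exact: Zm_rotz.
  have Zy : Zm n *m tpow Vy n = tpow Vy n *m Zm n by exact: Zm_roty.
  by rewrite tpowM mulmxA Zz -!mulmxA Zy.
Qed.

(** Writing n + 1 - k in the first Gamma makes the formula symmetric under k -> n + 1 - k and
    correct at k = n + 1, where the truncated n - k in [zeta_eigen] would give 2 - u instead of 1 -
    u. *)
Definition zeta_log n k : R := ln (prior_const * (pi * (2 * 4 `^ (1 - u))) *
  (Gamma ((n.+1 - k)%:R + 1 - u) * Gamma (k%:R + 1 - u) / Gamma (n%:R + 4 - 2 * u))).

Lemma zeta_log_eigen n k : (k <= n)%N -> zeta_log n k = ln (zeta_eigen n k).
Proof.
move=> kn; rewrite /zeta_log /zeta_eigen (subSn kn).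
have -> : (n - k).+1%:R + 1 - u = (n - k)%:R + 2 - u by rewrite -natr1; ring.
reflexivity.
Qed.

(** One [l], the traces of log zeta against the weight projections, serves every p; this allows r to
    tend to 0 at fixed n. *)
Lemma redundancy_sum n : exists l : nat -> R,
  (forall p, norm3 p <= 1 ->
     let s := (1 + norm3 p) / 2 in let t := (1 - norm3 p) / 2 in
     redundancy u p n = n%:R * (s * ln s + t * ln t) - \sum_(k < n.+1) s ^+ (n - k) * t ^+ k * l k) /\
  (forall s t, s + t = 1 -> (s - t) * (\sum_(k < n.+1) s ^+ (n - k) * t ^+ k * l k) =
     s * bern n (zeta_log n) t - t * bern n (fun k => zeta_log n k.+1) t).
Proof.
have Zr := @Zm_rotz n; have Zf := @Zm_roty n.
have Zh := @Zm_highest n.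
exists (logtrace (Zm n)); split => [p p1 s t|s t st]; last first.
  apply: binomial_difference_sum => //.
  - exact: logtrace_gt.
  - rewrite (logtrace0 (Zm_normal n) Zr Zf Zh) (zeta_log_eigen (leq0n n)); reflexivity.
  - move=> k kn; apply: (logtrace_step (Zm_normal n) Zr Zf Zh kn) => j jn.
      apply: zeta_log_eigen; lia.
    rewrite /zeta_log (subKn jn) [Gamma _ * Gamma _]mulrC; reflexivity.
have [V [w [w2 uV qV ZV]]] := qubit_diagonalization p.
rewrite /redundancy zeta_Zm ntensmx_tpow relative_entropy_cast.
rewrite (relative_entropy_tpow (Zm_normal n) uV qV (tpow_qubit_normal p n) (ZV n)).
have r0 : 0 <= norm3 p by exact: sqrtr_ge0.
have wr : w = norm3 p \/ w = - norm3 p.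
  rewrite /norm3 -w2 sqrtr_sqr; have [w0|w0] := leP 0 w; first by left; rewrite ger0_norm.
  by right; rewrite ltr0_norm// opprK.
rewrite -sum_binomial_entropy; first last.
- by rewrite /s /t; field.
- by rewrite /t divr_ge0// subr_ge0.
- by rewrite /s divr_ge0// addr_ge0.
(* For w = - r the roles of s and t are exchanged, which is undone by reversing both sums and
   [logtrace_sym]. *)
case: wr => -> //; rewrite opprK -/s -/t.
congr (_ - _).
  rewrite [LHS](reindex_inj rev_ord_inj)/=; apply: eq_bigr => k _.
  have kn : (k <= n)%N by rewrite -ltnS.
  by rewrite subSS subKn// bin_sub// [t ^+ _ * _]mulrC.
rewrite [LHS](reindex_inj rev_ord_inj)/=; apply: eq_bigr => k _.
have kn : (k <= n)%N by rewrite -ltnS.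
by rewrite subSS subKn// (logtrace_sym (Zm_normal n) Zf kn) [t ^+ _ * _]mulrC.
Qed.

End ZetaMatrix.

(** * Asymptotics of Bernstein polynomials of log Gamma *)

Section Asymptotics.
Variable R : realType.

Lemma mvt_bound (f df : R -> R) (a b e : R) : a <= b ->
  (forall x, a <= x <= b -> is_derive x 1 f (df x)) ->
  (forall x, a <= x <= b -> `|df x| <= e) ->
  `|f b - f a| <= e * (b - a).
Proof.
move=> ab fd fe; have [||c cab ->] := @MVT_segment R f df a b ab.
- by move=> x; rewrite in_itv/= => /andP[ax xb]; apply: fd; rewrite !ltW.
- apply: derivable_within_continuous => x; rewrite in_itv/= => xab.
  by have [] := fd x xab.
rewrite normrM [X in _ * X]ger0_norm ?subr_ge0// ler_wpM2r ?subr_ge0//.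
by apply: fe; rewrite in_itv/= in cab.
Qed.

Lemma is_derive_sub_ln_inv (B : R -> R) (dB a x : R) : 0 < x -> is_derive x 1 B dB ->
  is_derive x 1 (fun q => B q - (ln q + a * q^-1)) (dB - (x^-1 - a * x^-1 ^+ 2)).
Proof.
move=> x0 D; have D1 := is_derive1_ln x0.
have D2 : is_derive x 1 (fun q : R => q^-1) (- x^-1 ^+ 2).
  have xn : x != 0 by rewrite gt_eqF.
  apply: DeriveDef; first exact: derivableV.
  by rewrite deriveV// derive_id /GRing.scale/= mulr1 exprVn.
by apply: is_derive_eq; rewrite /GRing.scale/=; ring.
Qed.

Lemma is_derive_mul_sub_ln (B : R -> R) (dB a x : R) : 0 < x -> is_derive x 1 B dB ->
  is_derive x 1 (fun q => q * (B q - ln q - a)) (B x - ln x - a + x * (dB - x^-1)).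
Proof.
move=> x0 D; have D1 := is_derive1_ln x0.
by apply: is_derive_eq; rewrite /GRing.scale/=; ring.
Qed.

Lemma is_derive_sub_entropy (B : R -> R) (dB n a b e x : R) : 0 < x -> is_derive x 1 B dB ->
  is_derive x 1 (fun q => B q - (n * (q * ln q) + a * ln q + q * b + e))
    (dB - (n * ln x + n + a * x^-1 + b)).
Proof.
move=> x0 D; have D1 := is_derive1_ln x0.
apply: is_derive_eq; rewrite /GRing.scale/=; field.
by rewrite gt_eqF.
Qed.

Lemma ln_le_sub1 (x : R) : 0 < x -> ln x <= x - 1.
Proof. by move=> x0; rewrite -[X in ln X](subrK 1) addrC le_ln1Dx//; lra. Qed.

Lemma ln_add1_ge (y : R) : -1 < y -> y / (1 + y) <= ln (1 + y).
Proof.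
move=> y1; have y0 : 0 < 1 + y by lra.
have := @ln_le_sub1 (1 + y)^-1; rewrite invr_gt0 lnV ?posrE// => /(_ y0).
have -> : y / (1 + y) = 1 - (1 + y)^-1 by field; rewrite gt_eqF.
lra.
Qed.

Lemma ln_add1_linear (y : R) : - 2^-1 <= y -> `|ln (1 + y) - y| <= 2 * y ^+ 2.
Proof.
move=> y1; have y2 : -1 < y by lra.
have h1 := le_ln1Dx y2; have h2 := ln_add1_ge y2.
have y0 : 0 < 1 + y by lra.
have e : y / (1 + y) = y - y ^+ 2 / (1 + y) by field; rewrite gt_eqF.
have h : y ^+ 2 / (1 + y) <= 2 * y ^+ 2.
  rewrite ler_pdivrMr//; have := sqr_ge0 y; nra.
have := sqr_ge0 y; rewrite ler_norml => y3; apply/andP; split; lra.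
Qed.

Lemma ln_add1_quadratic (y : R) : 0 <= y -> `|ln (1 + y) - y + y ^+ 2 / 2| <= y ^+ 3.
Proof.
move=> y0; pose f (x : R) := ln x - (x - 1) + (x - 1) ^+ 2 / 2.
have := @mvt_bound f (fun x => x^-1 - 1 + (x - 1)) 1 (1 + y) (y ^+ 2).
have -> : f (1 + y) = ln (1 + y) - y + y ^+ 2 / 2.
  by rewrite /f; have -> : 1 + y - 1 = y by ring.
have -> : f 1 = 0 by rewrite /f ln1 subrr expr0n/=; ring.
rewrite subr0 (_ : 1 + y - 1 = y); last by ring.
move=> H; apply: le_trans (H _ _ _) _; [lra| | |by rewrite -exprSr].
- move=> x /andP[x1 _]; have x0 : 0 < x by lra.
  have D := is_derive1_ln x0.
  rewrite /f; apply: is_derive_eq.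
  by rewrite /GRing.scale/= ; lra.
move=> x /andP[x1 xy]; have x0 : 0 < x by lra.
have -> : x^-1 - 1 + (x - 1) = (x - 1) ^+ 2 / x by field; rewrite gt_eqF.
rewrite (ger0_norm (divr_ge0 (sqr_ge0 _) (ltW x0))) ler_pdivrMr//.
have : (x - 1) ^+ 2 <= y ^+ 2 by rewrite ler_sqr ?nnegrE; lra.
have := sqr_ge0 y; nra.
Qed.


Lemma eq0_le_inv_nat (x C : R) : (forall m, (0 < m)%N -> `|x| <= C / m%:R) -> x = 0.
Proof.
move=> H; apply/eqP; rewrite -normr_eq0; apply: contrapT => /negP x0.
have xp : 0 < `|x| by rewrite lt0r x0 normr_ge0.
have := H (Num.truncn (C / `|x|)).+1 isT; rewrite ler_pdivlMr ?ltr0n// mulrC -ler_pdivlMr//.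
by rewrite leNgt truncnS_gt.
Qed.

(* In the application g = ln Gamma; abstracting it also keeps conversion from unfolding Euler's
   integral. *)
Section LogGamma.
Variable g : R -> R.
Hypothesis gS : forall x : R, 0 < x -> g (x + 1) = g x + ln x.
Hypothesis g_add_le : forall x c : R, 0 < x -> 0 <= c <= 1 -> g (x + c) <= c * ln x + g x.
Hypothesis g1 : g 1 = 0.
Hypothesis g_half : g 2^-1 = ln pi / 2.

(** The upper bound is the step from n by c, the lower bound the step from n + c by 1 - c, which
    lands on n + 1. *)
Lemma log_gamma_add (n : nat) (c : R) : (0 < n)%N -> 0 <= c <= 1 ->
  `|g (n%:R + c) - g n%:R - c * ln n%:R| <= n%:R^-1.
Proof.
move=> n0 c01; have /andP[c0 c1] := c01.
have nR : (0 : R) < n%:R by rewrite ltr0n.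
have nc : 0 < n%:R + c by lra.
have up := g_add_le nR c01.
have lo : g n%:R + ln n%:R <= (1 - c) * ln (n%:R + c) + g (n%:R + c).
  rewrite -gS// (_ : n%:R + 1 = (n%:R + c) + (1 - c)); last by ring.
  by apply: g_add_le => //; apply/andP; split; lra.
have d : ln (n%:R + c) <= ln n%:R + c / n%:R.
  have -> : n%:R + c = n%:R * (1 + c / n%:R) by field; rewrite gt_eqF.
  have cn : 0 <= c / n%:R by rewrite divr_ge0// ltW.
  by rewrite lnM ?posrE ?lerD2l ?le_ln1Dx//; lra.
have n1 : 0 < (n%:R : R)^-1 by rewrite invr_gt0.
have : (1 - c) * ln (n%:R + c) <= (1 - c) * (ln n%:R + c / n%:R) by rewrite ler_wpM2l//; lra.
move: lo up n1; set i := n%:R^-1; set a := g _; set b := g _.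
move: (ln _) => l; move: (ln _) => l'.
move=> lo up i0 H; rewrite ler_norml; apply/andP; split; nra.
Qed.

Lemma log_gamma_add_uniform (K n : nat) (c : R) : (0 < n)%N -> 0 <= c <= K.+1%:R ->
  `|g (n%:R + c) - g n%:R - c * ln n%:R| <= K.+1%:R ^+ 2 / n%:R.
Proof.
move=> n0; have nR : (0 : R) < n%:R by rewrite ltr0n.
elim: K c => [|K IHK] c; first by rewrite expr1n div1r; exact: log_gamma_add.
have K2 : K.+2%:R = K.+1%:R + 1 :> R by rewrite natr1.
move=> /andP[c0]; rewrite K2 => cK.
have i0 : 0 < (n%:R : R)^-1 by rewrite invr_gt0.
have K0 : (0 : R) <= K.+1%:R by [].
have [c1|c1] := leP c 1.
  apply: le_trans (log_gamma_add n0 _) _; first by rewrite c0.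
  move: (n%:R^-1) (K.+1%:R) i0 K0 => i k; nra.
have cK1 : 0 <= c - 1 <= K.+1%:R by apply/andP; split; lra.
have nc : 0 < n%:R + (c - 1) by lra.
have := IHK _ cK1; have := gS nc.
rewrite (_ : n%:R + (c - 1) + 1 = n%:R + c); last by ring.
move=> ->.
have cn0 : 0 <= (c - 1) / n%:R by apply: divr_ge0; [lra|exact: ltW].
have cnK : (c - 1) / n%:R <= K.+1%:R / n%:R by rewrite ler_pM2r//; lra.
have : ln n%:R <= ln (n%:R + (c - 1)) <= ln n%:R + K.+1%:R / n%:R.
  have -> : n%:R + (c - 1) = n%:R * (1 + (c - 1) / n%:R) by field; rewrite gt_eqF.
  rewrite lnM ?posrE//; last by lra.
  rewrite lerDl lerD2l ln_ge0 ?lerDl//=.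
  by apply: le_trans cnK; apply: le_ln1Dx; lra.
move: (g _) (g _) (ln _) (ln _) => a b l l'.
move: (n%:R^-1) i0 (K.+1%:R) K0 => i i0 k k0 /andP[h1 h2]; rewrite !ler_norml => /andP[h3 h4].
apply/andP; split; nra.
Qed.

(* Stirling's formula: the increments of this sequence are O(1/(n(n+1))). *)
Let a (n : nat) : R := g n.+1%:R - (n%:R + 2^-1) * ln n%:R + n%:R.

Let a_step n : (0 < n)%N -> `|a n.+1 - a n| <= 4 / n%:R - 4 / n.+1%:R.
Proof.
move=> n0; have nR : (1 : R) <= n%:R by rewrite ler1n.
have n1 : n.+1%:R = n%:R + 1 :> R by rewrite natr1.
have n2 : n.+2%:R = n.+1%:R + 1 :> R by rewrite natr1.
rewrite /a n2 gS ?ltr0n// n1.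
have -> : n%:R + 1 = n%:R * (1 + n%:R^-1) :> R by field; rewrite gt_eqF//; lra.
have i0 : 0 < (n%:R : R)^-1 by rewrite invr_gt0; lra.
have i1 : (n%:R : R)^-1 <= 1 by rewrite invf_le1//; lra.
rewrite lnM ?posrE; [|lra..].
have := ln_add1_quadratic (ltW i0).
have -> : 4 / n%:R - 4 / (n%:R * (1 + n%:R^-1)) = 4 * n%:R^-1 ^+ 2 / (1 + n%:R^-1) :> R.
  by field; rewrite !gt_eqF//; lra.
have nn : n%:R * n%:R^-1 = 1 :> R by rewrite divff// gt_eqF//; lra.
move: (n%:R : R) (n%:R^-1 : R) nR nn i0 i1 => x i x1 xi i0 i1.
set l := ln (1 + i) => H.
have -> : g (x * (1 + i)) + (ln x + l) - (x * (1 + i) + 2^-1) * (ln x + l) + x * (1 + i)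
   - (g (x * (1 + i)) - (x + 2^-1) * ln x + x) = x * i - x * i * ln x + ln x - (x + x * i - 1 / 2) * l
   by field.
rewrite xi.
have : `|1 - 1 * ln x + ln x - (x + 1 - 1 / 2) * l| <= 2 * i ^+ 2.
  have -> : 1 - 1 * ln x + ln x - (x + 1 - 1 / 2) * l =
    (1 - (x + 2^-1) * (i - i ^+ 2 / 2)) - (x + 2^-1) * (l - i + i ^+ 2 / 2) by field.
  (* Since x i = 1, the shift 1/2 in the sequence cancels the terms of first order in i. *)
  have -> : 1 - (x + 2^-1) * (i - i ^+ 2 / 2) = i ^+ 2 / 4.
    by have -> : (x + 2^-1) * (i - i ^+ 2 / 2) = x * i - (x * i) * i / 2 + i / 2 - i ^+ 2 / 4;
      [field|rewrite xi; field].
  have B : (x + 2^-1) * i ^+ 3 <= 3 / 2 * i ^+ 2.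
    have -> : (x + 2^-1) * i ^+ 3 = (x * i) * i ^+ 2 + i / 2 * i ^+ 2 by field.
    by rewrite xi; have := sqr_ge0 i; nra.
  move: H; set d := l - i + i ^+ 2 / 2 => H.
  have x2 : 0 < x + 2^-1 by lra.
  have : `|(x + 2^-1) * d| <= 3 / 2 * i ^+ 2.
    by apply: le_trans B; rewrite normrM (gtr0_norm x2) ler_pM2l.
  by have := sqr_ge0 i; rewrite !ler_norml => i2 /andP[? ?]; apply/andP; split; lra.
(* The origin of the constant 4: as i <= 1, 2 i^2 is at most 4 i^2 / (1 + i). *)
move=> /le_trans; apply; rewrite ler_pdivlMr; last by lra.
by have := sqr_ge0 i; nra.
Qed.

(** By [a_step], a n - 4 / n increases and a n + 4 / n decreases; the supremum of the former will be
    the limit. *)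
Let a_dist m n : (0 < m)%N -> (0 < n)%N -> a m - 4 / m%:R <= a n + 4 / n%:R.
Proof.
clearbody a.
have up p q : (0 < p)%N -> a p - 4 / p%:R <= a (p + q)%N - 4 / (p + q)%:R.
  move=> p0; elim: q => [|q IHq]; first by rewrite addn0.
  have := @a_step (p + q) (ltn_addr q p0); rewrite addnS; move: (p + q)%N IHq => k.
  by rewrite ler_norml; move: (k%:R^-1) (k.+1%:R^-1) => x y h /andP[]; lra.
have dn p q : (0 < p)%N -> a (p + q)%N + 4 / (p + q)%:R <= a p + 4 / p%:R.
  move=> p0; elim: q => [|q IHq]; first by rewrite addn0.
  have := @a_step (p + q) (ltn_addr q p0); rewrite addnS; move: (p + q)%N IHq => k.
  by rewrite ler_norml; move: (k%:R^-1) (k.+1%:R^-1) => x y h /andP[]; lra.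
move=> m0 n0; have [mn|nm] := leqP m n.
  have := up m (n - m)%N m0; rewrite subnKC// => h.
  by have : 0 <= 8 / n%:R :> R by []; lra.
have := dn n (m - n)%N n0; rewrite subnKC 1?ltnW// => h.
by have : 0 <= 8 / m%:R :> R by []; lra.
Qed.

Let a_cvg : exists kappa, forall n, (0 < n)%N -> `|a n - kappa| <= 4 / n%:R.
Proof.
clearbody a.
pose A := [set x | exists2 m, (0 < m)%N & x = a m - 4 / m%:R].
have A0 : A !=set0 by exists (a 1 - 4 / 1%:R), 1%N.
have Aub n : (0 < n)%N -> ubound A (a n + 4 / n%:R).
  by move=> n0 _ [m m0 ->]; exact: a_dist.
have sA : has_sup A by split => //; exists (a 1 + 4 / 1%:R); exact: Aub.
exists (sup A) => n n0.
have h1 : a n - 4 / n%:R <= sup A by apply: sup_upper_bound => //; exists n.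
have h2 : sup A <= a n + 4 / n%:R by apply: ge_sup => //; exact: Aub.
by rewrite ler_norml; apply/andP; split; lra.
Qed.

(** Legendre's duplication formula at half-integers, by induction from the value at 1/2; it will
    identify the limit of the Stirling sequence. *)
Lemma log_gamma_half (m : nat) :
  g (m%:R + 2^-1) = ln pi / 2 + g (2 * m + 1)%:R - m%:R * ln 4 - g m.+1%:R.
Proof.
elim: m => [|m IHm]; first by rewrite add0r g_half muln0 add0n g1; ring.
have e : (2 * m.+1 + 1)%:R = (2 * m + 1)%:R + 1 + 1 :> R by rewrite !natr1; congr (_%:R); lia.
have m2 : 0 < m%:R + 2^-1 :> R by rewrite ltr_wpDl.
have o0 : (0 : R) < (2 * m + 1)%:R by rewrite ltr0n addn1.
have o1 : (0 : R) < (2 * m + 1)%:R + 1 by rewrite addr_gt0.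
rewrite e gS// [in g (_ + 1)]gS//.
have -> : m.+1%:R + 2^-1 = m%:R + 2^-1 + 1 :> R by rewrite -natr1; ring.
have -> : m.+2%:R = m.+1%:R + 1 :> R by rewrite natr1.
rewrite !gS// IHm.
have -> : (2 * m + 1)%:R + 1 = 2 * m.+1%:R :> R by rewrite natr1 -natrM; congr (_%:R); lia.
have -> : (2 * m + 1)%:R = 2 * (m%:R + 2^-1) :> R by rewrite natrD natrM; field.
rewrite !lnM ?posrE//.
have -> : ln 4 = ln 2 + ln 2 :> R by rewrite -lnM ?posrE//; congr ln; ring.
by rewrite -natr1; ring.
Qed.

Let a_cvg_stirling n : (0 < n)%N -> `|a n - (ln 2 + ln pi) / 2| <= 4 / n%:R.
Proof.
have [kappa ak] := a_cvg; suff <- : kappa = (ln 2 + ln pi) / 2 by exact: ak.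
(* The duplication formula compares a (2 m) with twice a m, and 11 = 2 + 2 * 4 + 1 adds their errors
   and that of [log_gamma_add] at c = 1/2. *)
apply/eqP; rewrite -subr_eq0; apply/eqP; apply: (@eq0_le_inv_nat _ 11) => m m0.
have mR : (0 : R) < m%:R by rewrite ltr0n.
have h : 0 <= (2^-1 : R) <= 1 by apply/andP; split; lra.
have := log_gamma_add m0 h; rewrite log_gamma_half.
have := ak _ m0; have m20 : (0 < 2 * m)%N by rewrite muln_gt0.
have := ak _ m20; rewrite /a.
have -> : (2 * m).+1 = (2 * m + 1)%N by rewrite addn1.
have -> : m.+1%:R = m%:R + 1 :> R by rewrite natr1.
rewrite gS//.
have -> : (2 * m)%:R = 2 * m%:R :> R by rewrite natrM.
have -> : 4 / (2 * m%:R) = 2 * m%:R^-1 :> R by field; rewrite gt_eqF.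
rewrite lnM ?posrE//.
have -> : ln 4 = ln 2 + ln 2 :> R by rewrite -lnM ?posrE//; congr ln; ring.
move: (g (2 * m + 1)%:R) (g m%:R) (m%:R^-1) (ln m%:R) => x y i lm.
rewrite !ler_norml => /andP[h1 h2] /andP[h3 h4] /andP[h5 h6]; apply/andP; split; lra.
Qed.

Lemma stirling (b : R) : exists C, forall (n : nat) (c : R), (0 < n)%N -> 0 <= c <= b ->
  `|g (n%:R + c) - ((n%:R + c - 2^-1) * ln n%:R - n%:R + (ln 2 + ln pi) / 2)| <= C / n%:R.
Proof.
pose K := Num.truncn b; exists (4 + K.+1%:R ^+ 2) => n c n0 /andP[c0 cb].
have cK : 0 <= c <= K.+1%:R by rewrite c0 (le_trans cb)// ltW// truncnS_gt.
have := log_gamma_add_uniform n0 cK; have := a_cvg_stirling n0; rewrite /a.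
have -> : n.+1%:R = n%:R + 1 :> R by rewrite natr1.
rewrite gS ?ltr0n//.
move: (g (n%:R + c)) (g n%:R) (n%:R^-1) (ln n%:R) => x y i lm.
rewrite !ler_norml => /andP[h1 h2] /andP[h3 h4]; apply/andP; split; lra.
Qed.

End LogGamma.

(** * Binomial means of inverse factorials and of the logarithm *)

Section Bernstein.
Implicit Types (f h : nat -> R) (q : R) (m : nat).

(** Absorption, k C(m + 1, k) = (m + 1) C(m, k - 1). Applied to reciprocals, it evaluates the
    inverse moments below. *)
Lemma bern_moment m f q :
  bern m.+1 (fun k => k%:R * f k) q = m.+1%:R * q * bern m (fun k => f k.+1) q.
Proof.
elim: m f => [|m IHm] f; first by rewrite /=; ring.
rewrite [LHS](_ : _ = (1 - q) * bern m.+1 (fun k => k%:R * f k) q +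
   q * bern m.+1 (fun k => k.+1%:R * f k.+1) q)// IHm.
rewrite (_ : bern m.+1 (fun k => k.+1%:R * f k.+1) q =
    bern m.+1 (fun k => k%:R * f k.+1) q + bern m.+1 (fun k => f k.+1) q); last first.
  by rewrite !bernE -big_split/=; apply: eq_bigr => k _; rewrite -natr1; ring.
rewrite (IHm (fun k => f k.+1)) /= -[m.+2%:R]natr1; ring.
Qed.

Lemma bernD m f h q : bern m (fun k => f k + h k) q = bern m f q + bern m h q.
Proof. by rewrite !bernE -big_split/=; apply: eq_bigr => k _; rewrite mulrDr. Qed.

Lemma bernZ m a f q : bern m (fun k => a * f k) q = a * bern m f q.
Proof. by rewrite !bernE mulr_sumr; apply: eq_bigr => k _; rewrite mulrCA. Qed.

Lemma bernB m f h q : bern m (fun k => f k - h k) q = bern m f q - bern m h q.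
Proof. by rewrite !bernE -sumrB/=; apply: eq_bigr => k _; rewrite mulrBr. Qed.

Lemma bern_cst m a q : bern m (fun=> a) q = a.
Proof.
transitivity (bern m (fun k => a + k%:R * 0) q); last by rewrite bern_affine mulr0 addr0.
by apply: eq_bern => k _; rewrite mulr0 addr0.
Qed.

Lemma bern_rev m f q : bern m f (1 - q) = bern m (fun k => f (m - k)%N) q.
Proof.
rewrite !bernE (reindex_inj rev_ord_inj)/=; apply: eq_bigr => k _.
have km : (k <= m)%N by rewrite -ltnS.
by rewrite subSS bin_sub// subKn// (_ : 1 - (1 - q) = q) 1?[q ^+ _ * _]mulrC//; ring.
Qed.

Lemma bern_norm_le m f h q : 0 <= q <= 1 -> (forall k, `|f k| <= h k) ->
  `|bern m f q| <= bern m h q.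
Proof.
move=> /andP[q0 q1] fh; rewrite !bernE; apply: le_trans (ler_norm_sum _ _ _) _.
apply: ler_sum => k _; rewrite normrM ger0_norm ?ler_wpM2l//.
  by rewrite !mulr_ge0 ?exprn_ge0 ?subr_ge0.
by rewrite !mulr_ge0 ?exprn_ge0 ?subr_ge0.
Qed.

Lemma bern_top m f : bern m f 1 = f m.
Proof.
by elim: m f => [//|m IHm] f /=; rewrite subrr mul0r add0r mul1r IHm.
Qed.

Lemma bern_bot m f : bern m f 0 = f 0%N.
Proof. by elim: m f => [//|m IHm] f /=; rewrite subr0 mul0r addr0 mul1r IHm. Qed.

Lemma bern_delta0 m q : bern m (fun k => (k == 0%N)%:R) q = (1 - q) ^+ m.
Proof.
elim: m => [//|m IHm] /=; rewrite IHm exprS.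
by rewrite (_ : (fun k => (k.+1 == 0%N)%:R) = (fun=> 0))// bern_cst mulr0 addr0.
Qed.

(** The product of k and 1 / k is 1 except at k = 0, where it is 0; this exception contributes (1 -
    q)^(m + 1). *)
Lemma bern_inv m q : m.+1%:R * q * bern m (fun k => k.+1%:R^-1) q = 1 - (1 - q) ^+ m.+1.
Proof.
rewrite -(bern_moment m (fun k => k%:R^-1)) -(bern_delta0 m.+1 q).
rewrite -[X in X - _](bern_cst m.+1 1 q) -bernB; apply: eq_bern => -[|k] _ /=.
  by rewrite mul0r subrr.
by rewrite divff// subr0.
Qed.

Lemma bern_inv2 m q : m.+1%:R * q * bern m (fun k => (k.+1%:R * k.+2%:R)^-1) q =
  bern m.+1 (fun k => k.+1%:R^-1) q - (1 - q) ^+ m.+1.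
Proof.
rewrite -(bern_moment m (fun k => (k%:R * k.+1%:R)^-1)) -(bern_delta0 m.+1 q).
rewrite -bernB; apply: eq_bern => -[|k] _ /=.
  by rewrite mul0r invr1 subrr.
by rewrite subr0 invfM mulrA divff// mul1r.
Qed.

(** Keep only the k = 2 term of the binomial expansion of 1 with m + 2 trials. *)
Lemma pow_decay m q : 0 < q <= 1 -> (1 - q) ^+ m <= 2 / (m.+1%:R * m.+2%:R * q ^+ 2).
Proof.
move=> /andP[q0 q1].
have d0 : 0 < m.+1%:R * m.+2%:R * q ^+ 2 by rewrite !mulr_gt0 ?exprn_gt0.
rewrite ler_pdivlMr// mulrC.
have e : m.+1%:R * m.+2%:R = 2 * 'C(m.+2, 2)%:R :> R.
  by rewrite -!natrM; have := mul_bin_diag m.+2 1; rewrite bin1 mulnC => ->.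
rewrite e -mulrA -mulrA ler_piMr//.
rewrite -mulrA [q ^+ 2 * _]mulrC -[leRHS](bern_cst m.+2 1 q) bernE.
rewrite (bigD1 (inord 2))//= inordK// subn2/= mulr1 lerDl sumr_ge0// => k _.
by rewrite !mulr_ge0 ?exprn_ge0 ?subr_ge0// ltW.
Qed.

Lemma bern_inv_le m q : 0 < q <= 1 -> bern m (fun k => k.+1%:R^-1) q <= (m.+1%:R * q)^-1.
Proof.
move=> /andP[q0 q1]; have d0 : 0 < m.+1%:R * q by rewrite mulr_gt0.
rewrite -(ler_pM2l d0) bern_inv divff ?gt_eqF// gerBl exprn_ge0// subr_ge0//.
Qed.

Lemma bern_inv2_le m q : 0 < q <= 1 ->
  bern m (fun k => (k.+1%:R * k.+2%:R)^-1) q <= (m.+1%:R * m.+2%:R * q ^+ 2)^-1.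
Proof.
move=> q01; have /andP[q0 q1] := q01; have d0 : 0 < m.+1%:R * q by rewrite mulr_gt0.
rewrite -(ler_pM2l d0) bern_inv2; apply: (@le_trans _ _ (m.+2%:R * q)^-1).
  by apply: le_trans (bern_inv_le m.+1 q01); rewrite gerBl exprn_ge0// subr_ge0.
rewrite le_eqVlt; apply/orP; left; apply/eqP; field.
by have m0 := ler0n R m; rewrite !gt_eqF//; lra.
Qed.

Lemma bern_inv3_le m q : 0 < q <= 1 ->
  bern m (fun k => (k.+1%:R * k.+2%:R * k.+3%:R)^-1) q <= (m.+1%:R * m.+2%:R * m.+3%:R * q ^+ 3)^-1.
Proof.
move=> q01; have /andP[q0 q1] := q01; have d0 : 0 < m.+1%:R * q by rewrite mulr_gt0.
rewrite -(ler_pM2l d0) -(bern_moment m (fun k => (k%:R * k.+1%:R * k.+2%:R)^-1)).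
apply: (@le_trans _ _ (m.+2%:R * m.+3%:R * q ^+ 2)^-1).
  apply: le_trans (bern_inv2_le m.+1 q01); apply: le_trans (ler_norm _) _.
  apply: bern_norm_le => [|[|k]]; first by rewrite ltW.
    by rewrite mul0r normr0 invr_ge0 mulr_ge0.
  by rewrite -mulrA invfM mulrA divff// mul1r ger0_norm// invr_ge0 mulr_ge0.
rewrite le_eqVlt; apply/orP; left; apply/eqP; field.
by have m0 := ler0n R m; rewrite !gt_eqF//; lra.
Qed.

Lemma is_derive_bern m f q :
  is_derive q 1 (bern m f) (m%:R * bern m.-1 (fun k => f k.+1 - f k) q).
Proof.
elim: m f => [|m IHm] f /=; first by rewrite mul0r; exact: is_derive_cst.
have D1 := IHm f; have D2 := IHm (fun k => f k.+1).
apply: is_derive_eq.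
rewrite /GRing.scale/= !bernB -[m.+1%:R]natr1.
case: m {IHm D1 D2} => [|m] /=; first by ring.
ring.
Qed.

(** The expansion uses inverse rising factorials instead of powers of 1 / (k + c) because their
    binomial means can be computed exactly or bounded sharply. *)
Lemma log_increment (c0 c1 : R) : 0 < c0 -> 0 <= c1 -> exists2 M, 0 <= M &
  forall (c : R) (k : nat), c0 <= c <= c1 ->
  `|ln (k.+1%:R + c) - ln (k%:R + c) - (k.+1%:R^-1 + (2^-1 - c) * (k.+1%:R * k.+2%:R)^-1)|
    <= M * (k.+1%:R * k.+2%:R * k.+3%:R)^-1.
Proof.
(* [A] satisfies k + 3 <= A (k + c), which trades powers of 1 / (k + c) for inverse factorials; [P]
   is chosen so that P (k + 1) bounds the numerator [N] below. *)
move=> c0p c1p; pose A := 1 + 3 / c0.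
pose P := 2 * ((1 + c1) * (2 + c1)) * (1 + c1) + (3 + 2 * c1) + (2 + c1 ^+ 2).
have A0 : 0 <= A by rewrite addr_ge0// divr_ge0// ltW.
have P0 : 0 <= P by rewrite !addr_ge0 ?mulr_ge0 ?sqr_ge0 ?addr_ge0 ?mulr_ge0.
exists (A ^+ 3 + P * A ^+ 2) => [|c k /andP[cl cu]].
  by rewrite addr_ge0 ?mulr_ge0 ?exprn_ge0.
have -> : k.+3%:R = k%:R + 3 :> R by rewrite -natrD addn3.
have -> : k.+2%:R = k%:R + 2 :> R by rewrite -natrD addn2.
have -> : k.+1%:R = k%:R + 1 :> R by rewrite natr1.
have := ler0n R k; move: (k%:R : R) => K K0.
have x0 : 0 < K + c by lra.
have -> : K + 1 + c = (K + c) * (1 + (K + c)^-1) by field; rewrite gt_eqF.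
have ix0 : 0 < (K + c)^-1 by rewrite invr_gt0.
rewrite lnM ?posrE; [|lra..].
have Hl := ln_add1_quadratic (ltW ix0).
have KA : K + 3 <= A * (K + c).
  have : 3 <= 3 / c0 * (K + c) by rewrite mulrAC ler_pdivlMr//; lra.
  by rewrite /A; lra.
move: Hl KA; set x := K + c; set D := (K + 1) * (K + 2) * (K + 3) => Hl KA.
have D0 : 0 < D by rewrite !mulr_gt0; lra.
have h1 : x^-1 ^+ 3 <= A ^+ 3 * D^-1.
  rewrite exprVn ler_pdivlMr// mulrC ler_pdivrMr ?exprn_gt0// -exprMn.
  apply: le_trans (_ : (K + 3) ^+ 3 <= _); last by rewrite lerXn2r ?nnegrE//; lra.
  by rewrite /D; nra.
pose N := 2 * ((1 - c) * (2 - c)) * x - ((3 - 2 * c) * K + (2 - c ^+ 2)).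
have NE : x^-1 - x^-1 ^+ 2 / 2 - ((K + 1)^-1 + (2^-1 - c) / ((K + 1) * (K + 2))) =
    N / (2 * x ^+ 2 * ((K + 1) * (K + 2))).
  by rewrite /N /x; field; rewrite !gt_eqF//; lra.
have NP : `|N| <= P * (K + 1).
  have n1 : `|1 - c| <= 1 + c1 by rewrite ler_norml; apply/andP; split; lra.
  have n2 : `|2 - c| <= 2 + c1 by rewrite ler_norml; apply/andP; split; lra.
  have n3 : x <= (1 + c1) * (K + 1) by rewrite /x; nra.
  have n4 : `|(3 - 2 * c) * K + (2 - c ^+ 2)| <= (3 + 2 * c1) * K + (2 + c1 ^+ 2).
    by rewrite ler_norml; apply/andP; split; nra.
  have n5 : `|2 * ((1 - c) * (2 - c)) * x| <= 2 * ((1 + c1) * (2 + c1)) * ((1 + c1) * (K + 1)).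
    by rewrite !normrM (ger0_norm (ltW x0)) normr_nat !ler_pM// ?mulr_ge0// ltW.
  apply: le_trans (ler_normB _ _) _; apply: le_trans (lerD n5 n4) _.
  by rewrite /P; have := sqr_ge0 c1; nra.
have h2 : `|N / (2 * x ^+ 2 * ((K + 1) * (K + 2)))| <= P * A ^+ 2 * D^-1.
  have K1 : 0 < K + 1 by lra.
  have K2 : 0 < K + 2 by lra.
  have d0 : 0 < 2 * x ^+ 2 * ((K + 1) * (K + 2)) by rewrite !mulr_gt0 ?exprn_gt0.
  rewrite normrM normfV (gtr0_norm d0) ler_pdivrMr//; apply: le_trans NP _.
  rewrite mulrAC ler_pdivlMr// -!mulrA ler_wpM2l//.
  have : (K + 3) ^+ 2 <= (A * x) ^+ 2 by rewrite lerXn2r ?nnegrE//; lra.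
  rewrite exprMn => h; have : (K + 3) ^+ 2 * ((K + 1) * (K + 2)) <= A ^+ 2 * x ^+ 2 * ((K + 1) * (K + 2)).
    by rewrite ler_wpM2r// mulr_ge0// ltW.
  have : (K + 1) * D <= (K + 3) ^+ 2 * ((K + 1) * (K + 2)) by rewrite /D; nra.
  have : 0 <= A ^+ 2 * x ^+ 2 * ((K + 1) * (K + 2)) by rewrite !mulr_ge0 ?sqr_ge0// ltW.
  lra.
have -> : ln x + ln (1 + x^-1) - ln x - ((K + 1)^-1 + (2^-1 - c) / ((K + 1) * (K + 2))) =
  (ln (1 + x^-1) - x^-1 + x^-1 ^+ 2 / 2) + N / (2 * x ^+ 2 * ((K + 1) * (K + 2))).
  by rewrite -NE; ring.
apply: le_trans (ler_normD _ _) _; rewrite [leRHS]mulrDl; apply: lerD => //; exact: le_trans h1.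
Qed.

(** [log_increment] is averaged term by term. The first two means are explicit up to powers of 1 -
    q, controlled by [pow_decay]; with q >= d, these and the cubic term are uniformly O(m^-2). *)
Lemma log_mean_derivative (d c0 c1 : R) : 0 < d -> d <= 1 -> 0 < c0 -> 0 <= c1 -> exists2 M, 0 <= M &
  forall (c q : R) m, c0 <= c <= c1 -> d <= q <= 1 ->
  `|m.+1%:R * bern m (fun k => ln (k.+1%:R + c) - ln (k%:R + c)) q
    - (q^-1 + (2^-1 - c) / (m.+2%:R * q ^+ 2))| <= M / m.+2%:R ^+ 2.
Proof.
move=> d0 d1 c0p c1p; have [M0 M0p HM] := log_increment c0p c1p.
pose D := d^-1; have D0 : 0 < D by rewrite invr_gt0.
exists (2 * D ^+ 2 * (D + (1 + c1) * (D ^+ 2 + D)) + M0 * D ^+ 3) => [|c q m cc /andP[dq q1]].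
  by rewrite addr_ge0 ?mulr_ge0 ?addr_ge0 ?exprn_ge0 ?mulr_ge0 ?addr_ge0 ?exprn_ge0// ltW.
have q0 : 0 < q by exact: lt_le_trans dq.
have q01 : 0 < q <= 1 by rewrite q0.
have /andP[cl cu] := cc.
pose rho k := ln (k.+1%:R + c) - ln (k%:R + c) - (k.+1%:R^-1 + (2^-1 - c) * (k.+1%:R * k.+2%:R)^-1).
have -> : bern m (fun k => ln (k.+1%:R + c) - ln (k%:R + c)) q =
    bern m (fun k => k.+1%:R^-1) q + (2^-1 - c) * bern m (fun k => (k.+1%:R * k.+2%:R)^-1) q
    + bern m rho q.
  by rewrite -bernZ -!bernD; apply: eq_bern => k _; rewrite /rho; ring.
have rho_le : `|bern m rho q| <= M0 * (m.+1%:R * m.+2%:R * m.+3%:R * q ^+ 3)^-1.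
  apply: le_trans (_ : bern m (fun k => M0 * (k.+1%:R * k.+2%:R * k.+3%:R)^-1) q <= _).
    apply: bern_norm_le => [|k]; first by rewrite ltW.
    exact: HM.
  by rewrite bernZ ler_wpM2l// bern_inv3_le.
have e_le := pow_decay m.+1 q01.
have e0 : 0 <= (1 - q) ^+ m.+1 by rewrite exprn_ge0// subr_ge0.
have b1 := bern_inv m q; have b2 := bern_inv2 m q; have b3 := bern_inv m.+1 q.
move: b1 b2 b3 rho_le e_le e0; rewrite [(1 - q) ^+ m.+2]exprS.
set e := (1 - q) ^+ m.+1; set B1 := bern m _ q; set B2 := bern m _ q; set B3 := bern m.+1 _ q.
set B := bern m rho q.
have N0 : (0 : R) < m.+2%:R by [].
have N1 : (0 : R) < m.+1%:R by [].
have N3 : m.+2%:R <= m.+3%:R :> R by rewrite ler_nat.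
have N2 : (1 : R) <= m.+2%:R by rewrite ler1n.
move: (m.+1%:R : R) (m.+2%:R : R) (m.+3%:R : R) N0 N1 N2 N3 => n1 n2 n3 n20 n10 n21 n23.
have n30 : 0 < n3 by lra.
move=> b1 b2 b3 HB He e0.
have -> : n1 * (B1 + (2^-1 - c) * B2 + B) - (q^-1 + (2^-1 - c) / (n2 * q ^+ 2)) =
   n1 * B - e * (q^-1 + (2^-1 - c) * ((1 - q) / (n2 * q ^+ 2) + q^-1)).
  have -> : B1 = (1 - e) / (n1 * q) by rewrite -b1 mulrAC divff ?mul1r// gt_eqF ?mulr_gt0.
  have -> : B2 = (B3 - e) / (n1 * q) by rewrite -b2 mulrAC divff ?mul1r// gt_eqF ?mulr_gt0.
  have -> : B3 = (1 - (1 - q) * e) / (n2 * q) by rewrite -b3 mulrAC divff ?mul1r// gt_eqF ?mulr_gt0.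
  by field; rewrite !gt_eqF.
have wD : q^-1 <= D by rewrite lef_pV2 ?posrE.
have w0 : 0 < q^-1 by rewrite invr_gt0.
have n2i : 0 < n2^-1 by rewrite invr_gt0.
have n2i1 : n2^-1 <= 1 by rewrite invf_le1.
have n32 : n3^-1 <= n2^-1 by rewrite lef_pV2 ?posrE.
have n3i : 0 < n3^-1 by rewrite invr_gt0.
have t1 : `|n1 * B| <= M0 * D ^+ 3 * n2^-1 ^+ 2.
  rewrite normrM (gtr0_norm n10); apply: le_trans (_ : n1 * (M0 / (n1 * n2 * n3 * q ^+ 3)) <= _).
    by rewrite ler_pM2l.
  have -> : n1 * (M0 / (n1 * n2 * n3 * q ^+ 3)) = M0 * (q^-1 ^+ 3 * (n2^-1 * n3^-1)).
    by field; rewrite !gt_eqF.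
  rewrite -mulrA ler_wpM2l// ler_pM ?exprn_ge0 ?mulr_ge0// ?(ltW w0) ?(ltW n2i) ?(ltW n3i)//.
    by rewrite lerXn2r ?nnegrE// ltW.
  by rewrite expr2 ler_wpM2l// ltW.
have e2 : e <= 2 * D ^+ 2 * n2^-1 ^+ 2.
  apply: le_trans He _.
  have -> : 2 / (n2 * n3 * q ^+ 2) = 2 * (q^-1 ^+ 2 * (n2^-1 * n3^-1)) by field; rewrite !gt_eqF.
  rewrite -mulrA ler_wpM2l// ler_pM ?exprn_ge0 ?mulr_ge0// ?(ltW w0) ?(ltW n2i) ?(ltW n3i)//.
    by rewrite lerXn2r ?nnegrE// ltW.
  by rewrite expr2 ler_wpM2l// ltW.
have t2 : `|q^-1 + (2^-1 - c) * ((1 - q) / (n2 * q ^+ 2) + q^-1)| <= D + (1 + c1) * (D ^+ 2 + D).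
  have s1 : `|2^-1 - c| <= 1 + c1 by rewrite ler_norml; apply/andP; split; lra.
  have s2 : `|(1 - q) / (n2 * q ^+ 2) + q^-1| <= D ^+ 2 + D.
    have -> : (1 - q) / (n2 * q ^+ 2) = (1 - q) * n2^-1 * q^-1 ^+ 2 by field; rewrite !gt_eqF.
    have s3 : (1 - q) * n2^-1 <= 1 by nra.
    have s4 : 0 <= (1 - q) * n2^-1 by rewrite mulr_ge0 ?subr_ge0// ltW.
    have s5 : q^-1 ^+ 2 <= D ^+ 2 by rewrite lerXn2r ?nnegrE// ltW.
    have s6 := sqr_ge0 q^-1.
    have s7 := mulr_ge0 s4 s6.
    have s8 : (1 - q) * n2^-1 * q^-1 ^+ 2 <= q^-1 ^+ 2 by rewrite ler_piMl.
    by rewrite ger0_norm; lra.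
  apply: le_trans (ler_normD _ _) _; rewrite (gtr0_norm w0) lerD// normrM ler_pM//.
apply: le_trans (ler_normB _ _) _; rewrite addrC [leRHS]mulrDl; apply: lerD; last by rewrite -exprVn.
rewrite normrM (ger0_norm e0) -exprVn mulrAC ler_pM//.
Qed.

(** The derivative formula is integrated from q to 1, where the binomial mean is the single value ln
    (m + 1 + c). The expansion is in m + 2 because that is the denominator in the derivative. *)
Lemma log_mean (d c0 c1 : R) : 0 < d -> d <= 1 -> 0 < c0 -> 0 <= c1 -> exists2 M, 0 <= M &
  forall (c q : R) m, c0 <= c <= c1 -> d <= q <= 1 ->
  `|bern m.+1 (fun k => ln (k%:R + c)) q
    - (ln q + ln m.+2%:R + (c - 2^-1) / m.+2%:R * q^-1 - (2 * m.+2%:R)^-1)| <= M / m.+2%:R ^+ 2.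
Proof.
move=> d0 d1 c0p c1p; have [M M0 HM] := log_mean_derivative d0 d1 c0p c1p.
exists (M + 2 * (1 + c1) ^+ 2) => [|c q m cc /andP[dq q1]].
  by rewrite (addr_ge0 M0 (mulr_ge0 (ler0n _ 2) (sqr_ge0 _))).
have /andP[cl cu] := cc; have q0 : 0 < q by exact: lt_le_trans dq.
have N2 : (2 : R) <= m.+2%:R by rewrite ler_nat.
pose f (q : R) := bern m.+1 (fun k => ln (k%:R + c)) q - (ln q + (c - 2^-1) / m.+2%:R * q^-1).
have fE : `|f 1 - f q| <= M / m.+2%:R ^+ 2 * (1 - q).
  apply: (@mvt_bound f (fun q => m.+1%:R * bern m (fun k => ln (k.+1%:R + c) - ln (k%:R + c)) q
      - (q^-1 + (2^-1 - c) / (m.+2%:R * q ^+ 2))) _ _ _ q1) => x /andP[qx x1].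
    have x0 : 0 < x by exact: lt_le_trans qx.
    have D := is_derive_bern m.+1 (fun k => ln (k%:R + c)) x.
    set v := (X in is_derive _ _ _ X).
    have -> : v = m.+1%:R * bern m (fun k => ln (k.+1%:R + c) - ln (k%:R + c)) x
        - (x^-1 - (c - 2^-1) / m.+2%:R * x^-1 ^+ 2).
      rewrite /v; congr (_ - _); field.
      by rewrite !gt_eqF//; move: (ler0n R m); lra.
    exact: is_derive_sub_ln_inv x0 D.
  by apply: HM => //; rewrite (le_trans dq).
have fq : `|f q - f 1| <= M / m.+2%:R ^+ 2.
  rewrite distrC; apply: le_trans fE _; rewrite ler_piMr ?divr_ge0 ?sqr_ge0//; lra.
have y1 : - 2^-1 <= (c - 1) / m.+2%:R by rewrite ler_pdivlMr; lra.
have := ln_add1_linear y1.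
have e1 : 2 * ((c - 1) / m.+2%:R) ^+ 2 <= 2 * (1 + c1) ^+ 2 / m.+2%:R ^+ 2.
  rewrite expr_div_n -mulrA ler_pM2l// ler_pM2r ?invr_gt0 ?exprn_gt0//.
  by rewrite -ler_sqrt ?sqr_ge0// !sqrtr_sqr [leRHS]ger0_norm ?ler_norml; [apply/andP; split|]; lra.
move=> /le_trans/(_ e1); move: fq; rewrite /f bern_top invr1 ln1.
(* Expanding this logarithm gives (c - 1) / (m + 2), whose difference from (c - 1/2) / (m + 2) is
   the correction - 1 / (2 (m + 2)). *)
have -> : m.+1%:R + c = m.+2%:R * (1 + (c - 1) / m.+2%:R).
  by rewrite -[m.+2%:R]natr1 mulrDr mulr1 mulrCA divff ?mulr1; [ring|rewrite natr1].
have p1 : 0 < 1 + (c - 1) / m.+2%:R by move: y1; move: ((c - 1) / m.+2%:R) => y; lra.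
rewrite lnM ?posrE//.
have -> : (2 * m.+2%:R)^-1 = (c - 2^-1) / m.+2%:R - (c - 1) / m.+2%:R by field; move: (ler0n R m) => ?; rewrite gt_eqF//; lra.
rewrite [(M + _) / _]mulrDl.
set y := (c - 1) / _; set B := bern _ _ q; set z := (c - 2^-1) / _.
move: (ln (1 + y)) (ln m.+2%:R) (M / m.+2%:R ^+ 2) (2 * (1 + c1) ^+ 2 / m.+2%:R ^+ 2) => l1 l2 z1 z2.
clearbody y B z; rewrite !ler_norml => /andP[h1 h2] /andP[h3 h4].
apply/andP; split; lra.
Qed.

(** The factor s - t in the bound is the point, as this quantity will be divided by r = s - t. The
    mean value theorem for q (L q - ln q - ln n), with L the binomial mean of log, provides it. *)
Lemma log_mean_difference (d c0 c1 : R) : 0 < d -> d <= 1 -> 0 < c0 -> 0 <= c1 -> exists2 M, 0 <= M &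
  forall (c s t : R) n, (2 <= n)%N -> c0 <= c <= c1 -> d <= t -> t <= s -> s <= 1 ->
  `|s * (bern n (fun k => ln (k%:R + c)) s - ln s - ln n%:R)
    - t * (bern n (fun k => ln (k%:R + c)) t - ln t - ln n%:R)| <= M / n%:R * (s - t).
Proof.
move=> d0 d1 c0p c1p; have [M1 M10 HM1] := log_mean_derivative d0 d1 c0p c1p.
have [M2 M20 HM2] := log_mean d0 d1 c0p c1p.
exists (M2 + 1 + (1 + c1) / d + 1 + (1 + c1) / d + M1) => [|c s t n n2 cc dt ts s1].
  have : 0 <= (1 + c1) / d by apply: divr_ge0; lra.
  by move: (_ / d) => y y0; lra.
have /andP[cl cu] := cc.
case: n n2 => [//|m] n2.
pose f (q : R) := q * (bern m.+1 (fun k => ln (k%:R + c)) q - ln q - ln m.+1%:R).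
pose df (q : R) := (bern m.+1 (fun k => ln (k%:R + c)) q - ln q - ln m.+1%:R)
  + q * (m.+1%:R * bern m (fun k => ln (k.+1%:R + c) - ln (k%:R + c)) q - q^-1).
apply: (@mvt_bound f df _ _ _ ts) => x /andP[tx xs].
  have x0 : 0 < x by lra.
  exact: is_derive_mul_sub_ln x0 (is_derive_bern m.+1 (fun k => ln (k%:R + c)) x).
have x0 : 0 < x by lra.
have xd : d <= x <= 1 by apply/andP; split; lra.
have := HM1 c x m cc xd; have := HM2 c x m cc xd; rewrite /df.
move: (bern m.+1 _ _) (bern m _ _) => B B'.
have n0 : (0 : R) < m.+1%:R by [].
have -> : ln m.+2%:R = ln m.+1%:R + ln (1 + m.+1%:R^-1) :> R.
  rewrite -lnM ?posrE ?addr_gt0 ?invr_gt0//; congr ln.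
  by rewrite mulrDr mulr1 divff ?gt_eqF// natr1.
have i0 : 0 < (m.+1%:R : R)^-1 by rewrite invr_gt0.
have l0 : 0 <= ln (1 + (m.+1%:R : R)^-1) by rewrite ln_ge0// lerDl ltW.
have l1 : ln (1 + (m.+1%:R : R)^-1) <= m.+1%:R^-1 by rewrite le_ln1Dx// (lt_trans _ i0)// ltrN10.
have j0 : 0 < (m.+2%:R : R)^-1 by rewrite invr_gt0.
have ji : (m.+2%:R : R)^-1 <= m.+1%:R^-1 by rewrite lef_pV2 ?posrE// ler_nat.
have j1 : (m.+2%:R : R)^-1 <= 1 by rewrite invf_le1// ler1n.
have xi0 : 0 < x^-1 by rewrite invr_gt0.
have xD : x^-1 <= d^-1 by rewrite lef_pV2 ?posrE//; lra.
rewrite (invfM 2) (_ : (2^-1 - c) / (m.+2%:R * x ^+ 2) = (2^-1 - c) * (m.+2%:R^-1 * x^-1 ^+ 2)); last first.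
  by rewrite invfM exprVn.
rewrite -!(exprVn m.+2%:R).
have xx : x * x^-1 = 1 by rewrite divff ?gt_eqF.
set i := m.+1%:R^-1 in i0 l0 l1 ji *; set ll := ln (1 + i) in l0 l1 *.
set j := m.+2%:R^-1 in j0 ji j1 *; clearbody ll; clearbody i j.
move: (m.+1%:R : R) (ln m.+1%:R) => n ln1.
move: (ln x) (x^-1) xi0 xD xx => lx xi xi0 xD xx.
move=> H2 H1.
have jj : j ^+ 2 <= i by rewrite expr2; nra.
have cxi : `|(c - 2^-1) * j * xi| <= (1 + c1) / d * i.
  have cc1 : `|c - 2^-1| <= 1 + c1 by rewrite ler_norml; apply/andP; split; lra.
  have h := ler_pM (normr_ge0 _) (ltW xi0) cc1 xD.
  rewrite !normrM (gtr0_norm j0) (gtr0_norm xi0) mulrAC.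
  by apply: ler_pM (mulr_ge0 (normr_ge0 _) (ltW xi0)) (ltW j0) h ji.
(* The terms in c - 1/2 of the value and of x times the derivative are opposite, because x * xi =
   1. *)
have -> : B - lx - ln1 + x * (n * B' - xi) =
   (B - (lx + (ln1 + ll) + (c - 2^-1) * j * xi - 2^-1 * j)) + x * (n * B' - (xi + (2^-1 - c) * (j * xi ^+ 2)))
   + (ll - 2^-1 * j) + (1 - x * xi) * ((c - 2^-1) * j * xi) by ring.
rewrite xx subrr mul0r addr0.
have h1 : `|x * (n * B' - (xi + (2^-1 - c) * (j * xi ^+ 2)))| <= M1 * i.
  rewrite normrM (gtr0_norm x0); apply: le_trans (_ : 1 * (M1 * j ^+ 2) <= _).
    have x1 : x <= 1 by lra.
    exact: ler_pM (ltW x0) (normr_ge0 _) x1 H1.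
  by rewrite mul1r ler_wpM2l.
have h2 := le_trans H2 (ler_wpM2l M20 jj).
have h3 : `|ll - 2^-1 * j| <= i by rewrite ler_norml; apply/andP; split; lra.
apply: le_trans (ler_normD _ _) _; apply: le_trans (lerD (ler_normD _ _) h3) _.
have hc := le_trans (normr_ge0 _) cxi.
lra.
Qed.

End Bernstein.

(** * Binomial means of log Gamma *)

Section LogGammaMean.
Variable g : R -> R.
Hypothesis gS : forall x : R, 0 < x -> g (x + 1) = g x + ln x.
Hypothesis gStirling : forall b : R, exists C, forall (n : nat) (c : R), (0 < n)%N -> 0 <= c <= b ->
  `|g (n%:R + c) - ((n%:R + c - 2^-1) * ln n%:R - n%:R + (ln 2 + ln pi) / 2)| <= C / n%:R.

(** Since g has increments ln, the deviation [f] has derivative n times the error of [log_mean] in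
    degree n - 1, hence O(1/n). The [m.+2] of [log_mean] is exactly n here. *)
Lemma log_gamma_mean (d c0 c1 : R) : 0 < d -> d <= 1 -> 0 < c0 -> 0 <= c1 -> exists M,
  forall (c q : R) n, (2 <= n)%N -> c0 <= c <= c1 -> d <= q <= 1 ->
  `|bern n (fun k => g (k%:R + c)) q
    - (n%:R * (q * ln q) + (c - 2^-1) * ln q + q * (n%:R * ln n%:R - n%:R - 2^-1)
       + ((c - 2^-1) * ln n%:R + 2^-1 + (ln 2 + ln pi) / 2))| <= M / n%:R.
Proof.
move=> d0 d1 c0p c1p; have [M M0 HM] := log_mean d0 d1 c0p c1p.
have [C HC] := gStirling c1.
exists (C + M) => c q [//|[//|m]] _ cc /andP[dq q1].
have /andP[cl cu] := cc; have q0 : 0 < q by exact: lt_le_trans dq.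
have n0 : (0 : R) < m.+2%:R by [].
pose e := (c - 2^-1) * ln m.+2%:R + 2^-1 + (ln 2 + ln pi) / 2.
pose b := m.+2%:R * ln m.+2%:R - m.+2%:R - 2^-1 : R.
pose f (q : R) := bern m.+2 (fun k => g (k%:R + c)) q
  - (m.+2%:R * (q * ln q) + (c - 2^-1) * ln q + q * b + e).
pose df (q : R) := m.+2%:R * bern m.+1 (fun k => ln (k%:R + c)) q
  - (m.+2%:R * ln q + m.+2%:R + (c - 2^-1) * q^-1 + b).
have fE : `|f 1 - f q| <= M / m.+2%:R * (1 - q).
  apply: (@mvt_bound f df _ _ _ q1) => x /andP[qx x1].
    have x0 : 0 < x by exact: lt_le_trans qx.
    have D := is_derive_bern m.+2 (fun k => g (k%:R + c)) x.
    have E : bern m.+1 (fun k => ln (k%:R + c)) x = bern m.+1 (fun k => g (k.+1%:R + c) - g (k%:R + c)) x.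
      apply: eq_bern => k _; have kc : 0 < k%:R + c by move: (ler0n R k); lra.
      by rewrite -natr1 (_ : k%:R + 1 + c = k%:R + c + 1) ?gS//; ring.
    rewrite /df E; exact: is_derive_sub_entropy x0 D.
  have xd : d <= x <= 1 by rewrite (le_trans dq).
  have -> : df x = m.+2%:R * (bern m.+1 (fun k => ln (k%:R + c)) x
    - (ln x + ln m.+2%:R + (c - 2^-1) / m.+2%:R * x^-1 - (2 * m.+2%:R)^-1)).
    have x0 : 0 < x by lra.
    rewrite /df /b; field; rewrite gt_eqF//= gt_eqF//; move: (ler0n R m); lra.
  rewrite normrM (gtr0_norm n0); apply: le_trans (ler_wpM2l (ltW n0) (HM _ _ _ cc xd)) _.
  by rewrite le_eqVlt; apply/orP; left; apply/eqP; field; rewrite gt_eqF//; move: (ler0n R m); lra.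
have fq : `|f 1 - f q| <= M / m.+2%:R.
  by apply: le_trans fE _; rewrite ler_piMr ?divr_ge0//; lra.
have c01 : 0 <= c <= c1 by apply/andP; split; lra.
have := HC m.+2 c isT c01; move: fq; rewrite /f bern_top ln1 /b /e [(C + M) / _]mulrDl.
move: (C / _) (M / _) (bern _ _ _) (g _) (ln q) (ln m.+2%:R) (ln 2) (ln pi) => z1 z2 B G lq ln2' l2 lp.
rewrite !ler_norml => /andP[h1 h2] /andP[h3 h4]; apply/andP; split; lra.
Qed.

(** With F and L the binomial means of g and ln, reversal of the sums gives s G1 - t G2 = r (const +
    F s + F t) + (s L s - t L t). Only the last bracket is really divided by r, and
    [log_mean_difference] handles it. In the application c is 1 - u and G is [zeta_log]. *)
Lemma entropy_asymptotics (d c0 c1 : R) : 0 < d -> d <= 1 -> 0 < c0 -> 0 <= c1 -> exists M,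
  forall (c r lK s t : R) n (G : nat -> R), (2 <= n)%N -> c0 <= c <= c1 -> 0 < r -> r <= 1 - d ->
  s = (1 + r) / 2 -> t = (1 - r) / 2 ->
  (forall k, G k = lK + g ((n.+1 - k)%:R + c) + g (k%:R + c) - g (n%:R + (2 + 2 * c))) ->
  `|(s * bern n G t - t * bern n (fun k => G k.+1) t) / r
    - (lK + n%:R * (s * ln s + t * ln t) + c * (ln s + ln t) + 2^-1 + (ln 2 + ln pi) / 2
       - 3 / 2 * ln n%:R + (ln s - ln t) / (2 * r))| <= M / n%:R.
Proof.
move=> d0 d1 c0p c1p.
(* The smaller eigenvalue (1 - r) / 2 is at least d / 2. *)
have d20 : 0 < d / 2 by lra.
have d21 : d / 2 <= 1 by lra.
have [MF HF] := log_gamma_mean d20 d21 c0p c1p.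
have [ML ML0 HL] := log_mean_difference d20 d21 c0p c1p.
have [C HC] := gStirling (2 + 2 * c1).
exists (C + 2 * MF + ML) => c r lK s t n G n2 cc r0 r1 sE tE GE.
have /andP[cl cu] := cc.
have st : s - t = r by rewrite sE tE; field.
have sd : d / 2 <= s <= 1 by rewrite sE; apply/andP; split; lra.
have td : d / 2 <= t <= 1 by rewrite tE; apply/andP; split; lra.
have c2 : 0 <= 2 + 2 * c <= 2 + 2 * c1 by apply/andP; split; lra.
have n0 : (0 < n)%N by exact: leq_trans n2.
have nR : (0 : R) < n%:R by rewrite ltr0n.
have gk k : g (k.+1%:R + c) = g (k%:R + c) + ln (k%:R + c).
  have kc : 0 < k%:R + c by move: (ler0n R k); lra.
  by rewrite -natr1 (_ : k%:R + 1 + c = k%:R + c + 1) ?gS//; ring.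
pose F q := bern n (fun k => g (k%:R + c)) q.
pose L q := bern n (fun k => ln (k%:R + c)) q.
have FL q : bern n (fun k => g (k.+1%:R + c)) q = F q + L q.
  by rewrite /F /L -bernD; apply: eq_bern => k _.
have ts : t = 1 - s by rewrite sE tE; field.
have G1 : bern n G t = lK - g (n%:R + (2 + 2 * c)) + (F s + L s) + F t.
  rewrite -FL /F -[lK - _](bern_cst n _ t) (_ : bern n (fun k => g (k.+1%:R + c)) s =
      bern n (fun k => g ((n.+1 - k)%:R + c)) t).
    by rewrite -!bernD; apply: eq_bern => k _; rewrite GE; ring.
  rewrite ts bern_rev; apply: eq_bern => k kn.
  by rewrite (subSn (leq_subr k n)) (subKn kn).
have G2 : bern n (fun k => G k.+1) t = lK - g (n%:R + (2 + 2 * c)) + F s + (F t + L t).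
  rewrite -FL -[lK - _](bern_cst n _ t) (_ : F s = bern n (fun k => g ((n - k)%:R + c)) t).
    by rewrite -!bernD; apply: eq_bern => k _; rewrite GE subSS; ring.
  by rewrite ts bern_rev; apply: eq_bern => k kn; rewrite (subKn kn).
rewrite G1 G2.
have hs := HF c s n n2 cc sd; have ht := HF c t n n2 cc td.
have hL : `|(s * (L s - ln s - ln n%:R) - t * (L t - ln t - ln n%:R)) / r| <= ML / n%:R.
  have /andP[_ s1] := sd; have /andP[t1 _] := td.
  have := HL c s t n n2 cc t1; rewrite st => H.
  by rewrite normrM normfV (gtr0_norm r0) ler_pdivrMr// H//; lra.
have hg := HC n (2 + 2 * c) n0 c2.
move: hs ht hL hg; rewrite -/(F s) -/(F t) !(mulrDl _ _ (n%:R^-1)) -[2 * MF / _]mulrA.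
move: (F s) (F t) (L s) (L t) (g _) => Fs Ft Ls Lt G0.
move: (C / _) (ML / _) (MF / _) => z1 z2 z3.
move: (ln s) (ln t) (ln n%:R) => lns lnt lnn.
set A1 := Fs - _; set A2 := Ft - _; set A3 := (_ / r); set A4 := G0 - _ => hs ht hL hg.
set E := (X in `|X|).
have -> : E = A1 + A2 - A4 + A3.
  by rewrite /E /A1 /A2 /A3 /A4 sE tE; field; rewrite gt_eqF.
move: hs ht hL hg; rewrite !ler_norml => /andP[h1 h2] /andP[h3 h4] /andP[h5 h6] /andP[h7 h8].
apply/andP; split; lra.
Qed.

End LogGammaMean.
End Asymptotics.

(** * Asymptotics of the relative entropy *)

Section Redundancy.
Variable R : realType.
Implicit Types (u r : R) (n : nat).

Let lnMgt0 (x y : R) : 0 < x -> 0 < y -> ln (x * y) = ln x + ln y.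
Proof. by move=> x0 y0; rewrite lnM ?posrE. Qed.

Let lnVgt0 (x y : R) : 0 < x -> 0 < y -> ln (x / y) = ln x - ln y.
Proof. by move=> x0 y0; rewrite ln_div ?posrE. Qed.

Let lnGammaS (x : R) : 0 < x -> ln (Gamma (x + 1)) = ln (Gamma x) + ln x.
Proof. by move=> x0; rewrite GammaS// lnM ?posrE ?Gamma_gt0// addrC. Qed.

Let lnGamma_add_le (x c : R) : 0 < x -> 0 <= c <= 1 ->
  ln (Gamma (x + c)) <= c * ln x + ln (Gamma x).
Proof.
move=> x0 c01; have /andP[c0 c1] := c01.
have xc : 0 < x + c by lra.
rewrite -ln_powR -lnM ?posrE ?powR_gt0 ?Gamma_gt0//.
rewrite ler_ln ?posrE ?mulr_gt0 ?powR_gt0 ?Gamma_gt0//; exact: Gamma_add_le.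
Qed.

Let lnGamma1 : ln (Gamma (1 : R)) = 0.
Proof. by rewrite Gamma1 ln1. Qed.

Let lnGamma_half : ln (Gamma (2^-1 : R)) = ln pi / 2.
Proof. by rewrite Gamma_half -powR12_sqrt ?pi_ge0// ln_powR mulrC. Qed.

Let lnGamma_stirling := stirling lnGammaS lnGamma_add_le lnGamma1 lnGamma_half.
Let lnGamma_entropy := entropy_asymptotics lnGammaS lnGamma_stirling.

Definition lnK u : R := ln (prior_const u * (pi * (2 * 4 `^ (1 - u)))).

Lemma lnKE u : u < 1 ->
  lnK u = ln (Gamma (5 / 2 - u)) - ln (Gamma (1 - u)) - ln pi / 2 + ln 2 + 2 * (1 - u) * ln 2.
Proof.
move=> u1; have G1 : 0 < Gamma (1 - u) by apply: Gamma_gt0; lra.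
have G2 : 0 < Gamma (5 / 2 - u) by apply: Gamma_gt0; lra.
have p0 : 0 < pi :> R by exact: pi_gt0.
have p32 : 0 < (pi : R) `^ (3 / 2) by rewrite powR_gt0.
have c4 : 0 < (4 : R) `^ (1 - u) by rewrite powR_gt0.
have lnE (A P G q e : R) : 0 < A -> 0 < P -> 0 < G -> 0 < q -> 0 < e ->
    ln (A / (P * G) * (q * (2 * e))) = ln A - (ln P + ln G) + (ln q + (ln 2 + ln e)).
  move=> A0 P0 G0 q0 e0; have PG := mulr_gt0 P0 G0; have t0 : (0 : R) < 2 by [].
  rewrite (lnMgt0 (divr_gt0 A0 PG) (mulr_gt0 q0 (mulr_gt0 t0 e0))) (lnVgt0 A0 PG) (lnMgt0 P0 G0).
  by rewrite (lnMgt0 q0 (mulr_gt0 t0 e0)) (lnMgt0 t0 e0).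
rewrite /lnK /prior_const lnE// !ln_powR.
have -> : ln 4 = ln 2 + ln 2 :> R by rewrite -lnM ?posrE//; congr ln; ring.
by move: (ln (Gamma _)) (ln (Gamma _)) => a b; field.
Qed.

Lemma zeta_logE u n k : u < 1 -> zeta_log u n k =
  lnK u + ln (Gamma ((n.+1 - k)%:R + (1 - u))) + ln (Gamma (k%:R + (1 - u)))
  - ln (Gamma (n%:R + (2 + 2 * (1 - u)))).
Proof.
move=> u1; have k0 : 0 < prior_const u * (pi * (2 * 4 `^ (1 - u))).
  apply: mulr_gt0; first exact: prior_const_gt0.
  have c4 : 0 < (4 : R) `^ (1 - u) by rewrite powR_gt0.
  by apply: mulr_gt0; [exact: pi_gt0|rewrite mulr_gt0].
have G1 : 0 < Gamma ((n.+1 - k)%:R + (1 - u)) by apply: Gamma_gt0; move: (ler0n R (n.+1 - k)); lra.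
have G2 : 0 < Gamma (k%:R + (1 - u)) by apply: Gamma_gt0; move: (ler0n R k); lra.
have G3 : 0 < Gamma (n%:R + (2 + 2 * (1 - u))) by apply: Gamma_gt0; move: (ler0n R n); lra.
rewrite /zeta_log -(addrA (n.+1 - k)%:R 1) -(addrA k%:R 1) (_ : n%:R + 4 - 2 * u = n%:R + (2 + 2 * (1 - u))); last by ring.
have lnE (A P G q : R) : 0 < A -> 0 < P -> 0 < G -> 0 < q ->
    ln (A * (P * G / q)) = ln A + ln P + ln G - ln q.
  move=> A0 P0 G0 q0; have PG := mulr_gt0 P0 G0.
  by rewrite (lnMgt0 A0 (divr_gt0 PG q0)) (lnVgt0 PG q0) (lnMgt0 P0 G0) !addrA.
exact: (lnE _ _ _ _ k0 G1 G2 G3).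
Qed.

Lemma ball_asymptotics (d a b : R) : 0 < d -> d <= 1 -> b < 1 -> exists M,
  forall u r n (l : nat -> R), (2 <= n)%N -> a <= u <= b -> 0 < r -> r <= 1 - d ->
  let s := (1 + r) / 2 in let t := (1 - r) / 2 in
  (s - t) * (\sum_(k < n.+1) s ^+ (n - k) * t ^+ k * l k) =
     s * bern n (zeta_log u n) t - t * bern n (fun k => zeta_log u n k.+1) t ->
  `|n%:R * (s * ln s + t * ln t) - \sum_(k < n.+1) s ^+ (n - k) * t ^+ k * l k
    - mixed_asymp u r n| <= M / n%:R.
Proof.
move=> d0 d1 b1.
have b0 : 0 < 1 - b by lra.
have a0 : 0 <= 1 + `|a| by rewrite addr_ge0.
have [M HM] := lnGamma_entropy d0 d1 b0 a0.
exists M => u r n l n2 /andP[au ub] r0 r1.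
have u1 : u < 1 := le_lt_trans ub b1.
(* The shift c = 1 - u stays in a compact set of positive reals; b < 1 keeps it away from the pole
   of Gamma at 0. *)
have cc : 1 - b <= 1 - u <= 1 + `|a|.
  by have := ler_norm (- a); rewrite normrN => ?; apply/andP; split; lra.
have rn : r != 0 by rewrite gt_eqF.
have p1 : 0 < 1 + r by lra.
have p2 : 0 < 1 - r by lra.
move=> s t; have st : s - t = r by rewrite /s /t; field.
rewrite st; set S := \sum_(k < _) _ => H.
have := HM (1 - u) r (lnK u) s t n (zeta_log u n) n2 cc r0 r1 erefl erefl (fun k => zeta_logE n k u1).
rewrite -H (mulrC r) mulfK ?gt_eqF// distrC.
set T := (X in `|X - S|).
suff -> : n%:R * (s * ln s + t * ln t) - S - mixed_asymp u r n = T - S by [].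
rewrite /T /mixed_asymp (negbTE rn) lnKE//.
have -> : 1 - r ^+ 2 = (1 - r) * (1 + r) by ring.
have t2 : (0 : R) < 2 by [].
rewrite /s /t (lnMgt0 p2 p1) (lnVgt0 p1 t2) (lnVgt0 p2 t2) (lnVgt0 p2 p1).
move: (ln (1 + r)) (ln (1 - r)) (ln (Gamma _)) (ln (Gamma _)) S H => l1 l2 g1 g2 S H.
by field.
Qed.

(** With y = 2 r / (1 - r), the bounds y / (1 + y) <= ln (1 + y) <= y squeeze the slope between - 1
    / (1 - r) and - 1 / (1 + r). *)
Lemma log_slope_cvg :
  1 / (2 * r) * ln ((1 - r) / (1 + r)) @[r --> (0 : R)^'+] --> (-1 : R).
Proof.
have cv1 : - (1 - r)^-1 @[r --> (0 : R)^'+] --> (-1 : R).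
  apply: cvg_at_right_filter; have -> : (-1 : R) = - (1 - 0)^-1 by rewrite subr0 invr1.
  by apply: cvgN; apply: cvgV; [rewrite subr0 oner_neq0|apply: cvgB; [exact: cvg_cst|exact: cvg_id]].
have cv2 : - (1 + r)^-1 @[r --> (0 : R)^'+] --> (-1 : R).
  apply: cvg_at_right_filter; have -> : (-1 : R) = - (1 + 0)^-1 by rewrite addr0 invr1.
  by apply: cvgN; apply: cvgV; [rewrite addr0 oner_neq0|apply: cvgD; [exact: cvg_cst|exact: cvg_id]].
apply: squeeze_cvgr cv1 cv2; near=> r.
have r0 : 0 < r by near: r; exact: nbhs_right_gt.
have r1 : r < 1 by near: r; exact: nbhs_right_lt.
have p1 : 0 < 1 + r by lra.
have p2 : 0 < 1 - r by lra.
have h : -1 < 2 * r / (1 - r) by rewrite (@lt_trans _ _ 0)// ?ltrN10// divr_gt0// mulr_gt0.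
have -> : (1 - r) / (1 + r) = (1 + 2 * r / (1 - r))^-1.
  by rewrite -(invf_div (1 + r)); congr (_^-1); field; rewrite gt_eqF.
have q0 : 0 < 1 + 2 * r / (1 - r) by lra.
rewrite lnV ?posrE//; have := le_ln1Dx h; have := ln_add1_ge h.
have -> : 2 * r / (1 - r) / (1 + 2 * r / (1 - r)) = 2 * r / (1 + r).
  by field; rewrite !gt_eqF//; lra.
move: (ln _) => y h1 h2; rewrite mul1r mulrN; apply/andP; split.
  by rewrite lerN2 ler_pdivrMl ?mulr_gt0.
by rewrite lerN2 ler_pdivlMl ?mulr_gt0.
Unshelve. all: by end_near.
Qed.

Lemma mixed_asymp_cvg u n : mixed_asymp u r n @[r --> (0 : R)^'+] --> center_asymp u n.
Proof.
pose f r := 3 / 2 * ln n%:R - 1 / 2 - 3 / 2 * ln 2 - (1 - u) * ln (1 - r ^+ 2)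
  + 1 / (2 * r) * ln ((1 - r) / (1 + r)) + ln (Gamma (1 - u)) - ln (Gamma (5 / 2 - u)).
apply: (@cvg_trans _ (f r @[r --> (0 : R)^'+])).
  apply: near_eq_cvg; near=> r; have r0 : 0 < r by near: r; exact: nbhs_right_gt.
  by rewrite /f /mixed_asymp gt_eqF.
have -> : center_asymp u n = 3 / 2 * ln n%:R - 1 / 2 - 3 / 2 * ln 2 - (1 - u) * ln (1 - 0 * 0)
  + -1 + ln (Gamma (1 - u)) - ln (Gamma (5 / 2 - u)).
  rewrite /center_asymp mulr0 subr0 ln1.
  by move: (ln (Gamma _)) (ln (Gamma _)) => g1 g2; field.
apply: cvgB; last exact: cvg_cst; apply: cvgD; last exact: cvg_cst.
apply: cvgD; last exact: log_slope_cvg.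
apply: cvgB; first exact: cvg_cst; apply: cvgM; first exact: cvg_cst.
apply: cvg_at_right_filter.
apply: (@cvg_comp _ _ _ (fun r => 1 - r ^+ 2) (@ln R) _ (nbhs (1 - 0 * 0 : R))); last first.
  by apply: continuous_ln; rewrite mulr0 subr0.
by apply: cvgB; [exact: cvg_cst|apply: cvgM; exact: cvg_id].
Unshelve. all: by end_near.
Qed.

Lemma entropy_sum_cvg n (l : nat -> R) :
  let f r := n%:R * ((1 + r) / 2 * ln ((1 + r) / 2) + (1 - r) / 2 * ln ((1 - r) / 2))
    - \sum_(k < n.+1) ((1 + r) / 2) ^+ (n - k) * ((1 - r) / 2) ^+ k * l k in
  f r @[r --> (0 : R)^'+] --> f 0.
Proof.
move=> f; apply: cvg_at_right_filter.
have cs : (1 + r) / 2 @[r --> (0 : R)] --> (1 + 0) / (2 : R).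
  by apply: cvgM; [apply: cvgD; [exact: cvg_cst|exact: cvg_id]|exact: cvg_cst].
have ct : (1 - r) / 2 @[r --> (0 : R)] --> (1 - 0) / (2 : R).
  by apply: cvgM; [apply: cvgB; [exact: cvg_cst|exact: cvg_id]|exact: cvg_cst].
have cX (h : R -> R) (y : R) (m : nat) : h r @[r --> (0 : R)] --> y -> h r ^+ m @[r --> (0 : R)] --> y ^+ m.
  move=> hy; elim: m => [|m IHm]; first by under eq_fun do rewrite expr0; rewrite expr0; exact: cvg_cst.
  by under eq_fun do rewrite exprS; rewrite exprS; exact: cvgM.
have cl (h : R -> R) (y : R) : 0 < y -> h r @[r --> (0 : R)] --> y -> ln (h r) @[r --> (0 : R)] --> ln y.
  by move=> y0 hy; apply: (cvg_comp _ _ hy); exact: continuous_ln.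
apply: cvgB.
  apply: cvgM; first exact: cvg_cst; apply: cvgD; apply: cvgM => //; apply: cl => //; lra.
have sumc (e : seq 'I_n.+1) (F : 'I_n.+1 -> R -> R) :
    (forall k, F k r @[r --> (0 : R)] --> F k 0) ->
    \sum_(k <- e) F k r @[r --> (0 : R)] --> \sum_(k <- e) F k 0.
  move=> Fc; elim: e => [|k e IHe].
    by under eq_fun do rewrite big_nil; rewrite big_nil; exact: cvg_cst.
  by under eq_fun do rewrite big_cons; rewrite big_cons; exact: cvgD.
apply: (sumc _ (fun k r => ((1 + r) / 2) ^+ (n - k) * ((1 - r) / 2) ^+ k * l k)) => k.
by apply: cvgM; [apply: cvgM; exact: cX|exact: cvg_cst].
Qed.

Lemma mixed_asymp0 u n : mixed_asymp u 0 n = center_asymp u n.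
Proof.
rewrite /mixed_asymp eqxx expr0n subr0 ln1 /center_asymp.
by move: (ln (Gamma _)) (ln (Gamma _)) => g1 g2; field.
Qed.

(** For r > 0 this is [ball_asymptotics]; its constant does not depend on r, so the bound passes to
    the limit r -> 0 at fixed n. *)
Lemma redundancy_mixed (eps a b : R) : 0 < eps -> b < 1 -> exists M,
  forall u (p : R * R * R) n, (2 <= n)%N -> a <= u <= b -> norm3 p <= 1 - eps ->
  `|redundancy u p n - mixed_asymp u (norm3 p) n| <= M / n%:R.
Proof.
(* [eps] may exceed 1, while the estimates need d <= 1; with d <= 1/2, small positive r also satisfy
   r <= 1 - d. *)
move=> e0 b1; pose d := Num.min eps 2^-1.
have d0 : 0 < d by rewrite lt_min e0/=; lra.
have d2 : d <= 2^-1 by rewrite ge_min lexx orbT.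
have de : d <= eps by rewrite ge_min lexx.
have d1 : d <= 1 by lra.
have [M HM] := ball_asymptotics a d0 d1 b1.
exists M => u p n n2 uab p1; have /andP[_ ub] := uab; have u1 : u < 1 := le_lt_trans ub b1.
have [l [Hl Hb]] := redundancy_sum u1 n.
have r0 : 0 <= norm3 p := sqrtr_ge0 _.
have r1 : norm3 p <= 1 by rewrite (le_trans p1)// gerBl ltW.
have rd : norm3 p <= 1 - d by rewrite (le_trans p1)// lerB.
rewrite (Hl p r1) /=; move: (norm3 p) r0 rd {p1 r1 Hl} => r r0 rd.
have half (x : R) : (1 + x) / 2 + (1 - x) / 2 = 1 by field.
have pos x : 0 < x -> x <= 1 - d -> _ := fun x0 x1 =>
  HM u x n l n2 uab x0 x1 (Hb _ _ (half x)).
move: r0; rewrite le_eqVlt => /predU1P[<-|r0]; last exact: pos.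
rewrite mixed_asymp0.
have cD := cvg_norm (cvgB (@entropy_sum_cvg n l) (@mixed_asymp_cvg u n)).
apply: (cvgr_to_le (cD _ _)); near=> x; apply: pos; first by near: x; exact: nbhs_right_gt.
by near: x; apply: nbhs_right_le; lra.
Unshelve. all: by end_near.
Qed.

(** At s = 1 and t = 0 the entropy term is 0 and the Bernstein difference is the value at k = 0.
    There ln Gamma (1 - u) cancels against the normalization of the prior, which is why the bound is
    uniform up to u = 1. *)
Lemma redundancy_pure (a : R) : exists M,
  forall u (p : R * R * R) n, (1 <= n)%N -> a <= u < 1 -> norm3 p = 1 ->
  `|redundancy u p n - pure_asymp u n| <= M / n%:R.
Proof.
(* The bound covers both shifts 2 - u and 4 - 2 u for a <= u < 1; the two uses of Stirling's formula
   give 2 C. *)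
have [C HC] := lnGamma_stirling (4 + 2 * `|a|).
exists (2 * C) => u p n n1 /andP[au u1] p1.
have [l [Hl Hb]] := redundancy_sum u1 n.
have r1 : norm3 p <= 1 by rewrite p1.
have := Hl p r1; rewrite /= p1 => ->.
have h : (1 + 1) / 2 = 1 :> R by field.
rewrite h subrr mul0r ln1 mulr0 mul0r addr0 mulr0 sub0r.
have := Hb 1 0 (addr0 1); rewrite subr0 mul1r => ->.
rewrite mul1r mul0r subr0 bern_bot zeta_logE// subn0.
have aN : - a <= `|a| by rewrite -normrN ler_norm.
have c1 : 0 <= 1 + (1 - u) <= 4 + 2 * `|a| by apply/andP; split; lra.
have c2 : 0 <= 2 + 2 * (1 - u) <= 4 + 2 * `|a| by apply/andP; split; lra.
have H1 := HC n _ n1 c1; have H2 := HC n _ n1 c2.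
have arith (g1 g2 g3 g4 z lnn l2 lp N : R) :
    `|g1 - ((N + (1 + (1 - u)) - 2^-1) * lnn - N + (l2 + lp) / 2)| <= z ->
    `|g2 - ((N + (2 + 2 * (1 - u)) - 2^-1) * lnn - N + (l2 + lp) / 2)| <= z ->
    `|- (g3 - g4 - lp / 2 + l2 + 2 * (1 - u) * l2 + g1 + g4 - g2)
      - ((2 - u) * lnn + (2 * u - 3) * l2 + 1 / 2 * lp - g3)| <= 2 * z.
  rewrite !ler_norml => /andP[h1 h2] /andP[h3 h4]; apply/andP; split; lra.
rewrite lnKE// add0r /pure_asymp -[2 * C / _]mulrA -(natr1 n) -(addrA n%:R 1).
exact: arith H1 H2.
Qed.

Lemma eqO_inv_nat (f : nat -> R) (C : R) : (forall n, (2 <= n)%N -> `|f n| <= C / n%:R) ->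
  f =O_\oo (fun n : nat => n%:R^-1 : R).
Proof.
move=> fC; apply/eqO_exP; exists (`|C| + 1); first by rewrite ltr_wpDl.
near=> n; have n2 : (2 <= n)%N by near: n; exact: nbhs_infty_ge.
have -> : `|(n%:R : R)^-1| = n%:R^-1 by rewrite ger0_norm ?invr_ge0.
apply: (le_trans (fC n n2)); apply: ler_wpM2r; first by rewrite invr_ge0.
by have := ler_norm C; lra.
Unshelve. all: by end_near.
Qed.

End Redundancy.

Theorem theorem9 (R : realType) :
  (* fixed u < 1 and fixed r, 0 <= r < 1 *)
  (forall (u : R) (p : R * R * R), u < 1 -> norm3 p < 1 ->
     (fun n : nat => redundancy u p n - mixed_asymp u (norm3 p) n)
       =O_\oo (fun n : nat => n%:R^-1 : R))
  /\
  (* r = 0: the limit of the expression as r decreases to 0 *)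
  (forall (u : R), u < 1 ->
     (forall n : nat, mixed_asymp u r n @[r --> 0^'+] --> center_asymp u n) /\
     (forall p : R * R * R, norm3 p = 0 ->
        (fun n : nat => redundancy u p n - center_asymp u n)
          =O_\oo (fun n : nat => n%:R^-1 : R)))
  /\
  (* uniformity in r <= 1 - eps and, locally, in u *)
  (forall eps a b : R, 0 < eps -> b < 1 ->
     exists C : R, \forall n \near \oo,
       forall (u : R) (p : R * R * R), a <= u <= b -> norm3 p <= 1 - eps ->
         `|redundancy u p n - mixed_asymp u (norm3 p) n| <= C / n%:R)
  /\
  (* r = 1 *)
  (forall (u : R) (p : R * R * R), u < 1 -> norm3 p = 1 ->
     (fun n : nat => redundancy u p n - pure_asymp u n)
       =O_\oo (fun n : nat => n%:R^-1 : R))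
  /\
  (* r = 1: uniformity in u, away from -oo *)
  (forall a : R,
     exists C : R, \forall n \near \oo,
       forall (u : R) (p : R * R * R), a <= u < 1 -> norm3 p = 1 ->
         `|redundancy u p n - pure_asymp u n| <= C / n%:R).
Proof.
have mixed (u : R) (p : R * R * R) : u < 1 -> norm3 p < 1 ->
    (fun n : nat => redundancy u p n - mixed_asymp u (norm3 p) n)
       =O_\oo (fun n : nat => n%:R^-1 : R).
  move=> u1 p1; have e0 : 0 < 1 - norm3 p by rewrite subr_gt0.
  (* The statement for fixed u and r is the uniform bound with a = b = u and eps = 1 - r. *)
  have [C HC] := redundancy_mixed u e0 u1; apply: (eqO_inv_nat (C := C)) => n n2.
  by apply: HC => //; [rewrite lexx|rewrite subKr].
split; first exact: mixed.
split.
  move=> u u1; split => [n|p p0]; first exact: mixed_asymp_cvg.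
  have p1 : norm3 p < 1 by rewrite p0.
  by have := mixed u p u1 p1; rewrite p0; under eq_fun do rewrite mixed_asymp0.
split.
  move=> eps a b e0 b1; have [C HC] := redundancy_mixed a e0 b1; exists C.
  by near=> n => u p uab p1; apply: HC => //; near: n; exact: nbhs_infty_ge.
split.
  move=> u p u1 p1; have [C HC] := redundancy_pure u; apply: (eqO_inv_nat (C := C)) => n n2.
  by apply: HC => //; [exact: ltnW|rewrite lexx].
move=> a; have [C HC] := redundancy_pure a; exists C.
by near=> n => u p ua p1; apply: HC => //; near: n; exact: nbhs_infty_ge.
Unshelve. all: by end_near.
Qed.
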